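(* Let $m_1\ge\dots\ge m_n=0$ be integers, and consider shift vectors $\gamma$ corresponding to all possible Gelfand-Tsetlin diagrams with upper row $[m_1,\dots,m_n]$ (one for each diagram). Then the functions $F_\gamma(A)$ of the independent variables $A_X$ form a base in the representation of the algebra $\mathfrak{gl}_n$ with the highest vector $$\frac{A_{1}^{m_{1}-m_{2}}}{(m_1-m_2)!}\frac{A_{1,2}^{m_{2}-m_{3}}}{(m_2-m_3)!}\cdots\frac{A_{1,2,\dots,n-1}^{m_{n-1}}}{m_{n-1}!},$$ where the generators of the algebra act by the rule $E_{i,j}F_\gamma(A)=\sum_XA_{i,X}F_{\gamma-e_{j,X}}(A)$, i.e. by the operators $E_{i,j}=\sum_XA_{i,X}\frac{\partial}{\partial A_{j,X}}$ (sums over $X\subset\{1,\dots,n\}$ containing neither $i$ nor $j$).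
   Context: Fix $n\ge 2$, let $N=2^n-2$, and index coordinates of $\mathbb{Z}^N$ by the nonempty proper subsets $X\subset\{1,\dots,n\}$; $e_X$ are unit vectors, $A=(A_X)$ independent variables. $A_{i_1,\dots,i_l}$ is skew-symmetric in its indices and equals $A_{\{i_1,\dots,i_l\}}$ for $i_1<\dots<i_l$ (so in the rule for $E_{i,j}$ signs are taken accordingly); $\mathfrak{gl}_n$ acts on polynomials in $A$ by derivations, $E_{i,j}$ replacing the index $j$ by $i$. The representation in question is the irreducible submodule of $\mathbb{C}[A]$ generated by the highest vector. The lattice $B\subset\mathbb{Z}^N$ consists of all $v$ with $\sum_{X:\,|X\cap\{1,\dots,q\}|\ge p}v_X=0$ for all $1\le p\le q\le n$. For $1\le i<j<x\le n$ and $X$ (possibly empty) with all elements greater than $x$, put $v_+=e_{1,\dots,i-1,i,X}+e_{1,\dots,i-1,j,x,X}$, $v_-=e_{1,\dots,i-1,j,X}+e_{1,\dots,i-1,i,x,X}$, $v_0=e_{1,\dots,i-1,x,X}+e_{1,\dots,i-1,i,j,X}$ (juxtaposition means union of sets). Enumerate these quadruples by $\alpha=1,\dots,k$; $v^\alpha=v^\alpha_+-v^\alpha_-$ (these form a base of $B$), $r^\alpha=v^\alpha_0-v^\alpha_+$; $tv=\sum_\alpha t_\alpha v^\alpha$, $sr=\sum_\alpha s_\alpha r^\alpha$. Notation: $A^x=\prod_XA_X^{x_X}$, $x!=\prod_Xx_X!$, $1/m!=0$ for negative integers $m$; for $s\in\mathbb{Z}^k_{\ge0}$, $s!=\prod_\alpha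 s_\alpha!$, $(-1)^s=(-1)^{\sum s_\alpha}$. Define $$J^s_\gamma(A)=\sum_{t\in\mathbb{Z}^k}\frac{\prod_\alpha(t_\alpha+1)\cdots(t_\alpha+s_\alpha)}{(\gamma+tv)!}A^{\gamma+tv},\qquad F_\gamma(A)=\sum_{s\in\mathbb{Z}^k_{\ge0}}\frac{(-1)^s}{s!}J^s_{\gamma-sr}(A).$$ A Gelfand-Tsetlin diagram with upper row $[m_1,\dots,m_n]$ is an array of integers $m_{p,q}$, $1\le p\le q\le n$, with $m_{p,n}=m_p$ and $m_{p,q+1}\ge m_{p,q}\ge m_{p+1,q+1}$. The set of $x\in\mathbb{Z}^N$ with $\sum_{X:\,|X\cap\{1,\dots,q\}|\ge p}x_X=m_{p,q}$ for all $1\le p\le q\le n$ is of the form $\gamma+B$; a shift vector of the diagram is any such $\gamma$. *)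

(* Defs.v *)
(* classical_sets comes first so that set0 and setT are those of finset *)
From mathcomp Require Import boolp classical_sets functions cardinality fsbigop.
From mathcomp Require Import all_boot all_order all_algebra.
From mathcomp Require Import mpoly.

Set Implicit Arguments.
Unset Strict Implicit.
Unset Printing Implicit Defensive.

Import Order.TTheory GRing.Theory Num.Theory.
Local Open Scope ring_scope.

(* Indices are 0-based: i : 'I_n stands for the element i + 1 of {1, ..., n},
   and the entry (p, q) below stands for (p + 1, q + 1). *)

Definition pset (n : nat) := {X : {set 'I_n} | (X != set0) && (X != setT)}.

Definition zvec (n : nat) := {ffun pset n -> int}.

(* Zero when Y is not a nonempty proper subset. *)
Definition evec (n : nat) (Y : {set 'I_n}) : zvec n :=
  [ffun X => (val X == Y)%:R].

(* (i, j, x, X) with i < j < x and all the elements of X greater than x *)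
Definition is_quad (n : nat) (a : 'I_n * 'I_n * 'I_n * {set 'I_n}) : bool :=
  let: (i, j, x, X) := a in
  [&& (i < j)%N, (j < x)%N & [forall y in X, (x < y)%N]].

Definition quad (n : nat) :=
  {a : 'I_n * 'I_n * 'I_n * {set 'I_n} | is_quad a}.

Definition initset (n i : nat) : {set 'I_n} := [set y : 'I_n | (y < i)%N].

Definition vplus (n : nat) (a : quad n) : zvec n :=
  let: (i, j, x, X) := val a in let W := initset n i :|: X in
  evec ([set i] :|: W) + evec ([set j; x] :|: W).

Definition vminus (n : nat) (a : quad n) : zvec n :=
  let: (i, j, x, X) := val a in let W := initset n i :|: X in
  evec ([set j] :|: W) + evec ([set i; x] :|: W).

Definition vzero (n : nat) (a : quad n) : zvec n :=
  let: (i, j, x, X) := val a in let W := initset n i :|: X in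
  evec ([set x] :|: W) + evec ([set i; j] :|: W).

Definition vvec (n : nat) (a : quad n) : zvec n := vplus a - vminus a.
Definition rvec (n : nat) (a : quad n) : zvec n := vzero a - vplus a.

Definition tv (n : nat) (t : {ffun quad n -> int}) : zvec n :=
  \sum_a vvec a *~ t a.
Definition sr (n : nat) (s : {ffun quad n -> nat}) : zvec n :=
  \sum_a rvec a *+ s a.

Definition Cpoly (K : fieldType) (n : nat) := {mpoly K[#|{: pset n}|]}.

(* The full set carries no variable: Aset setT = 0 and dset setT = 0. *)
Definition Aset (K : fieldType) (n : nat) (Y : {set 'I_n}) : Cpoly K n :=
  if (insub Y : option (pset n)) is Some X then 'X_(enum_rank X) else 0.
Definition dset (K : fieldType) (n : nat) (Y : {set 'I_n}) (f : Cpoly K n) :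
    Cpoly K n :=
  if (insub Y : option (pset n)) is Some X then f^`M(enum_rank X) else 0.

Fixpoint ninv (n : nat) (l : seq 'I_n) : nat :=
  (if l is i :: l' then count (fun y : 'I_n => y < i) l' + ninv l' else 0)%N.

Definition skew_sign (K : fieldType) (n : nat) (l : seq 'I_n) : K :=
  if uniq l then (-1) ^+ ninv l else 0.

(* A_{i_1, ..., i_l}, skew-symmetric in the indices, and the corresponding
   derivation; for a set X, enum X is increasing, so that i :: enum X is the
   index sequence i, X. *)
Definition Aseq (K : fieldType) (n : nat) (l : seq 'I_n) : Cpoly K n :=
  skew_sign K l *: Aset K [set y in l].
Definition dseq (K : fieldType) (n : nat) (l : seq 'I_n) (f : Cpoly K n) :
    Cpoly K n :=
  skew_sign K l *: dset [set y in l] f.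

Definition Eop (K : fieldType) (n : nat) (i j : 'I_n) (f : Cpoly K n) :
    Cpoly K n :=
  \sum_(X : {set 'I_n} | (i \notin X) && (j \notin X))
    Aseq K (i :: enum X) * dseq (j :: enum X) f.

(* 1 / z!, with 1 / z! = 0 for z < 0 *)
Definition invfact (K : fieldType) (z : int) : K :=
  if z is Posz k then (k`!%:R)^-1 else 0.

Definition vinvfact (K : fieldType) (n : nat) (x : zvec n) : K :=
  \prod_X invfact K (x X).

(* A^x for x >= 0; otherwise the value is junk, but it only ever occurs
   multiplied by vinvfact K x, which is then 0. *)
Definition Amon (K : fieldType) (n : nat) (x : zvec n) : Cpoly K n :=
  \prod_X Aset K (val X) ^+ `|x X|%N.

(* The sums over t (below) and s (in Ffun) have finitely many nonzero terms: the
   v^alpha are linearly independent, and with i < j < x in alpha, subtracting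
   r^alpha adds 1 to m_{i,q} and -1 to m_{i+1,q} for j <= q < x, which can
   happen only finitely often while all coordinates stay nonnegative. *)
Definition Jfun (K : fieldType) (n : nat) (s : {ffun quad n -> nat})
    (g : zvec n) : Cpoly K n :=
  \sum_(t \in [set: {ffun quad n -> int}]%classic)
    ((\prod_a \prod_(1 <= l < (s a).+1) (t a + l%:Z)%:~R)
       * vinvfact K (g + tv t)) *: Amon K (g + tv t).

Definition Ffun (K : fieldType) (n : nat) (g : zvec n) : Cpoly K n :=
  \sum_(s \in [set: {ffun quad n -> nat}]%classic)
    ((-1) ^+ (\sum_a s a)%N / (\prod_a (s a)`!)%N%:R) *: Jfun K s (g - sr s).

(* Entries below the diagonal carry no data and are normalized to 0, so that
   equality of matrices is equality of diagrams. *)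
Definition is_GT (n : nat) (m : 'I_n -> int) (d : 'M[int]_n) : bool :=
  [&& [forall p : 'I_n, forall q : 'I_n, (q.+1 == n) ==> (d p q == m p)],
      [forall p : 'I_n, forall q : 'I_n, forall p' : 'I_n, forall q' : 'I_n,
         [&& (p <= q)%N, p' == p.+1 :> nat & q' == q.+1 :> nat] ==>
         (d p' q' <= d p q <= d p q')]
    & [forall p : 'I_n, forall q : 'I_n, (q < p)%N ==> (d p q == 0)]].

Definition GTdiag (n : nat) (m : 'I_n -> int) := {d : 'M[int]_n | is_GT m d}.

Definition is_shift (n : nat) (d : 'M[int]_n) (g : zvec n) : Prop :=
  forall p q : 'I_n, (p <= q)%N ->
    \sum_(X : pset n | (p < #|val X :&: initset n q.+1|)%N) g X = d p q.

(* p' ranges over the successor of p, when there is one *)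
Definition highest (K : fieldType) (n : nat) (m : 'I_n -> int) : Cpoly K n :=
  \prod_(p < n) \prod_(p' < n | p' == p.+1 :> nat)
    (invfact K (m p - m p') *: Aset K (initset n p.+1) ^+ `|m p - m p'|%N).

Definition is_submodule (K : fieldType) (n : nat) (V : Cpoly K n -> Prop) :
    Prop :=
  [/\ V 0, forall (c : K) f g, V f -> V g -> V (c *: f + g)
    & forall i j f, V f -> V (Eop i j f)].

Definition gen_submodule (K : fieldType) (n : nat) (v : Cpoly K n) :
    Cpoly K n -> Prop :=
  fun f => forall V : Cpoly K n -> Prop, is_submodule V -> V v -> V f.

Definition is_basis (K : fieldType) (W : lmodType K) (I : eqType)
    (V : W -> Prop) (b : I -> W) : Prop :=
  [/\ forall i, V (b i),
      forall (l : seq I) (c : I -> K), uniq l ->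
        \sum_(i <- l) c i *: b i = 0 -> forall i, i \in l -> c i = 0
    & forall f, V f ->
        exists (l : seq I) (c : I -> K), f = \sum_(i <- l) c i *: b i].

(* Main.v *)
From mathcomp Require Import boolp classical_sets fsbigop.
Require Import Defs.
From HB Require Import structures.
From mathcomp Require Import all_boot all_order all_algebra perm.
From mathcomp Require Import mpoly.
From mathcomp Require Import reals.
From mathcomp Require Import complex.
From mathcomp Require Import zify ring.

Set Implicit Arguments.
Unset Strict Implicit.
Unset Printing Implicit Defensive.

Import Order.TTheory GRing.Theory Num.Theory.
Local Open Scope ring_scope.

(** Let V be the representation.  The pairing of polynomials which weights the
    coefficients by x! makes E_{i,j} adjoint to E_{j,i} (pair_Eop).  Evaluating
    A_Y at the minor of a matrix on the rows Y and the first columns turns E_{i,j}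
    into the derivative along a row operation (meval_Eop), so that the relations
    between these minors form a submodule (ker_Eop).

    F lies in V.  By double orthogonality (biorthogonal) it suffices that F is
    orthogonal to each g, of the weight of the highest vector, which is orthogonal
    to V.  Such a g vanishes on diagonal matrices, where only the monomial of the
    highest vector survives (meval_diag), hence, by Taylor expansion along row
    operations, on the invertible lower triangular matrices (vanish_lower).  The
    coefficients of F satisfy difference equations (phi_plucker), which say that F
    is orthogonal to the ideal of the three-term relations; the minors satisfy
    these relations as well (minor_plucker).  Modulo them, every polynomial becomes
    after multiplication by a monomial a polynomial in the variables of the sets
    {1, ..., i, j} (localizable_all).  For g this polynomial is zero, because those
    variables take independent values on lower triangular matrices; and since
    multiplying g by a monomial amounts to shifting gamma, g is orthogonal to all
    the F (pair_Ffun_eq0).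

    F is a basis.  V is orthogonal to all the relations between minors
    (genV_orth_ker), in particular to the Garnir relations (garnir_minors), by
    which every monomial can be straightened: an element of V is determined by its
    coefficients at the semistandard monomials, whose sets form a chain
    (straighten).  The chains of the given weight correspond to the Gelfand-Tsetlin
    diagrams (gtwt_gtmon, chain_inj).  There is a linear functional which vanishes
    on B and is positive on every r (sqwt); it makes the matrix of the coefficients
    of the F at these monomials unitriangular (Fco_diag, Fco_tri), whence both the
    independence of the F and the spanning property.

    The formula for the action holds because differentiating F by A_Y replaces
    gamma by gamma - e_Y (dset_Ffun). *)

(** * Weights on exponent vectors, and the lattice B *)

Section Lattice.

Variable n : nat.
Implicit Types (z : zvec n) (Y W : {set 'I_n}) (w : {set 'I_n} -> int).

Definition proper_set Y := (Y != set0) && (Y != setT).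

Definition wt w z : int := \sum_X z X * w (val X).

Lemma wt_is_zmod_morphism w : zmod_morphism (wt w).
Proof.
by move=> y z; rewrite -sumrB; apply: eq_bigr => X _; rewrite !ffunE mulrBl.
Qed.

HB.instance Definition _ w :=
  GRing.isZmodMorphism.Build (zvec n) int (wt w) (wt_is_zmod_morphism w).

Lemma wt_evec w Y : proper_set Y -> wt w (evec Y) = w Y.
Proof.
move=> pY; rewrite /wt (bigD1 (Sub Y pY : pset n)) //= ffunE eqxx mul1r.
rewrite big1 ?addr0 // => X; rewrite -val_eqE /= => neX.
by rewrite ffunE (negbTE neX) mul0r.
Qed.

Lemma wtB w w' z : wt (fun Y => w Y - w' Y) z = wt w z - wt w' z.
Proof. by rewrite -sumrB; apply: eq_bigr => X _; rewrite mulrBr. Qed.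

Lemma wt_sum (I : finType) (f : I -> {set 'I_n} -> int) z :
  wt (fun Y => \sum_i f i Y) z = \sum_i wt (f i) z.
Proof. by rewrite exchange_big; apply: eq_bigr => X _; rewrite mulr_sumr. Qed.

Definition cnt Y (q : nat) : nat := #|Y :&: initset n q|.

Lemma in_initset q (y : 'I_n) : (y \in initset n q) = (y < q)%N.
Proof. by rewrite inE. Qed.

Lemma cntU1 y Y q : y \notin Y -> cnt (y |: Y) q = ((y < q) + cnt Y q)%N.
Proof.
move=> yY; rewrite /cnt setIUl.
have [yq|yq] := boolP (y < q)%N.
  have -> : [set y] :&: initset n q = [set y].
    by apply/setIidPl; rewrite sub1set in_initset.
  by rewrite cardsU1 inE (negbTE yY).
have -> : [set y] :&: initset n q = set0; last by rewrite set0U.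
by apply/setP=> x; rewrite !inE; case: eqP => // ->; rewrite (negbTE yq).
Qed.

Lemma cnt_full Y q : (n <= q)%N -> cnt Y q = #|Y|.
Proof.
move=> nq; congr #|pred_of_set _|; apply/setIidPl/subsetP => y _.
by rewrite in_initset (leq_trans (ltn_ord y)).
Qed.

Lemma cntS Y (q : 'I_n) : cnt Y q.+1 = ((q \in Y) + cnt Y q)%N.
Proof.
rewrite /cnt [in LHS](cardsD1 q) !inE ltnSn andbT; congr (_ + #|pred_of_set _|)%N.
apply/setP=> y; rewrite !inE -val_eqE /= ltnS leq_eqVlt.
by have [->|] := eqVneq (y : nat) q; rewrite ?ltnn /= ?andbF.
Qed.

Lemma cnt_le Y q : (cnt Y q <= q)%N.
Proof.
have le : (#|initset n q| <= q)%N.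
  have [nq|qn] := leqP n q.
    by apply: leq_trans (max_card _) _; rewrite card_ord.
  pose f (i : 'I_q) : 'I_n := widen_ord (ltnW qn) i.
  have /subset_leq_card : initset n q \subset [set f i | i : 'I_q].
    apply/subsetP => y; rewrite in_initset => yq.
    by apply/imsetP; exists (Ordinal yq) => //; apply: val_inj.
  by move/leq_trans; apply; rewrite (leq_trans (leq_imset_card _ _)) ?card_ord.
by apply: leq_trans le; apply: subset_leq_card; apply: subsetIr.
Qed.

Lemma cnt_mono Y q q' : (q <= q')%N -> (cnt Y q <= cnt Y q')%N.
Proof.
move=> qq'; apply: subset_leq_card; apply/subsetP => y; rewrite !inE.
by case/andP => -> /leq_trans; apply.
Qed.

Lemma cnt_leS Y (q : 'I_n) : (cnt Y q.+1 <= (cnt Y q).+1)%N.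
Proof. by rewrite cntS -add1n leq_add2r leq_b1. Qed.

(** For alpha = (i, j, x, X): its three elements, and the part which its six sets
    have in common. *)
Definition qi (a : quad n) := (val a).1.1.1.
Definition qj (a : quad n) := (val a).1.1.2.
Definition qx (a : quad n) := (val a).1.2.
Definition qW (a : quad n) := initset n (qi a) :|: (val a).2.

(** The set of alpha of largest element sum.  It determines alpha, and serves as
    the leading coordinate of v. *)
Definition qtop (a : quad n) := qj a |: (qx a |: qW a).

Lemma vplusE a : vplus a = evec (qi a |: qW a) + evec (qtop a).
Proof.
by case: a => [[[[i j] x] X] ?]; rewrite /vplus /qtop /qi /qj /qx /qW /= setUA.
Qed.

Lemma vminusE a : vminus a = evec (qj a |: qW a) + evec (qi a |: (qx a |: qW a)).
Proof.
by case: a => [[[[i j] x] X] ?]; rewrite /vminus /qi /qj /qx /qW /= !setUA.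
Qed.

Lemma vzeroE a : vzero a = evec (qx a |: qW a) + evec (qi a |: (qj a |: qW a)).
Proof.
by case: a => [[[[i j] x] X] ?]; rewrite /vzero /qi /qj /qx /qW /= !setUA.
Qed.

Lemma qij a : (qi a < qj a)%N.
Proof. by case: a => [[[[i j] x] X] H]; case/and3P: (H). Qed.

Lemma qjx a : (qj a < qx a)%N.
Proof. by case: a => [[[[i j] x] X] H]; case/and3P: (H). Qed.

Lemma qWP a y : y \in qW a -> (y < qi a)%N || (qx a < y)%N.
Proof.
case: a => [[[[i j] x] X] H']; case/and3P: (H') => _ _ /forallP H.
rewrite /qW /qi /qx /= in_setU in_initset; case: ltnP => //= _ yX.
by have := H y; rewrite yX.
Qed.

Lemma qiW a : qi a \notin qW a.
Proof.
by apply/negP => H; have := qWP H; rewrite ltnn ltnNge (ltnW (ltn_trans (qij a) (qjx a))).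
Qed.

Lemma qjW a : qj a \notin qW a.
Proof.
apply/negP => H; have := qWP H; rewrite ltnNge (ltnW (qij a)).
by rewrite ltnNge (ltnW (qjx a)).
Qed.

Lemma qxW a : qx a \notin qW a.
Proof.
by apply/negP => H; have := qWP H; rewrite ltnn ltnNge (ltnW (ltn_trans (qij a) (qjx a))).
Qed.

Lemma qi_xW a : qi a \notin qx a |: qW a.
Proof.
rewrite in_setU1 negb_or qiW andbT -val_eqE neq_ltn.
by rewrite (ltn_trans (qij a) (qjx a)).
Qed.

Lemma qi_jW a : qi a \notin qj a |: qW a.
Proof. by rewrite in_setU1 negb_or qiW andbT -val_eqE neq_ltn qij. Qed.

Lemma qj_xW a : qj a \notin qx a |: qW a.
Proof. by rewrite in_setU1 negb_or qjW andbT -val_eqE neq_ltn qjx. Qed.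

Lemma proper_setP Y y y' : y \in Y -> y' \notin Y -> proper_set Y.
Proof.
move=> yY y'Y; apply/andP; split; first by apply/set0Pn; exists y.
by apply: contra y'Y => /eqP ->; rewrite inE.
Qed.

(** Each of the six sets of alpha contains one of i, j, x and misses another. *)
Lemma proper_iW a : proper_set (qi a |: qW a).
Proof.
apply: (@proper_setP _ (qi a) (qj a)); first by rewrite setU11.
by rewrite in_setU1 negb_or qjW andbT -val_eqE neq_ltn qij orbT.
Qed.

Lemma proper_jW a : proper_set (qj a |: qW a).
Proof. by apply: (@proper_setP _ (qj a) (qi a)); rewrite ?setU11 ?qi_jW. Qed.

Lemma proper_xW a : proper_set (qx a |: qW a).
Proof. by apply: (@proper_setP _ (qx a) (qi a)); rewrite ?setU11 ?qi_xW. Qed.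

Lemma proper_ixW a : proper_set (qi a |: (qx a |: qW a)).
Proof.
apply: (@proper_setP _ (qi a) (qj a)); rewrite ?setU11 //.
by rewrite in_setU1 negb_or qj_xW andbT -val_eqE neq_ltn qij orbT.
Qed.

Lemma proper_ijW a : proper_set (qi a |: (qj a |: qW a)).
Proof.
apply: (@proper_setP _ (qi a) (qx a)); rewrite ?setU11 //.
rewrite !in_setU1 !negb_or qxW andbT -!val_eqE !neq_ltn qjx !orbT andbT.
by rewrite (ltn_trans (qij a) (qjx a)) !orbT.
Qed.

Lemma proper_qtop a : proper_set (qtop a).
Proof.
apply: (@proper_setP _ (qj a) (qi a)); first by rewrite setU11.
by rewrite in_setU1 negb_or qi_xW andbT -val_eqE neq_ltn qij.
Qed.

Definition qproper :=
  (proper_iW, proper_jW, proper_xW, proper_ixW, proper_ijW, proper_qtop).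

(** As i < j < x, the numbers of elements below q in the two sets of v_+ are those
    in the two sets of v_-, possibly in the other order. *)
Lemma wt_vvec_cnt (h : nat -> int) q a : wt (fun Y => h (cnt Y q)) (vvec a) = 0.
Proof.
rewrite /vvec vplusE vminusE raddfB !raddfD /= !wt_evec ?qproper //.
rewrite !cntU1 ?(qiW, qjW, qxW, qi_xW, qi_jW, qj_xW) //.
have := qij a; have := qjx a.
case: (ltnP (qi a) q) => iq; case: (ltnP (qj a) q) => jq;
  case: (ltnP (qx a) q) => xq; rewrite ?add0n => jx ij; lia.
Qed.

(** A functional bounding the shifts by r: it vanishes on B, and it is positive on
    r by convexity of the square, the two sets of v_0 being less balanced than
    those of v_+. *)
Definition sqwt : zvec n -> int :=
  wt (fun Y => \sum_(q < n) ((cnt Y q)%:Z ^+ 2)).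

HB.instance Definition _ := GRing.Additive.on sqwt.

Lemma sqwt_vvec a : sqwt (vvec a) = 0.
Proof.
rewrite /sqwt wt_sum big1 // => q _.
exact: (wt_vvec_cnt (fun c => c%:Z ^+ 2)).
Qed.

Lemma sqwt_rvec a : 1 <= sqwt (rvec a).
Proof.
rewrite /sqwt wt_sum.
suff H (q : 'I_n) : 2 * ((qj a < q)%N && (q <= qx a)%N)%:R <=
    wt (fun Y => (cnt Y q)%:Z ^+ 2) (rvec a).
  rewrite (bigD1 (qx a)) //= -[1]addr0 lerD //.
    by apply: le_trans (H (qx a)); rewrite qjx leqnn.
  by apply: sumr_ge0 => q _; apply: le_trans (H q); case: (_ && _).
rewrite /rvec vplusE vzeroE raddfB !raddfD /= !wt_evec ?qproper //.
rewrite !cntU1 ?(qiW, qjW, qxW, qi_xW, qi_jW, qj_xW) //.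
have := qij a; have := qjx a; move: (cnt (qW a) q) => c.
by case: (ltnP (qi a) q) => iq; case: (ltnP (qj a) q) => jq;
  case: (leqP q (qx a)) => xq; rewrite ?(add0n, addrN) //=; lia.
Qed.

Lemma wt_card_rvec (h : nat -> int) q a :
  (n <= q)%N -> wt (fun Y => h (cnt Y q)) (rvec a) = 0.
Proof.
move=> nq; rewrite /rvec vplusE vzeroE raddfB !raddfD /= !wt_evec ?qproper //.
rewrite !cntU1 ?(qiW, qjW, qxW, qi_xW, qi_jW, qj_xW) //.
by rewrite !(leq_trans (ltn_ord _) nq) ?subrr; lia.
Qed.

Definition rho Y : nat := (\sum_(y in Y) y)%N.

Lemma rhoU1 y Y : y \notin Y -> rho (y |: Y) = (y + rho Y)%N.
Proof. by move=> yY; rewrite /rho big_setU1. Qed.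

Lemma rho_qtop a :
  [/\ (rho (qi a |: qW a) < rho (qtop a))%N,
      (rho (qj a |: qW a) < rho (qtop a))%N,
      (rho (qx a |: qW a) < rho (qtop a))%N,
      (rho (qi a |: (qx a |: qW a)) < rho (qtop a))%N
    & (rho (qi a |: (qj a |: qW a)) < rho (qtop a))%N].
Proof.
have := qij a; have := qjx a; rewrite /qtop.
rewrite !rhoU1 ?(qiW, qjW, qxW, qi_xW, qi_jW, qj_xW) //.
by move=> ? ?; split; lia.
Qed.

Lemma evecE Y (X : pset n) : evec Y X = (val X == Y)%:R.
Proof. by rewrite ffunE. Qed.

End Lattice.

Section LatticeBasis.

Variable n : nat.
Implicit Types (z : zvec n) (Y : {set 'I_n}) (a : quad n).

Lemma in_qtop a y :
  (y \in qtop a) =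
  [|| y == qj a, y == qx a, (y < qi a)%N | (y \in (val a).2)].
Proof. by rewrite !(in_setU1, in_setU) in_initset. Qed.

Lemma qX_gt a y : y \in (val a).2 -> (qx a < y)%N.
Proof.
case: a => [[[[i j] x] X] H']; case/and3P: (H') => _ _ /forallP H /= yX.
by have := H y; rewrite yX.
Qed.

Lemma in_qX a y : (y \in (val a).2) = (y \in qtop a) && (qx a < y)%N.
Proof.
rewrite in_qtop; have [yX|yX] := boolP (y \in (val a).2).
  by rewrite !orbT qX_gt.
rewrite orbF; symmetry; apply/negbTE/negP => /andP[H xy].
have := qij a; have := qjx a.
by move: H => /or3P[/eqP E|/eqP E|E]; rewrite ?E in xy; lia.
Qed.

Lemma qi_notin_qtop a : qi a \notin qtop a.
Proof.
rewrite /qtop in_setU1 negb_or qi_xW andbT -val_eqE neq_ltn.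
by rewrite qij.
Qed.

Lemma qtop_cases a y : y \in qtop a ->
  [\/ (y < qi a)%N, y = qj a, y = qx a | (qx a < y)%N].
Proof.
rewrite in_qtop => /or4P[/eqP|/eqP|yi|/qX_gt yx];
  [exact: Or42|exact: Or43|exact: Or41|exact: Or44].
Qed.

(** i is the least element missing from qtop a, j and x are the next two
    elements present, and X is the rest. *)
Lemma qtop_inj : injective (@qtop n).
Proof.
have leqi a a' : qtop a = qtop a' -> (qi a <= qi a')%N.
  move=> E; rewrite leqNgt; apply/negP => lt.
  by have := qi_notin_qtop a'; rewrite -E in_qtop lt !orbT.
have leqj a a' : qtop a = qtop a' -> (qj a <= qj a')%N.
  move=> E; have := setU11 (qj a') (qx a' |: qW a'); rewrite -/(qtop a') -E.
  have le := leqi _ _ E; have := qij a'; have := qjx a.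
  by move=> h1 h2 /qtop_cases[] => [|->|->|]; lia.
have leqx a a' : qtop a = qtop a' -> (qx a <= qx a')%N.
  move=> E; have : qx a' \in qtop a' by rewrite in_qtop eqxx orbT.
  rewrite -E; have le1 := leqi _ _ E; have le2 := leqj _ _ E.
  have := qij a'; have := qjx a'.
  by move=> h1 h2 /qtop_cases[] => [|e|->|]; rewrite ?e in h1 *; lia.
move=> a a' E; apply: val_inj.
have Ei : qi a = qi a' by apply/val_inj/eqP; rewrite eqn_leq !leqi.
have Ej : qj a = qj a' by apply/val_inj/eqP; rewrite eqn_leq !leqj.
have Ex : qx a = qx a' by apply/val_inj/eqP; rewrite eqn_leq !leqx.
have EX : (val a).2 = (val a').2.
  by apply/setP=> y; rewrite !in_qX E Ex.
move: Ei Ej Ex EX; rewrite /qi /qj /qx.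
by case: (val a) (val a') => [[[i j] x] X] [[[i' j'] x'] X'] /= -> -> -> ->.
Qed.

(** Each v is a unit vector at qtop plus terms of smaller element sum; this
    triangularity gives both the independence of the v and the elimination of
    the coordinates at the sets qtop. *)
Lemma vvec_qtop a a' (X : pset n) :
  val X = qtop a' -> (rho (qtop a) <= rho (qtop a'))%N ->
  vvec a X = (a == a')%:R.
Proof.
move=> EX le; have [h1 h2 h3 h4 h5] := rho_qtop a.
have ne Y : (rho Y < rho (qtop a))%N -> (val X == Y) = false.
  move=> lt; apply/eqP => E; move: lt; rewrite -E EX; lia.
rewrite /vvec vplusE vminusE !ffunE (ne _ h1) (ne _ h2) (ne _ h4) /=.
rewrite !add0r ?addr0 ?oppr0 ?addr0 EX.
by rewrite (inj_eq qtop_inj) eq_sym.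
Qed.

Lemma tvE (t : {ffun quad n -> int}) X : tv t X = \sum_a vvec a X * t a.
Proof.
rewrite /tv sum_ffunE; apply: eq_bigr => a _.
by rewrite ffunMzE mulrzz.
Qed.

Lemma tv_is_zmod_morphism : zmod_morphism (@tv n).
Proof.
move=> t t'; apply/ffunP=> X; rewrite !ffunE !tvE -sumrB.
by apply: eq_bigr => a _; rewrite !ffunE mulrBr.
Qed.

HB.instance Definition _ :=
  GRing.isZmodMorphism.Build _ (zvec n) (@tv n) tv_is_zmod_morphism.

Lemma tv_inj : injective (@tv n).
Proof.
apply: raddf_inj => t tv0; apply/ffunP => a0; rewrite ffunE.
apply/eqP; apply/negPn/negP => ta0.
pose a := [arg max_(b > a0 | t b != 0) rho (qtop b)].
have [ta maxa] : t a != 0 /\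
    forall b, t b != 0 -> (rho (qtop b) <= rho (qtop a))%N.
  by rewrite /a; case: arg_maxnP => // b tb H; split.
have := congr1 (fun z : zvec n => z (Sub (qtop a) (proper_qtop a))) tv0.
rewrite tvE [RHS]ffunE (bigD1 a) //= (@vvec_qtop a a) // eqxx mul1r.
rewrite big1 ?addr0 => [E|b ba]; first by rewrite E eqxx in ta.
have [->|tb] := eqVneq (t b) 0; first by rewrite mulr0.
by rewrite (@vvec_qtop b a) ?maxa // (negbTE ba) mul0r.
Qed.

(** The sets {1, ..., i, j} with i < j, which are the ones not of the form qtop.
    Here i is the number of elements of the initial segment, so that the 0-based
    index j satisfies i <= j. *)
Definition cluster Y :=
  [exists i : 'I_n, exists j : 'I_n, (i <= j)%N && (Y == j |: initset n i)].

Lemma clusterP Y :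
  reflect (exists i j : 'I_n, (i <= j)%N /\ Y = j |: initset n i) (cluster Y).
Proof.
apply: (iffP existsP) => [[i /existsP[j /andP[ij /eqP ->]]]|[i [j [ij ->]]]].
  by exists i, j.
by exists i; apply/existsP; exists j; rewrite ij eqxx.
Qed.

Lemma ncluster_qtop Y : proper_set Y -> ~~ cluster Y -> exists a, qtop a = Y.
Proof.
case/andP => Y0 YT /clusterP ncl.
have [i0 i0Y] : exists i0, i0 \notin Y.
  apply/existsP; rewrite -negb_forall; apply: contra YT => /forallP H.
  by apply/eqP/setP => y; rewrite H inE.
case: (@arg_minnP _ i0 [pred i | i \notin Y] val i0Y) => i /= iY imin.
have subY (y : 'I_n) : (y < i)%N -> y \in Y.
  move=> yi; apply/negPn/negP => yY.
  by have := imin y yY; rewrite leqNgt yi.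
have /existsP[j0 /andP[j0Y ij0]] : [exists j, (j \in Y) && (i <= j)%N].
  apply: contraT; rewrite negb_exists => /forallP H; exfalso.
  have EY : Y = initset n i.
    apply/setP=> y; rewrite in_initset; apply/idP/idP => [yY|/subY //].
    by have := H y; rewrite yY /= -ltnNge.
  have [y0 y0Y] : exists y, y \in Y by apply/set0Pn.
  have i0gt : (0 < i)%N by move: y0Y; rewrite EY in_initset; lia.
  have lt : (i.-1 < n)%N by have := ltn_ord i; lia.
  apply: ncl; exists (Ordinal lt), (Ordinal lt); split=> //.
  by rewrite EY; apply/setP=> y; rewrite in_setU1 !in_initset -val_eqE /=; lia.
pose Pj := [pred j | (j \in Y) && (i <= j)%N].
have Pj0 : Pj j0 by rewrite /Pj /= j0Y.
case: (@arg_minnP _ j0 Pj val Pj0) => j /= /andP[jY ij] jmin.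
have {}ij : (i < j)%N.
  by rewrite ltn_neqAle ij andbT; apply: contra iY => /eqP/val_inj ->.
have /existsP[x0 /andP[x0Y jx0]] : [exists x, (x \in Y) && (j < x)%N].
  apply: contraT; rewrite negb_exists => /forallP H; exfalso.
  apply: ncl; exists i, j; split; first exact: ltnW.
  apply/setP=> y; rewrite in_setU1 in_initset; apply/idP/idP; last first.
    by case/orP => [/eqP ->|/subY].
  move=> yY; have [//|iy] := ltnP y i; first by rewrite orbT.
  rewrite orbF -val_eqE eqn_leq jmin ?yY // andbT.
  by have := H y; rewrite yY /= -leqNgt.
pose Px := [pred x | (x \in Y) && (j < x)%N].
have Px0 : Px x0 by rewrite /Px /= x0Y.
case: (@arg_minnP _ x0 Px val Px0) => x /= /andP[xY jx] xmin.
pose X := [set y in Y | (x < y)%N].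
have quadP : is_quad (i, j, x, X).
  by rewrite /is_quad ij jx; apply/forallP=> y; apply/implyP; rewrite inE => /andP[].
exists (exist _ (i, j, x, X) quadP : quad n); apply/setP=> y.
rewrite in_qtop /qj /qx /qi /= inE; apply/idP/idP.
  by case/or4P => [/eqP ->|/eqP ->|/subY|/andP[]].
move=> yY; rewrite yY /=.
have [yi|iy] := ltnP y i; first by rewrite !orbT.
have [yj|jy] := leqP y j.
  by rewrite -val_eqE eqn_leq yj jmin ?yY.
have [xy|yx] := ltnP x y; first by rewrite !orbT.
by rewrite -!val_eqE /= [X in _ || X]orbC /= [(y : nat) == x]eqn_leq yx xmin ?yY ?orbT.
Qed.

Lemma card_initset i : (i <= n)%N -> #|initset n i| = i.
Proof.
elim: i => [_|i IH lt].
  by apply/eqP; rewrite cards_eq0; apply/eqP/setP => y; rewrite !inE.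
have -> : initset n i.+1 = Ordinal lt |: initset n i.
  by apply/setP=> y; rewrite in_setU1 !in_initset -val_eqE ltnS leq_eqVlt.
by rewrite cardsU1 in_initset ltnn IH // ltnW.
Qed.

Lemma cnt_initset i q : (i <= n)%N -> (q <= n)%N -> cnt (initset n i) q = minn i q.
Proof.
move=> hi hq; rewrite /cnt.
have -> : initset n i :&: initset n q = initset n (minn i q).
  by apply/setP=> y; rewrite inE !in_initset; lia.
by rewrite card_initset //; lia.
Qed.

(** The (p, q) entry of the array of an exponent vector; B is where all the
    entries vanish. *)
Definition gtwt (p q : nat) : zvec n -> int :=
  wt (fun Y => (p < cnt Y q.+1)%:R).

HB.instance Definition _ p q := GRing.Additive.on (gtwt p q).

Lemma gtwt_tv p q t : gtwt p q (tv t) = 0.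
Proof.
rewrite /tv raddf_sum big1 // => a _; rewrite raddfMz /=.
have -> : gtwt p q (vvec a) = 0 by exact: (wt_vvec_cnt (fun c => (p < c)%:R)).
by rewrite mul0rz.
Qed.

Lemma sqwt_tv (t : {ffun quad n -> int}) : sqwt (tv t) = 0.
Proof.
by rewrite /tv raddf_sum big1 // => a _; rewrite raddfMz /= sqwt_vvec mul0rz.
Qed.

Lemma gtwt_sr p (s : {ffun quad n -> nat}) : gtwt p n.-1 (sr s) = 0.
Proof.
rewrite /sr raddf_sum big1 // => a _; rewrite raddfMn /=.
have -> : gtwt p n.-1 (rvec a) = 0; last by rewrite mul0rn.
exact: (wt_card_rvec (fun c => (p < c)%:R) _ (leqSpred n)).
Qed.

Lemma sqwt_sr (s : {ffun quad n -> nat}) a : (s a)%:Z <= sqwt (sr s).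
Proof.
have h b : (s b)%:Z <= sqwt (rvec b *+ s b).
  by rewrite raddfMn /= -[(s b)%:Z]natz lerMn2r sqwt_rvec orbT.
rewrite /sr raddf_sum (bigD1 a) //= -[leLHS]addr0 lerD ?h //.
by apply: sumr_ge0 => b _; apply: le_trans (h b).
Qed.

Lemma sqwt_sr_eq0 (s : {ffun quad n -> nat}) : sqwt (sr s) <= 0 -> s = [ffun=> 0%N].
Proof.
move=> h; apply/ffunP=> a; rewrite ffunE; apply/eqP; rewrite -leqn0.
by have := le_trans (sqwt_sr s a) h.
Qed.

(** The weight of a difference of two array entries.  On cluster sets it is the
    indicator of a single one, so that the array determines every vector supported
    on cluster sets. *)
Definition cluster_coord (p q : nat) Y : int :=
  (p < cnt Y q.+1)%:R -
  (if (p < q)%N then (p < cnt Y q)%:R else (p.+1 < cnt Y n)%:R).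

Lemma cluster_coordE (i j p q : 'I_n) : (i <= j)%N -> (p <= q)%N ->
  cluster_coord p q (j |: initset n i) = ((i == p) && (j == q))%:R.
Proof.
move=> ij pq; have jn := ltn_ord j; have qn := ltn_ord q.
have inn := ltnW (ltn_ord i).
rewrite /cluster_coord !cntU1 ?in_initset -?leqNgt // !cnt_initset //; last 1 first.
  exact: ltnW.
rewrite -!val_eqE /=; move: (val i) (val j) (val p) (val q) ij pq jn qn inn.
move=> {i j p q} i j p q pq' ij' jn' qn' in'.
have [Ei|Ni] := eqVneq i p; have [Ej|Nj] := eqVneq j q; rewrite ?andbF ?andbT /=;
  case: (ltnP p q) => pq; case: (ltnP p (_ + _)) => h1;
  case: (ltnP _ (_ + _)) => h2 //=; exfalso; lia.
Qed.

Lemma cluster_gtwt_inj z :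
  (forall X : pset n, ~~ cluster (val X) -> z X = 0) ->
  (forall p q : 'I_n, (p <= q)%N -> gtwt p q z = 0) -> z = 0.
Proof.
move=> zcl zM; apply/ffunP=> X; rewrite ffunE.
have [/clusterP[i [j [ij EX]]]|/zcl //] := boolP (cluster (val X)).
have <- : wt (cluster_coord i j) z = z X.
  rewrite /wt (bigD1 X) //= EX cluster_coordE // !eqxx mulr1 big1 ?addr0 // => X' ne.
  have [/clusterP[i' [j' [ij' EX']]]|/zcl -> //] := boolP (cluster (val X')); last first.
    by rewrite mul0r.
  rewrite EX' cluster_coordE //; case: (_ && _) / andP => [[/eqP Ei /eqP Ej]|]; last first.
    by rewrite mulr0.
  by case/eqP: ne; apply: val_inj; rewrite EX EX' Ei Ej.
rewrite /cluster_coord wtB [X in X - _](zM i j) // sub0r.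
apply/eqP; rewrite oppr_eq0; apply/eqP; case: (ltnP i j) => lt.
  have lt1 : (j.-1 < n)%N by have := ltn_ord j; lia.
  have := zM i (Ordinal lt1); rewrite /gtwt /= prednK; last by lia.
  by apply; lia.
have Eij : i = j by apply/val_inj/eqP; rewrite eqn_leq ij.
have lt1 : (i.+1 < n)%N.
  rewrite ltn_neqAle ltn_ord andbT; apply/eqP => En.
  case/andP: (valP X) => _ /eqP; apply; rewrite EX Eij.
  apply/setP=> y; rewrite in_setU1 in_initset inE -val_eqE /=.
  by have := ltn_ord y; rewrite -{2}En Eij; lia.
have lt2 : (n.-1 < n)%N by lia.
have := zM (Ordinal lt1) (Ordinal lt2); rewrite /gtwt /= prednK; last by lia.
by apply; lia.
Qed.

(** Elimination of the coordinates at the sets qtop, in the order of decreasing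
    element sum, shows that the v generate the lattice. *)
Lemma gtwt_eq0_tv z :
  (forall p q : 'I_n, (p <= q)%N -> gtwt p q z = 0) -> exists t, z = tv t.
Proof.
have [N ltN] : exists N, forall Y, (rho Y < N)%N.
  exists (\sum_(y < n) y).+1 => Y; rewrite ltnS /rho big_mkcond.
  by apply: leq_sum => y _; case: ifP.
have : forall X : pset n, ~~ cluster (val X) -> (N <= rho (val X))%N -> z X = 0.
  by move=> X _; rewrite leqNgt ltN.
elim: N {ltN} z => [|N IH] z zN zM.
  exists 0; rewrite raddf0; apply: cluster_gtwt_inj => // X ncl; exact: zN.
pose zq a := z (Sub (qtop a) (proper_qtop a)).
pose t : {ffun quad n -> int} :=
  [ffun a => if rho (qtop a) == N then zq a else 0].
have [||t' Et'] := IH (z - tv t); first 1 last.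
- by move=> p q pq; rewrite raddfB /= gtwt_tv zM // subr0.
- by exists (t' + t); rewrite raddfD /= -Et' subrK.
move=> X ncl; have [a Ea] := ncluster_qtop (valP X) ncl.
rewrite leq_eqVlt !ffunE tvE => /orP[/eqP EN|ltN]; last first.
  rewrite zN // big1 ?subr0 // => b _; rewrite [t b]ffunE.
  case: eqP => [Eb|_]; last by rewrite mulr0.
  rewrite (@vvec_qtop b a) // ?Eb ?Ea; last exact: ltnW.
  by case: eqP => [E|_]; rewrite ?mul0r //; move: ltN; rewrite -Ea -E Eb ltnn.
rewrite (bigD1 a) //= big1 => [|b ba].
  rewrite (@vvec_qtop a a) // eqxx mul1r addr0 [t a]ffunE Ea -EN eqxx /zq.
  by rewrite (_ : Sub _ _ = X) ?subrr //; apply: val_inj; rewrite /= Ea.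
rewrite [t b]ffunE; case: eqP => [Eb|_]; last by rewrite mulr0.
by rewrite (@vvec_qtop b a) // ?Eb ?Ea -?EN // (negbTE ba) mul0r.
Qed.

End LatticeBasis.

(** * The coefficients of F *)

Section Coefficients.

Variables (K : numFieldType) (n : nat).
Implicit Types (z g : zvec n) (s : {ffun quad n -> nat}) (a : quad n).
Implicit Types (t : {ffun quad n -> int}).

Notation NX := #|{: pset n}|.

Lemma fsumT (T : choiceType) (V : nmodType) (r : seq T) (f : T -> V) :
  uniq r -> (forall i, i \notin r -> f i = 0) ->
  \sum_(i \in [set: T]%classic) f i = \sum_(i <- r) f i.
Proof.
move=> ur f0; rewrite (bigfs _ ur) //; last by move=> i _; apply: f0.
by apply: eq_fsbigl; apply/seteqP; split.
Qed.

Definition zm (x : 'X_{1..NX}) : zvec n := [ffun X => (x (enum_rank X))%:Z].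

Lemma zmE x X : zm x X = x (enum_rank X).
Proof. by rewrite ffunE. Qed.

Lemma zmD x y : zm (x + y)%MM = zm x + zm y.
Proof. by apply/ffunP=> X; rewrite !ffunE mnmDE PoszD. Qed.

Lemma zm_inj : injective zm.
Proof.
move=> x y E; apply/mnmP=> k; have := congr1 (fun z : zvec n => z (enum_val k)) E.
by rewrite !ffunE enum_valK => -[].
Qed.

Lemma zm_ge0 x X : 0 <= zm x X.
Proof. by rewrite ffunE. Qed.

Lemma zm_ex z : (forall X, 0 <= z X) -> exists x, z = zm x.
Proof.
move=> z0; exists [multinom `|z (enum_val k)|%N | k < NX].
by apply/ffunP=> X; rewrite ffunE mnmE enum_rankK gez0_abs.
Qed.

Lemma zmU (X : pset n) : zm U_(enum_rank X)%MM = evec (val X).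
Proof.
apply/ffunP=> Y; rewrite !ffunE mnm1E (inj_eq enum_rank_inj) val_eqE eq_sym.
by case: (Y == X).
Qed.

Definition zdeg : zvec n -> int := wt (fun=> 1).

HB.instance Definition _ := GRing.Additive.on zdeg.

Lemma zdeg_tv t : zdeg (tv t) = 0.
Proof.
rewrite /tv raddf_sum big1 // => a _; rewrite raddfMz /=.
by rewrite [zdeg _](wt_vvec_cnt (fun=> 1) 0) mul0rz.
Qed.

Lemma zdeg_le z X : (forall X, 0 <= z X) -> z X <= zdeg z.
Proof.
move=> z0; rewrite /zdeg /wt (bigD1 X) //= mulr1 lerDl.
by apply: sumr_ge0 => Y _; rewrite mulr1.
Qed.

Lemma sqwt_ge0 z : (forall X, 0 <= z X) -> 0 <= sqwt z.
Proof.
move=> z0; apply: sumr_ge0 => X _; apply: mulr_ge0 => //.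
by apply: sumr_ge0 => q _; rewrite sqr_ge0.
Qed.

Lemma preimage_seq (T U : eqType) (h : T -> U) (us : seq U) : injective h ->
  exists2 r : seq T, uniq r & forall y : T, h y \in us -> y \in r.
Proof.
move=> inj_h; elim: us => [|u us [r ur rP]]; first by exists [::].
have [[y0 Ey0]|no] := pselect (exists y0 : T, u = h y0).
  exists (undup (y0 :: r)); first exact: undup_uniq.
  move=> y; rewrite mem_undup !inE Ey0 (inj_eq inj_h).
  by case/orP => [->//|/rP ->]; rewrite orbT.
exists r => // y; rewrite in_cons => /orP[/eqP E|]; last exact: rP.
by case: no; exists y.
Qed.

(** Only finitely many terms of the coset g + B are nonnegative, as they all
    have the same degree. *)
Lemma finite_tv g : exists2 r : seq {ffun quad n -> int}, uniq r &
  forall t, (forall X, 0 <= (g + tv t) X) -> t \in r.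
Proof.
pose N := `|zdeg g|%N.
pose zs : seq (zvec n) :=
  [seq [ffun X => (f X : nat)%:Z] - g | f : {ffun pset n -> 'I_N.+1}].
have [r ur rP] := preimage_seq zs (@tv_inj n).
exists r => // t t0; apply: rP.
have lt X : (`|(g + tv t)%R X| < N.+1)%N.
  have := zdeg_le X t0; have := t0 X; rewrite raddfD /= zdeg_tv addr0 /N.
  by move: ((g + tv t) X) (zdeg g) => *; lia.
apply/mapP; exists [ffun X => Ordinal (lt X)]; first by rewrite mem_enum.
apply: (addrI g); rewrite addrCA subrr addr0; apply/ffunP=> X.
by rewrite [RHS]ffunE [in RHS]ffunE /= gez0_abs.
Qed.

Definition sbox N : seq {ffun quad n -> nat} :=
  [seq [ffun a => val (f a)] | f : {ffun quad n -> 'I_N.+1}].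

Lemma sbox_uniq N : uniq (sbox N).
Proof.
rewrite map_inj_uniq ?enum_uniq // => f f' E; apply/ffunP=> a; apply: val_inj.
by have := congr1 (fun s : {ffun _ -> nat} => s a) E; rewrite !ffunE.
Qed.

Lemma in_sbox N s : (forall a, (s a <= N)%N) -> s \in sbox N.
Proof.
move=> sN; apply/mapP.
have lt a : (s a < N.+1)%N by rewrite ltnS.
exists [ffun a => Ordinal (lt a)]; first by rewrite mem_enum.
by apply/ffunP=> a; rewrite !ffunE.
Qed.

Definition rising s t : K :=
  \prod_a \prod_(1 <= l < (s a).+1) (t a + l%:Z)%:~R.

(** The rising product at the coordinates of z with respect to the v, extended by
    zero outside B. *)
Definition Qco s z : K :=
  \sum_(t \in [set: {ffun quad n -> int}]%classic) rising s t * (tv t == z)%:R.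

Lemma Qco_tv s t : Qco s (tv t) = rising s t.
Proof.
rewrite /Qco (@fsumT _ _ [:: t]) ?big_seq1 ?eqxx ?mulr1 // => t'.
by rewrite inE (inj_eq (@tv_inj n)) => /negbTE ->; rewrite mulr0.
Qed.

Lemma Qco_out s z : (forall t, tv t <> z) -> Qco s z = 0.
Proof.
move=> no; rewrite /Qco (@fsumT _ _ [::]) ?big_nil // => t _.
by case: eqP => [/no//|_]; rewrite mulr0.
Qed.

Lemma Qco_neq0 s z : Qco s z != 0 -> exists t, z = tv t.
Proof.
move=> Q0; have [[t E]|no] := pselect (exists t, tv t = z); first by exists t.
by rewrite Qco_out ?eqxx // in Q0 => t E; apply: no; exists t.
Qed.

Definition scoef s : K := (-1) ^+ (\sum_a s a)%N / (\prod_a (s a)`!)%N%:R.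

(** Up to factorials, phi (x - gamma) is the coefficient of F_gamma at x. *)
Definition phi z : K :=
  \sum_(s \in [set: {ffun quad n -> nat}]%classic) scoef s * Qco s (z + sr s).

Lemma Qco_sr_bound s z N a : - sqwt z <= N%:Z -> Qco s (z + sr s) != 0 -> (s a <= N)%N.
Proof.
move=> zN /Qco_neq0[t E]; have := sqwt_sr s a.
have := congr1 (@sqwt n) E; rewrite raddfD /= sqwt_tv; lia.
Qed.

Lemma phiE z N : - sqwt z <= N%:Z ->
  phi z = \sum_(s <- sbox N) scoef s * Qco s (z + sr s).
Proof.
move=> zN; apply: fsumT (sbox_uniq N) _ => s sN.
apply/eqP; rewrite mulf_eq0; apply/orP; right; apply/negPn/negP => Q0.
by move/negP: sN; apply; apply: in_sbox => a; apply: Qco_sr_bound zN Q0.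
Qed.

Lemma phi_neq0 z : phi z != 0 -> exists s t, z + sr s = tv t.
Proof.
have [N zN] : exists N : nat, - sqwt z <= N%:Z by exists `|sqwt z|%N; lia.
rewrite (phiE zN) => H.
have [s _] : exists2 s, s \in sbox N & scoef s * Qco s (z + sr s) != 0.
  apply: contrapT => no; case/eqP: H; rewrite big_seq big1 // => s sN.
  by apply/eqP/negPn/negP => Q0; apply: no; exists s.
by rewrite mulf_eq0 negb_or => /andP[_ /Qco_neq0[t E]]; exists s, t.
Qed.

Lemma sr0 : sr [ffun=> 0%N] = 0 :> zvec n.
Proof. by rewrite /sr big1 // => a _; rewrite ffunE mulr0n. Qed.

Lemma phi_tv t : phi (tv t) = 1.
Proof.
have scoef0 : scoef [ffun=> 0%N] = 1.
  by rewrite /scoef !big1 ?expr0 ?divr1 // => a _; rewrite ffunE.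
rewrite (@phiE _ 0); last by rewrite sqwt_tv.
rewrite (big_rem [ffun=> 0%N]) /=; last by apply: in_sbox => a; rewrite ffunE.
rewrite sr0 addr0 Qco_tv /rising big1 ?mulr1; last first.
  by move=> a _; rewrite ffunE big_geq.
rewrite scoef0 big_seq big1 ?addr0 // => s.
rewrite mem_rem_uniq ?sbox_uniq // !inE => /andP[ne /mapP[f _ E]].
by case/eqP: ne; rewrite E; apply/ffunP=> a; rewrite !ffunE ord1.
Qed.

Definition unit_ffun (R : pzSemiRingType) a : {ffun quad n -> R} :=
  [ffun b => (b == a)%:R].

Lemma tv_unit a : tv (unit_ffun int a) = vvec a.
Proof.
rewrite /tv (bigD1 a) //= ffunE eqxx mulr1z big1 ?addr0 // => b ne.
by rewrite ffunE (negbTE ne) mulr0z.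
Qed.

Lemma srD s s' : sr (s + s') = sr s + sr s'.
Proof. by rewrite /sr -big_split; apply: eq_bigr => a _; rewrite ffunE mulrnDr. Qed.

Lemma sr_unit a : sr (unit_ffun nat a) = rvec a.
Proof.
rewrite /sr (bigD1 a) //= ffunE eqxx mulr1n big1 ?addr0 // => b ne.
by rewrite ffunE (negbTE ne) mulr0n.
Qed.

(** The discrete analogue of differentiating a power: rising products are lowered
    by the difference operator in the direction of v_alpha. *)
Lemma rising_diff s t a :
  rising (s + unit_ffun nat a) t - rising (s + unit_ffun nat a) (t - unit_ffun int a) =
  (s a).+1%:R * rising s t.
Proof.
rewrite /rising (bigD1 a) //= [X in _ - X](bigD1 a) //= [in RHS](bigD1 a) //=.
rewrite (eq_bigr (fun b => \prod_(1 <= l < (s b).+1) (t b + l%:Z)%:~R)); last first.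
  by move=> b ne; rewrite !ffunE (negbTE ne) addr0.
rewrite [X in _ - _ * X](eq_bigr (fun b => \prod_(1 <= l < (s b).+1) (t b + l%:Z)%:~R));
  last first.
  by move=> b ne; rewrite !ffunE (negbTE ne) addr0 oppr0 addr0.
rewrite -mulrBl mulrA; congr (_ * _); rewrite !ffunE eqxx /=.
rewrite -[(s a + 1)]/(s a + 1)%N addn1.
move: (s a) (t a) => k u; rewrite big_nat_recr //=.
rewrite [X in _ - X]big_nat_recl //=.
under [X in _ - _ * X]eq_big_nat => l _.
  rewrite (_ : u - 1 + l.+1 = u + l%:Z); last by lia.
  over.
rewrite /= (_ : u - 1 + 1%N = u); last by lia.
by rewrite intrD -[k.+1%:~R]pmulrn; ring.
Qed.

Lemma rising_diff0 s t a : s a = 0%N ->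
  rising s t - rising s (t - unit_ffun int a) = 0.
Proof.
move=> sa; rewrite [X in _ - X](_ : _ = rising s t) ?subrr //.
apply: eq_bigr => b _; have [->|ne] := eqVneq b a; first by rewrite sa !big_geq.
by rewrite !ffunE (negbTE ne) oppr0 addr0.
Qed.

Lemma Qco_diff s a z :
  Qco (s + unit_ffun nat a) z - Qco (s + unit_ffun nat a) (z - vvec a) =
  (s a).+1%:R * Qco s z.
Proof.
have [[t <-]|no] := pselect (exists t, tv t = z).
  by rewrite -tv_unit -raddfB !Qco_tv rising_diff.
have out s' : Qco s' z = 0 by apply: Qco_out => t E; apply: no; exists t.
have out' s' : Qco s' (z - vvec a) = 0.
  apply: Qco_out => t E; apply: no; exists (t + unit_ffun int a).
  by rewrite raddfD /= E tv_unit subrK.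
by rewrite !out !out' ?mulr0 subrr.
Qed.

Lemma Qco_diff0 s a z : s a = 0%N -> Qco s z - Qco s (z - vvec a) = 0.
Proof.
move=> sa; have [[t <-]|no] := pselect (exists t, tv t = z).
  by rewrite -tv_unit -raddfB !Qco_tv rising_diff0.
have out s' : Qco s' z = 0 by apply: Qco_out => t E; apply: no; exists t.
have out' s' : Qco s' (z - vvec a) = 0.
  apply: Qco_out => t E; apply: no; exists (t + unit_ffun int a).
  by rewrite raddfD /= E tv_unit subrK.
by rewrite !out !out' ?mulr0 subrr.
Qed.

Lemma add_unit_eq s a : (s + unit_ffun nat a) a = (s a).+1.
Proof. by rewrite !ffunE eqxx -[RHS]addn1. Qed.

Lemma add_unit_neq s a b : b != a -> (s + unit_ffun nat a) b = s b.
Proof. by move=> ne; rewrite !ffunE (negbTE ne) addr0. Qed.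

Lemma scoef_unit s a : scoef (s + unit_ffun nat a) * (s a).+1%:R = - scoef s.
Proof.
rewrite /scoef.
have -> : (\sum_b (s + unit_ffun nat a)%R b = (\sum_b s b).+1)%N.
  rewrite (bigD1 a) // [in RHS](bigD1 a) //= add_unit_eq -addSn.
  by congr (_ + _)%N; apply: eq_bigr => b ne; rewrite add_unit_neq.
have -> : (\prod_b ((s + unit_ffun nat a)%R b)`! = (s a).+1 * \prod_b (s b)`!)%N.
  rewrite (bigD1 a) // [in RHS](bigD1 a) //= add_unit_eq mulnA -factS.
  by congr (_ * _)%N; apply: eq_bigr => b ne; rewrite add_unit_neq.
rewrite natrM exprS mulN1r invfM !mulNr; congr (- _).
by rewrite -mulrA; congr (_ * _); rewrite mulrAC mulVf ?mul1r // pnatr_eq0.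
Qed.

Lemma fsum_shift (f : {ffun quad n -> nat} -> K) a :
  (forall s, s a = 0%N -> f s = 0) ->
  \sum_(s \in [set: {ffun quad n -> nat}]%classic) f s =
  \sum_(s \in [set: {ffun quad n -> nat}]%classic) f (s + unit_ffun nat a).
Proof.
move=> f0; rewrite -(fsbig_image _ (fun s => s + unit_ffun nat a)); last first.
  move=> s s' _ _ E; apply/ffunP=> b; have := congr1 (fun h : {ffun _ -> nat} => h b) E.
  by rewrite !ffunE => /addIn.
symmetry; apply: fsbig_widen => // s [_ /= no]; apply: f0.
case Es: (s a) => [//|k]; case: no; exists [ffun b => (s b - (b == a))%N] => //.
apply/ffunP=> b; rewrite !ffunE; case: eqP => [->|_]; last by rewrite subn0 addr0.
by rewrite Es -[_ + _]/(_ + _)%N subnK.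
Qed.

(** The differential Plücker relation for F, at the level of coefficients: apply
    the difference operator of v_alpha termwise and shift the summation index. *)
Lemma phi_plucker z a :
  phi (z + vplus a) - phi (z + vminus a) + phi (z + vzero a) = 0.
Proof.
move Ey: (z + vzero a) => y.
have Ep : z + vplus a = y - rvec a by rewrite -Ey /rvec opprB [vplus a - _]addrC addrA addrK.
have Em : z + vminus a = y - rvec a - vvec a.
  by rewrite -Ep /vvec opprB [vminus a - _]addrC addrA addrK.
rewrite Ep Em.
move Eu: (y - rvec a) => u; move Ew: (u - vvec a) => w.
have bound (c d : int) : exists N : nat, - c <= N%:Z /\ - d <= N%:Z.
  by exists (`|c| + `|d|)%N; lia.
have [N [h1 h2]] := bound (sqwt u) (sqwt w).
rewrite (phiE h1) (phiE h2) -sumrB.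
pose f s := scoef s * (Qco s (u + sr s) - Qco s (w + sr s)).
rewrite (eq_bigr f) => [|s _]; last by rewrite /f mulrBr.
rewrite -(fsumT (sbox_uniq N)) => [|s sN]; last first.
  have out z' : - sqwt z' <= N%:Z -> Qco s (z' + sr s) = 0.
    move=> zN; apply/eqP/negPn/negP => Q0; move/negP: sN; apply.
    by apply: in_sbox => b; apply: Qco_sr_bound zN Q0.
  by rewrite /f !out // subrr mulr0.
have Ews s : w + sr s = u + sr s - vvec a.
  rewrite -Ew.
  by move: (vvec a) (sr s) => c d; exact: addrAC.
(* The terms with s_alpha = 0 drop out, so s can be increased by 1 at alpha *)
rewrite (@fsum_shift _ a) => [|s sa]; last by rewrite /f Ews Qco_diff0 ?mulr0.
rewrite /phi (eq_fsbigr (fun s => - (scoef s * Qco s (y + sr s)))); last first.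
  move=> s _; rewrite /f Ews Qco_diff mulrA scoef_unit srD sr_unit -Eu.
  by rewrite [sr s + _]addrC addrA subrK mulNr.
have [M yM] : exists M : nat, - sqwt y <= M%:Z by exists `|sqwt y|%N; lia.
have out s : s \notin sbox M -> scoef s * Qco s (y + sr s) = 0.
  move=> sM; apply/eqP; rewrite mulf_eq0; apply/orP; right; apply/negPn/negP => Q0.
  by move/negP: sM; apply; apply: in_sbox => b; apply: Qco_sr_bound yM Q0.
rewrite !(fsumT (sbox_uniq M)) //; last by move=> s /out ->; rewrite oppr0.
by rewrite sumrN addNr.
Qed.

End Coefficients.

Section Expansion.

Variables (K : numFieldType) (n : nat).
Implicit Types (z g : zvec n) (s : {ffun quad n -> nat}) (a : quad n).
Implicit Types (t : {ffun quad n -> int}) (Y : {set 'I_n}).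

Notation NX := #|{: pset n}|.
Notation zm := (@zm n).
Implicit Types (x y : 'X_{1..NX}) (X : pset n).

Lemma Aset_val (X : pset n) : Aset K (val X) = 'X_(enum_rank X).
Proof. by rewrite /Aset valK. Qed.

Lemma Aset_proper Y (pY : proper_set Y) :
  Aset K Y = 'X_(enum_rank (Sub Y pY : pset n)).
Proof. by rewrite -Aset_val. Qed.

Lemma dset_proper Y (pY : proper_set Y) (f : Cpoly K n) :
  dset Y f = f^`M(enum_rank (Sub Y pY : pset n)).
Proof. by rewrite /dset insubT. Qed.

Lemma Amon_zm x : Amon K (zm x) = 'X_[x] :> Cpoly K n.
Proof.
rewrite mpolyXE_id (reindex (@enum_rank (pset n))) /=; last first.
  by apply: onW_bij; exact: enum_rank_bij.
by apply: eq_bigr => X _; rewrite zmE absz_nat Aset_val.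
Qed.

Lemma vinvfact_neg z X : z X < 0 -> vinvfact K z = 0.
Proof.
by move=> zX; rewrite /vinvfact (bigD1 X) //=; case: (z X) zX => // k _; rewrite mul0r.
Qed.

Lemma vinvfact_zm x : vinvfact K (zm x) = \prod_X ((x (enum_rank X))`!%:R)^-1.
Proof. by apply: eq_bigr => X _; rewrite zmE. Qed.

Lemma vinvfact_zm_neq0 x : vinvfact K (zm x) != 0.
Proof.
rewrite vinvfact_zm; apply/prodf_neq0 => X _.
by rewrite invr_neq0 // pnatr_eq0 -lt0n fact_gt0.
Qed.

Lemma vinvfactS x X :
  vinvfact K (zm (x + U_(enum_rank X))) *+ (x (enum_rank X)).+1 = vinvfact K (zm x).
Proof.
rewrite !vinvfact_zm (bigD1 X) // [RHS](bigD1 X) //= -mulrnAl.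
congr (_ * _).
  rewrite mnmDE mnm1E eqxx addn1 factS natrM invfM -mulr_natr mulrAC mulVf ?mul1r //.
  by rewrite pnatr_eq0.
apply: eq_bigr => Y ne; rewrite mnmDE mnm1E (inj_eq enum_rank_inj) eq_sym.
by rewrite (negbTE ne) addn0.
Qed.

Lemma vinvfact_Amon z x :
  vinvfact K z * (Amon K z)@_x = vinvfact K (zm x) * (z == zm x)%:R.
Proof.
have [/zm_ex[y ->]|no] := pselect (forall X, 0 <= z X).
  rewrite Amon_zm mcoeffX (inj_eq (@zm_inj n)); case: eqP => [->//|_].
  by rewrite !mulr0.
have [X zX] : exists X, z X < 0.
  apply: contrapT => H; apply: no => X; rewrite leNgt; apply/negP => zX.
  by apply: H; exists X.
rewrite (vinvfact_neg zX) mul0r; case: eqP => [Ez|_]; last by rewrite mulr0.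
by move: zX; rewrite Ez ltNge zm_ge0.
Qed.

Lemma Jfun_coef s g x :
  (Jfun K s g)@_x = Qco K s (zm x - g) * vinvfact K (zm x).
Proof.
have [r ur rP] := finite_tv g.
rewrite /Jfun (fsumT ur) => [|t tr]; last first.
  have [X zX] : exists X, (g + tv t) X < 0.
    apply: contrapT => H; move/negP: tr; apply; apply: rP => X.
    by rewrite leNgt; apply/negP => zX; apply: H; exists X.
  by rewrite (vinvfact_neg zX) mulr0 scale0r.
rewrite /Qco (fsumT ur) => [|t tr]; last first.
  case: eqP => [E|_]; last by rewrite mulr0.
  move/negP: tr; case; apply: rP => X; rewrite E.
  by rewrite addrC subrK zm_ge0.
rewrite raddf_sum mulr_suml /=; apply: eq_bigr => t _.
rewrite mcoeffZ -[LHS]mulrA vinvfact_Amon -[RHS]mulrA; congr (_ * _).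
rewrite mulrC; congr (_%:R * _); congr nat_of_bool.
by rewrite [RHS]eq_sym subr_eq eq_sym addrC.
Qed.

Lemma Ffun_coef g x : (Ffun K g)@_x = phi K (zm x - g) * vinvfact K (zm x).
Proof.
have [N gN] : exists N : nat, sqwt g <= N%:Z.
  by move: (sqwt g) => u; exists `|u|%N; lia.
have xgN y : - sqwt (zm y - g) <= N%:Z.
  rewrite raddfB /= opprB; apply: le_trans gN.
  by rewrite lerBlDr lerDl sqwt_ge0 // => X; apply: zm_ge0.
have Eass s y : zm y - (g - sr s) = zm y - g + sr s by rewrite opprB addrCA addrC.
rewrite /Ffun (fsumT (sbox_uniq n N)) => [|s sN]; last first.
  apply/mpolyP => y; rewrite mcoeff0 mcoeffZ Jfun_coef Eass.
  apply/eqP; rewrite !mulf_eq0; apply/orP; right; apply/orP; left.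
  apply/negPn/negP => Q0; move/negP: sN; apply; apply: in_sbox => a.
  exact: Qco_sr_bound (xgN y) Q0.
rewrite (phiE _ (xgN x)) raddf_sum mulr_suml /=; apply: eq_bigr => s _.
by rewrite mcoeffZ Jfun_coef Eass mulrA.
Qed.

(** Differentiation shifts gamma, as it does for the exponential generating
    function of any family of coefficients depending on x - gamma only. *)
Lemma dset_Ffun Y g : proper_set Y -> dset Y (Ffun K g) = Ffun K (g - evec Y).
Proof.
move=> pY; rewrite (dset_proper pY); apply/mpolyP => x.
rewrite mcoeff_deriv !Ffun_coef -mulrnAr vinvfactS; congr (phi K _ * _).
by rewrite zmD zmU SubK opprB addrA.
Qed.

Lemma set_cons_enum (i : 'I_n) (X : {set 'I_n}) : [set y in i :: enum X] = i |: X.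
Proof. by apply/setP=> y; rewrite !inE mem_enum. Qed.

Lemma Eop_Ffun (i j : 'I_n) g :
  Eop i j (Ffun K g) =
  \sum_(X : {set 'I_n} | (i \notin X) && (j \notin X))
    Aseq K (i :: enum X) *
    (skew_sign K (j :: enum X) *: Ffun K (g - evec (j |: X))).
Proof.
apply: eq_bigr => X /andP[iX jX]; rewrite /dseq /Aseq !set_cons_enum.
have [pX|] := boolP (proper_set (j |: X)); first by rewrite dset_Ffun.
rewrite negb_and !negbK => /orP[/eqP E|/eqP E].
  by have := setU11 j X; rewrite E inE.
have Eij : i = j.
  by apply/eqP; have := in_setT i; rewrite -E in_setU1 (negbTE iX) orbF.
by rewrite Eij E /Aset insubN ?eqxx ?andbF // scaler0 !mul0r.
Qed.

End Expansion.

(** * Minors, row operations and the action of gl_n *)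

Section Minors.

Variables (K : numFieldType) (n : nat).
Implicit Types (M : 'I_n -> nat -> K) (l : seq 'I_n) (X Y : {set 'I_n}).

(** The minor on the rows listed in l and the first columns; columns are indexed
    by nat so that deleting one of them does not change the type. *)
Definition sminor M l : K :=
  \det (\matrix_(a < size l, b < size l) M (tnth (in_tuple l) a) b).

Lemma sminorE M l k (v : 'I_k -> 'I_n) : size l = k ->
  (forall x0 (a : 'I_k), nth x0 l a = v a) ->
  sminor M l = \det (\matrix_(a < k, b < k) M (v a) b).
Proof.
move=> E; case: k / E v => v Ev; congr (\det _); apply/matrixP=> a b.
by rewrite !mxE (tnth_nth (v a)) Ev.
Qed.

Lemma sminor_cons M i l :
  sminor M (i :: l) =
  \sum_(b < (size l).+1) (-1) ^+ b * M i b * sminor (fun y c => M y (bump b c)) l.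
Proof.
rewrite /sminor (expand_det_row _ ord0); apply: eq_bigr => b _.
rewrite mxE [tnth _ _]/= /cofactor add0n mulrCA mulrA; congr (_ * \det _).
by apply/matrixP=> a c; rewrite !mxE !(tnth_nth i) /=.
Qed.

Lemma sminor_eq M M' l :
  (forall y b, y \in l -> M y b = M' y b) -> sminor M l = sminor M' l.
Proof.
move=> H; congr (\det _); apply/matrixP=> a b; rewrite !mxE H //.
exact: mem_tnth.
Qed.

Lemma sminor_not_uniq M l : ~~ uniq l -> sminor M l = 0.
Proof.
case: l => [//|x0 l] /(uniqPn x0)[a [b [ab bl Eab]]].
have al := ltn_trans ab bl.
apply: (@determinant_alternate _ _ _ (Ordinal al) (Ordinal bl)).
  by rewrite -val_eqE /= ltn_eqF.
by move=> c; rewrite !mxE !(tnth_nth x0) /= Eab.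
Qed.

Lemma sminor_swap M i j l : sminor M (i :: j :: l) = - sminor M (j :: i :: l).
Proof.
rewrite /sminor /=; set A := \matrix_(a, b) _; set B := \matrix_(a, b) _.
have -> : A = tperm_mx 0 1 *m B.
  rewrite -xrowE; apply/matrixP=> a b; rewrite !mxE !(tnth_nth i) /=.
  case: tpermP => [->|->|/eqP]//=; rewrite -val_eqE /= => a0 /eqP.
  by rewrite -val_eqE /=; case: (val a) a0 => [//|[//|k]].
by rewrite det_mulmx det_perm odd_tperm /= expr1 mulN1r.
Qed.

Lemma sminor_move M i l1 l2 :
  sminor M (i :: l1 ++ l2) = (-1) ^+ size l1 * sminor M (l1 ++ i :: l2).
Proof.
elim: l1 M => [|y l1 IH] M; first by rewrite expr0 mul1r.
rewrite cat_cons sminor_swap sminor_cons [in RHS]sminor_cons mulr_sumr.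
rewrite -sumrN -cat_cons !size_cat /= addnS; apply: eq_bigr => b _.
by rewrite IH exprS mulN1r mulNr mulrCA.
Qed.

Lemma sorted_enum_set X : sorted (fun i j : 'I_n => i < j)%N (enum X).
Proof.
rewrite /enum_mem -enumT; apply: sorted_filter.
  by move=> ? ? ?; apply: ltn_trans.
by rewrite -(@sorted_map _ _ val ltn) val_enum_ord iota_ltn_sorted.
Qed.

Lemma mem_filter_enum (P : pred 'I_n) X y :
  (y \in [seq z <- enum X | P z]) = P y && (y \in X).
Proof. by rewrite mem_filter mem_enum. Qed.

Lemma enum_setU1 i X : i \notin X ->
  enum (i |: X) =
  [seq y : 'I_n <- enum X | (y < i)%N] ++ i :: [seq y : 'I_n <- enum X | (i < y)%N].
Proof.
have tr : transitive (fun i j : 'I_n => i < j)%N by move=> ? ? ?; apply: ltn_trans.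
move=> iX; apply: (irr_sorted_eq tr); first by move=> y; rewrite /= ltnn.
- exact: sorted_enum_set.
- rewrite (sorted_pairwise tr) pairwise_cat /= -!(sorted_pairwise tr).
  have sf P : sorted (fun i j : 'I_n => i < j)%N [seq y <- enum X | P y].
    exact: sorted_filter (sorted_enum_set X).
  rewrite !sf /= andbT; apply/andP; split.
    apply/allrelP => y z; rewrite mem_filter_enum inE => /andP[yi _].
    case/orP => [/eqP -> //|]; rewrite mem_filter_enum => /andP[iz _].
    exact: ltn_trans iz.
  by apply/allP => y; rewrite mem_filter_enum => /andP[].
move=> y; rewrite mem_enum mem_cat inE !mem_filter_enum ?in_setU1.
rewrite in_set1 in_cons mem_filter_enum.
rewrite -!val_eqE /=; case: (ltngtP y i) => //= _; first by rewrite orbF.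
Qed.

Lemma skew_sign_sqr l : uniq l -> skew_sign K l * skew_sign K l = 1.
Proof. by move=> ul; rewrite /skew_sign ul -expr2 sqrr_sign. Qed.

Definition minor M Y : K := sminor M (enum Y).

(** Moving the first row to its place in the sorted list of the others takes as
    many transpositions as there are smaller entries after it, which are the
    inversions counted by ninv. *)
Lemma sminor_skew M l : sminor M l = skew_sign K l * minor M [set y in l].
Proof.
rewrite /skew_sign; case: ifPn => [ul|/sminor_not_uniq ->]; last by rewrite mul0r.
elim: l ul M => [_|i l IH /=/andP[il ul]] M.
  by rewrite expr0 mul1r /minor (_ : [set y in [::]] = set0) ?enum_set0 //;
    apply/setP=> y; rewrite !inE.
have {}IH M' : sminor M' l = (-1) ^+ ninv l * minor M' [set y in l] by apply: IH.
have iX : i \notin [set y in l] by rewrite inE.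
have -> : [set y in i :: l] = i |: [set y in l].
  by apply/setP=> y; rewrite !inE.
rewrite exprD mulrAC /minor enum_setU1 //.
have -> : count (fun y : 'I_n => (y < i)%N) l =
    size [seq y : 'I_n <- enum [set y in l] | (y < i)%N].
  rewrite size_filter; apply/seq.permP; apply: uniq_perm => //; first exact: enum_uniq.
  by move=> y; rewrite mem_enum inE.
rewrite -sminor_move.
rewrite (_ : _ ++ _ = enum [set y in l]); last first.
  have tr : transitive (fun i j : 'I_n => i < j)%N by move=> ? ? ?; apply: ltn_trans.
  apply: (irr_sorted_eq tr); first by move=> y; rewrite /= ltnn.
  - rewrite (sorted_pairwise tr) pairwise_cat -!(sorted_pairwise tr).
    have sf P : sorted (fun i j : 'I_n => i < j)%N [seq y <- enum [set y in l] | P y].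
      exact: sorted_filter (sorted_enum_set _).
    rewrite !sf !andbT.
    apply/allrelP => y z; rewrite !mem_filter_enum => /andP[yi _] /andP[iz _].
    exact: ltn_trans iz.
  - exact: sorted_enum_set.
  move=> y; rewrite mem_cat !mem_filter_enum mem_enum inE -andb_orl -neq_ltn.
  by case: eqP => [/val_inj ->|_ //]; rewrite (negbTE il) andbF.
rewrite sminor_cons [in RHS]sminor_cons mulr_suml.
have -> : size (enum [set y in l]) = size l.
  by rewrite -cardE cardsE (card_uniqP ul).
apply: eq_bigr => b _; rewrite IH /minor; ring.
Qed.

(** The point of the affine space of the variables A whose coordinates are the
    minors of M. *)
Definition pt M (k : 'I_#|{: pset n}|) : K := minor M (val (enum_val k)).

Lemma meval_Aset M Y : proper_set Y -> (Aset K Y).@[pt M] = minor M Y.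
Proof. by move=> pY; rewrite (Aset_proper _ pY) mevalXU /pt enum_rankK. Qed.

Definition row_op (i j : 'I_n) (t : K) M : 'I_n -> nat -> K :=
  fun y b => M y b + (y == j)%:R * (t * M i b).

(** The minor with row j replaced by row i, which is the derivative of the minor
    on the rows Y under this row operation. *)
Definition dminor (i j : 'I_n) M Y : K :=
  if j \in Y then
    skew_sign K (j :: enum (Y :\ j)) * sminor M (i :: enum (Y :\ j)) else 0.

Lemma sminor_row_op i j t M l : j \notin l -> sminor (row_op i j t M) l = sminor M l.
Proof.
move=> jl; apply: sminor_eq => y b yl; rewrite /row_op.
by case: eqP => [E|_]; [rewrite -E yl in jl | rewrite mul0r addr0].
Qed.

Lemma minor_skew1 M Y (j : 'I_n) : j \in Y ->
  minor M Y = skew_sign K (j :: enum (Y :\ j)) * sminor M (j :: enum (Y :\ j)).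
Proof.
move=> jY; rewrite sminor_skew mulrA skew_sign_sqr ?mul1r.
  by rewrite set_cons_enum setD1K.
by rewrite /= enum_uniq mem_enum setD11.
Qed.

Lemma minor_row_op i j t M Y :
  minor (row_op i j t M) Y = minor M Y + t * dminor i j M Y.
Proof.
rewrite /dminor; case: ifPn => jY; last first.
  by rewrite mulr0 addr0 /minor sminor_row_op // mem_enum.
rewrite !(minor_skew1 _ jY) mulrCA -mulrDr; congr (_ * _).
rewrite !sminor_cons mulr_sumr -big_split; apply: eq_bigr => b _ /=.
rewrite [sminor (fun y c => _) _](_ : _ = sminor (fun y c => M y (bump b c)) (enum (Y :\ j))).
  by rewrite /row_op eqxx mul1r; ring.
apply: sminor_eq => y c; rewrite mem_enum in_setD1 /row_op.
by case: eqP => //; rewrite mul0r addr0.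
Qed.

Lemma dminor_row_op i j t M Y : i != j -> dminor i j (row_op i j t M) Y = dminor i j M Y.
Proof.
move=> ij; rewrite /dminor; case: ifP => // jY; rewrite sminor_row_op //.
by rewrite inE eq_sym negb_or ij mem_enum setD11.
Qed.

Lemma big_pset (V : nmodType) (F : {set 'I_n} -> V) :
  \sum_(Y : pset n) F (val Y) = \sum_(Y : {set 'I_n} | proper_set Y) F Y.
Proof.
rewrite [RHS](@reindex_omap _ _ _ _ {: pset n} val insub) => [|Y pY]; last first.
  by rewrite insubT.
by apply: eq_bigl => Y; rewrite valK eqxx andbT; symmetry; exact: (valP Y).
Qed.

(** By the signs in the skew-symmetric convention, replacing the index j by i in
    A_Y is replacing row j by row i in the corresponding minor. *)
Lemma meval_Eop i j M (g : Cpoly K n) :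
  (Eop i j g).@[pt M] =
  \sum_(Y : pset n) dminor i j M (val Y) * (dset (val Y) g).@[pt M].
Proof.
rewrite /Eop raddf_sum /=.
rewrite (bigID (fun X => proper_set (j |: X))) /= [X in _ + X]big1 ?addr0; last first.
  move=> X /andP[/andP[_ jX] np]; rewrite /dseq set_cons_enum /dset insubN //.
  by rewrite scaler0 mulr0 meval0.
rewrite (big_pset (fun Y => dminor i j M Y * (dset Y g).@[pt M])).
rewrite [RHS](bigID (fun Y => (j \in Y) && (i \notin Y :\ j))) /=.
rewrite [X in _ = _ + X]big1 ?addr0; last first.
  move=> Y /andP[_]; rewrite negb_and negbK /dminor.
  case: ifP => //= [_ iY|_ _]; last by rewrite mul0r.
  by rewrite sminor_not_uniq ?mulr0 ?mul0r //= mem_enum iY.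
rewrite [RHS](reindex_onto (fun X => j |: X) (fun Y => Y :\ j)) /=; last first.
  by move=> Y /and3P[_ jY _]; rewrite setD1K.
apply: eq_big => [X|X /andP[/andP[iX jX] pX]].
  rewrite setU11; have [jX|jX] := boolP (j \in X).
    have -> : ((j |: X) :\ j == X) = false.
      by apply/eqP => E; rewrite -E setD11 in jX.
    by rewrite !andbF.
  by rewrite setU1K // eqxx !andbT andbC.
rewrite /dminor setU11 setU1K // mevalM /Aseq /dseq !set_cons_enum !mevalZ.
have [pY|npY] := boolP (proper_set (i |: X)).
  by rewrite meval_Aset // sminor_skew set_cons_enum; ring.
have Eij : i = j.
  move: npY; rewrite negb_and !negbK => /orP[/eqP E|/eqP E].
    by have := setU11 i X; rewrite E inE.
  have : j \in i |: X by rewrite E in_setT.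
  by rewrite in_setU1 (negbTE jX) orbF => /eqP.
by case/negP: npY; rewrite Eij.
Qed.

End Minors.

Section RowFlow.

Variables (K : numFieldType) (n : nat).
Implicit Types (M : 'I_n -> nat -> K) (f g : Cpoly K n).

Lemma mpoly_ring_ind N (P : {mpoly K[N]} -> Prop) :
  (forall c, P c%:MP) -> (forall k, P 'X_k) ->
  (forall p q, P p -> P q -> P (p + q)) -> (forall p q, P p -> P q -> P (p * q)) ->
  forall p, P p.
Proof.
move=> PC PX PD PM p; rewrite [p]mpolyE; apply: big_ind => [||m _]; first exact: PC.
  exact: PD.
rewrite -mul_mpolyC; apply: (PM) => //; rewrite mpolyXE_id.
have P1 : P 1 by rewrite -mpolyC1.
apply: big_ind => [||k _]; [exact: P1|exact: PM|].
elim: (m k) => [|e IH]; first by rewrite expr0.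
by rewrite exprS; apply: PM.
Qed.

Lemma poly_horner_eq0 (p : {poly K}) : (forall t, p.[t] = 0) -> p = 0.
Proof.
move=> p0; apply/eqP/negPn/negP => np0.
have roots : all (root p) [seq i%:R | i <- iota 0 (size p)].
  by apply/allP => t _; apply/eqP.
have := max_poly_roots np0 roots; rewrite size_map size_iota ltnn => H.
have : false; last by [].
apply: H; rewrite map_inj_uniq ?iota_uniq // => i i' E.
by apply/eqP; rewrite -(eqr_nat K) E.
Qed.

(** The polynomial function of t given by f on the matrices row_op i j t M. *)
Definition flow (i j : 'I_n) M : Cpoly K n -> {poly K} :=
  mmap polyC (fun k => (pt M k)%:P + 'X * (dminor i j M (val (enum_val k)))%:P).

HB.instance Definition _ i j M := GRing.RMorphism.on (flow i j M).

Lemma flowC i j M c : flow i j M c%:MP = c%:P.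
Proof. exact: mmapC. Qed.

Lemma flowX i j M k :
  flow i j M 'X_k = (pt M k)%:P + 'X * (dminor i j M (val (enum_val k)))%:P.
Proof. by rewrite /flow mmapX mmap1U. Qed.

Lemma horner_flow i j M t f : (flow i j M f).[t] = f.@[pt (row_op i j t M)].
Proof.
elim/mpoly_ring_ind: f => [c|k|f g IHf IHg|f g IHf IHg].
- by rewrite flowC hornerC mevalC.
- by rewrite flowX mevalXU /pt minor_row_op !hornerE.
- by rewrite rmorphD /= hornerD mevalD IHf IHg.
- by rewrite rmorphM /= hornerM mevalM IHf IHg.
Qed.

Lemma deriv_flow i j M f :
  (flow i j M f)^`() =
  \sum_k (dminor i j M (val (enum_val k)))%:P * flow i j M f^`M(k).
Proof.
elim/mpoly_ring_ind: f => [c|k|f g IHf IHg|f g IHf IHg].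
- by rewrite flowC derivC big1 // => k _; rewrite mderivC raddf0 mulr0.
- rewrite flowX derivD derivM !derivC derivX mulr0 addr0 add0r mul1r.
  have UU : (U_(k) - U_(k))%MM = 0%MM by apply/mnmP=> l; rewrite mnmBE mnm0E subnn.
  rewrite (bigD1 k) //= mderivX mnm1E eqxx UU mpolyX0 scale1r rmorph1 mulr1.
  rewrite big1 ?addr0 // => k' ne; rewrite mderivX mnm1E eq_sym (negbTE ne).
  by rewrite scale0r raddf0 mulr0.
- rewrite rmorphD /= derivD IHf IHg -big_split; apply: eq_bigr => k _.
  by rewrite mderivD rmorphD mulrDr.
rewrite rmorphM /= derivM IHf IHg mulr_suml mulr_sumr -big_split.
by apply: eq_bigr => k _; rewrite mderivM rmorphD !rmorphM /=; ring.
Qed.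

Lemma meval_Eop_ord i j M f :
  (Eop i j f).@[pt M] =
  \sum_k dminor i j M (val (enum_val k)) * (f^`M(k)).@[pt M].
Proof.
rewrite meval_Eop (reindex (@enum_val (pset n) predT)) /=; last first.
  by apply: onW_bij; exact: enum_val_bij.
by apply: eq_bigr => k _; rewrite /dset valK enum_valK.
Qed.

Lemma meval_row_op0 i j M f : f.@[pt (row_op i j 0 M)] = f.@[pt M].
Proof. by apply: meval_eq => k; rewrite /pt minor_row_op mul0r addr0. Qed.

Lemma deriv_flow0 i j M f : (flow i j M f)^`().[0] = (Eop i j f).@[pt M].
Proof.
rewrite deriv_flow horner_sum meval_Eop_ord; apply: eq_bigr => k _.
by rewrite hornerM hornerC horner_flow meval_row_op0.
Qed.

Lemma deriv_flow_Eop i j M f : i != j -> (flow i j M f)^`() = flow i j M (Eop i j f).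
Proof.
move=> ij; apply/eqP; rewrite -subr_eq0; apply/eqP; apply: poly_horner_eq0 => t.
rewrite hornerD hornerN horner_flow meval_Eop_ord deriv_flow horner_sum.
rewrite -sumrB big1 // => k _.
by rewrite hornerM hornerC horner_flow dminor_row_op // subrr.
Qed.

(** The relations between minors form a gl_n-submodule, being the polynomials
    which vanish along every flow. *)
Lemma ker_Eop i j f :
  (forall M, f.@[pt M] = 0) -> forall M, (Eop i j f).@[pt M] = 0.
Proof.
move=> f0 M; rewrite -deriv_flow0 (_ : flow i j M f = 0) ?derivC ?horner0 //.
by apply: poly_horner_eq0 => t; rewrite horner_flow.
Qed.

(** A family of polynomials stable under E_{i,j} which vanishes at a matrix
    vanishes along its flow, since all the Taylor coefficients do. *)
Lemma vanish_row_op (W : Cpoly K n -> Prop) i j t M : i != j ->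
  (forall f, W f -> W (Eop i j f)) -> (forall f, W f -> f.@[pt M] = 0) ->
  forall f, W f -> f.@[pt (row_op i j t M)] = 0.
Proof.
move=> ij WE W0 f Wf; rewrite -horner_flow (_ : flow i j M f = 0) ?horner0 //.
apply/polyP => d; rewrite coef0; elim: d f Wf => [|d IH] f Wf.
  by rewrite -horner_coef0 horner_flow meval_row_op0 W0.
have := IH _ (WE _ Wf); rewrite -deriv_flow_Eop // coef_deriv => /eqP.
by rewrite mulrn_eq0 /= => /eqP.
Qed.

End RowFlow.

Section Triangular.

Variables (K : numFieldType) (n : nat).
Implicit Types (M L : 'I_n -> nat -> K) (f g : Cpoly K n).

Lemma meval_pt_eq M M' f : (forall y b, M y b = M' y b) -> f.@[pt M] = f.@[pt M'].
Proof.
by move=> E; apply: meval_eq => k; apply: sminor_eq => y b _; apply: E.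
Qed.

Section Vanish.

Variable W : Cpoly K n -> Prop.
Hypothesis WE : forall i j f, W f -> W (Eop i j f).

Lemma vanish_row_comb j (s : seq 'I_n) (c : 'I_n -> K) M :
  j \notin s -> (forall f, W f -> f.@[pt M] = 0) ->
  forall f, W f ->
    f.@[pt (fun y b => M y b + (y == j)%:R * \sum_(i <- s) c i * M i b)] = 0.
Proof.
elim: s => [|i s IH] js W0 f Wf.
  rewrite -[RHS](W0 f Wf); apply: meval_pt_eq => y b.
  by rewrite big_nil mulr0 addr0.
move: js; rewrite inE negb_or => /andP[ji js].
have ij : i != j by rewrite eq_sym.
rewrite -[RHS](vanish_row_op (c i) ij (WE _ _) (IH js W0) Wf).
apply: meval_pt_eq => y b; rewrite /row_op big_cons (negbTE ij) mul0r addr0.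
ring.
Qed.

(** Row operations lead from the diagonal matrices to all the invertible lower
    triangular ones; the rows are built from the last one up, so that those
    above are still diagonal. *)
Lemma vanish_lower :
  (forall d : 'I_n -> K, (forall y, d y != 0) ->
     forall f, W f -> f.@[pt (fun y b => (y == b :> nat)%:R * d y)] = 0) ->
  forall L, (forall (y : 'I_n) b, (y < b)%N -> L y b = 0) ->
    (forall y : 'I_n, L y y != 0) ->
  forall f, W f -> f.@[pt L] = 0.
Proof.
move=> Wdiag L Llow Ldiag.
(* Rows k and beyond are those of L, the rows above are diagonal *)
pose Mk k : 'I_n -> nat -> K :=
  fun y b => if (k <= y)%N then L y b else (y == b :> nat)%:R * L y y.
suff H k : (k <= n)%N -> forall f, W f -> f.@[pt (Mk (n - k)%N)] = 0.
  move=> f Wf; rewrite -[RHS](H n (leqnn n) f Wf).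
  by apply: meval_pt_eq => y b; rewrite /Mk subnn.
elim: k => [_ f Wf|k IH kn f Wf].
  rewrite -[RHS](Wdiag (fun y => L y y) Ldiag f Wf); apply: meval_pt_eq => y b.
  by rewrite /Mk subn0 leqNgt ltn_ord.
have jn : (n - k.+1 < n)%N by lia.
pose j := Ordinal jn.
have js : j \notin [seq i : 'I_n <- enum 'I_n | (i < j)%N].
  by rewrite mem_filter ltnn.
rewrite -[RHS](vanish_row_comb (fun i => L j i / L i i) js (IH (ltnW kn)) Wf).
apply: meval_pt_eq => y b; rewrite /Mk.
have -> : (n - k = (n - k.+1).+1)%N by lia.
rewrite -[(n - k.+1)%N]/(val j) big_filter big_enum_cond /=.
have [->|ne] := eqVneq y j; last first.
  have ne' : (j == y :> nat) = false.
    by apply/eqP => /val_inj E; rewrite E eqxx in ne.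
  by rewrite mul0r addr0 [in RHS]ltn_neqAle ne'.
rewrite leqnn ltnn mul1r; have [bj|jb|E] := ltngtP b j; last 1 first.
- rewrite mul1r big1 ?addr0 ?E // => i ij.
  by rewrite ltnNge (ltnW ij) /= (ltn_eqF ij) mul0r mulr0.
- have bn : (b < n)%N := ltn_trans bj (ltn_ord j).
  rewrite mul0r add0r (bigD1 (Ordinal bn)) //= ltnNge ltnW //=.
  rewrite eqxx mul1r divfK //.
  rewrite big1 ?addr0 // => i /andP[ij]; rewrite -val_eqE /= => /negbTE ib.
  by rewrite ltnNge ltnW //= ib mul0r mulr0.
rewrite Llow // mul0r add0r big1 // => i ij.
rewrite ltnNge ltnW //= [(i : nat) == b](_ : _ = false) ?mul0r ?mulr0 //.
exact: ltn_eqF (ltn_trans ij jb).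
Qed.

End Vanish.

Lemma enum_initset i : (i <= n)%N -> map val (enum (initset n i)) = iota 0 i.
Proof.
move=> hi; apply: (irr_sorted_eq ltn_trans ltnn).
- rewrite sorted_map; exact: sorted_enum_set.
- exact: iota_ltn_sorted.
move=> y; rewrite mem_iota add0n /=; apply/mapP/idP => [[z]|yi].
  by rewrite mem_enum in_initset => ? ->.
have yn := leq_trans yi hi.
by exists (Ordinal yn); rewrite // mem_enum in_initset.
Qed.

(** The rows and columns of such a minor still form a lower triangular matrix. *)
Lemma minor_lower L (D : nat -> K) (i j : 'I_n) :
  (forall (y : 'I_n) b, (y < b)%N -> L y b = 0) -> (forall y : 'I_n, L y y = D y) ->
  (i <= j)%N ->
  minor L (j |: initset n i) = (\prod_(0 <= a < i) D a) * L j i.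
Proof.
move=> Llow LD ij.
have jX : j \notin initset n i by rewrite in_initset -leqNgt.
have inn := ltnW (ltn_ord i).
have sz : size (enum (initset n i)) = i by rewrite -cardE card_initset.
have E : enum (j |: initset n i) = rcons (enum (initset n i)) j.
  rewrite enum_setU1 // (_ : filter (fun y : 'I_n => (j < y)%N) _ = [::]).
    rewrite cats1; congr rcons; apply/all_filterP/allP => y.
    by rewrite mem_enum in_initset => /leq_trans; apply.
  apply/eqP; rewrite -[_ == _]negbK -has_filter; apply/hasPn => y.
  by rewrite mem_enum in_initset -leqNgt => yi; rewrite ltnW // (leq_trans yi).
pose v (a : 'I_i.+1) : 'I_n := nth j (enum (initset n i)) a.
have vE (a : 'I_i.+1) : (a < i)%N -> v a = a :> nat.
  move=> ai; rewrite -[LHS]/(val (v a)) -(nth_map j 0%N) ?sz //.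
  by rewrite enum_initset // nth_iota.
rewrite /minor (@sminorE _ _ L (enum (j |: initset n i)) i.+1 v); last 2 first.
- by rewrite E size_rcons sz.
- move=> x0 a; rewrite E nth_rcons sz /v; case: ltngtP => [ai|ia|->].
  + by apply: set_nth_default; rewrite sz.
  + by have := ltn_ord a; rewrite ltnS leqNgt ia.
  + by rewrite nth_default // sz.
rewrite det_trig; last first.
  apply/is_trig_mxP => a b ab; rewrite mxE Llow // vE //.
  by apply: leq_trans ab _; rewrite -ltnS.
rewrite big_ord_recr /= !mxE /= [v ord_max]nth_default ?sz // big_mkord.
congr (_ * _); apply: eq_bigr => a _; rewrite mxE -[RHS]/(D a).
have va := vE (widen_ord (leqnSn i) a) (ltn_ord a).
by rewrite -[X in D X]va -LD va.
Qed.

(** A set Y other than {1, ..., k}, with k its cardinal, contains some element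
    beyond k, and the row of this element is zero in the first k columns. *)
Lemma minor_diag0 (d : 'I_n -> K) (Y : {set 'I_n}) :
  Y != initset n #|Y| -> minor (fun y b => (y == b :> nat)%:R * d y) Y = 0.
Proof.
move=> neY.
have /existsP[y /andP[yY ky]] : [exists y, (y \in Y) && (#|Y| <= y)%N].
  apply: contraT; rewrite negb_exists => /forallP H; case/negP: neY.
  rewrite eqEcard card_initset ?leqnn ?andbT; last first.
    by rewrite -[n in (_ <= n)%N]card_ord max_card.
  apply/subsetP => y yY; rewrite in_initset ltnNge.
  by have := H y; rewrite yY.
have lt : (index y (enum Y) < size (enum Y))%N by rewrite index_mem mem_enum.
rewrite /minor /sminor (expand_det_row _ (Ordinal lt)) big1 // => b _.
rewrite mxE (tnth_nth y) /= nth_index ?mem_enum //.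
have by_ : (y == b :> nat) = false.
  by apply/gtn_eqF/(leq_trans (ltn_ord b)); rewrite -cardE.
by rewrite by_ !mul0r.
Qed.

End Triangular.

Section Plucker.

Variables (K : numFieldType) (n : nat).
Implicit Types (M : 'I_n -> nat -> K) (l : seq 'I_n) (W : {set 'I_n}).

(** The three-term relation between minors of consecutive sizes: as a function
    of y, the minor on the rows y, l is a linear form in the first columns of row
    y; so adjoining the column of its values to the rows i, j, x, l gives a
    singular matrix, which is expanded along that column. *)
Lemma sminor_plucker M i j x l :
  sminor M (i :: l) * sminor M [:: j, x & l] -
  sminor M (j :: l) * sminor M [:: i, x & l] +
  sminor M (x :: l) * sminor M [:: i, j & l] = 0.
Proof.
pose f y := sminor M (y :: l).
pose s := [:: i, j, x & l].
pose A : 'M[K]_((size l).+3) := \matrix_(a, b)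
  (if b == 0 then f (nth i s a) else M (nth i s a) b.-1).
have fl y : y \in l -> f y = 0.
  by move=> yl; rewrite /f sminor_not_uniq //= yl.
have detA : \det A = 0.
  rewrite -det_tr; apply/eqP/det0P.
  (* The column of values of f is the combination of the others with
     coefficients c, by expansion of f along its first row *)
  pose c b := (-1) ^+ b * sminor (fun y c => M y (bump b c)) l.
  pose v : 'rV[K]_((size l).+3) := \row_b
    (if b == 0 then -1 else if (b <= (size l).+1)%N then c b.-1 else 0).
  exists v; first by apply/eqP => /rowP/(_ 0)/eqP; rewrite !mxE /= oppr_eq0 oner_eq0.
  apply/rowP => a; rewrite !mxE big_ord_recl !mxE /= big_ord_recr /= !mxE /=.
  rewrite ltnn mul0r addr0 mulN1r /f sminor_cons [X in _ + X](_ : _ =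
    \sum_(b < (size l).+1) (-1) ^+ b * M (nth i s a) b *
      sminor (fun y c => M y (bump b c)) l) ?addNr //.
  by apply: eq_bigr => b _; rewrite !mxE /= /bump /= add1n ltn_ord /c mulrAC.
have := detA; rewrite (expand_det_col _ 0) !big_ord_recl big1 => [|a _]; last first.
  rewrite mxE /= fl ?mul0r //; apply: mem_nth; exact: ltn_ord.
rewrite addr0 !mxE /= /cofactor /=.
have -> : \det (row' ord0 (col' 0 A)) = sminor M [:: j, x & l].
  by congr (\det _); apply/matrixP => a b; rewrite !mxE /= !(tnth_nth i).
have -> : \det (row' (lift ord0 ord0) (col' 0 A)) = sminor M [:: i, x & l].
  congr (\det _); apply/matrixP => a b; rewrite !mxE /= !(tnth_nth i) /=.
  by case: a => [[|a] lt].
have -> : \det (row' (lift ord0 (lift ord0 ord0)) (col' 0 A)) = sminor M [:: i, j & l].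
  congr (\det _); apply/matrixP => a b; rewrite !mxE /= !(tnth_nth i) /=.
  by case: a => [[|[|a]] lt].
by rewrite /f => <-; rewrite /= !(expr0, expr1, expr2) /=; ring.
Qed.

Lemma skew_cons2 (y z : 'I_n) W : (y < z)%N -> y \notin W -> z \notin W ->
  skew_sign K [:: y, z & enum W] =
  skew_sign K (y :: enum W) * skew_sign K (z :: enum W).
Proof.
move=> yz yW zW.
rewrite /skew_sign /= !inE !mem_enum yW zW enum_uniq -val_eqE ltn_eqF //=.
have N0 : ninv (enum W) = 0%N.
  have := sorted_enum_set W; elim: (enum W) => //= u s IH us.
  rewrite IH ?(path_sorted us) // addn0; apply/eqP.
  rewrite -leqn0 leqNgt -has_count; apply/hasPn => w ws.
  have tr : transitive (fun i j : 'I_n => i < j)%N by move=> ? ? ?; apply: ltn_trans.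
  by rewrite -leqNgt ltnW //; move/(order_path_min tr)/allP: us => /(_ w ws).
by rewrite yW N0 ltnNge (ltnW yz) /= !addn0 add0n exprD.
Qed.

Lemma minor_plucker M (a : quad n) :
  minor M (qi a |: qW a) * minor M (qtop a) -
  minor M (qj a |: qW a) * minor M (qi a |: (qx a |: qW a)) +
  minor M (qx a |: qW a) * minor M (qi a |: (qj a |: qW a)) = 0.
Proof.
have := sminor_plucker M (qi a) (qj a) (qx a) (enum (qW a)).
have ix := ltn_trans (qij a) (qjx a).
have E2 (y z : 'I_n) (S : {set 'I_n}) : [set u in [:: y, z & enum S]] = y |: (z |: S).
  by apply/setP=> u; rewrite !inE mem_enum.
rewrite !sminor_skew !set_cons_enum !E2 -/(qtop a).
rewrite !skew_cons2 ?(qij, qjx, qiW, qjW, qxW) //.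
set si := skew_sign K (qi a :: _); set sj := skew_sign K (qj a :: _).
set sx := skew_sign K (qx a :: _) => E.
have s0 : si * sj * sx != 0.
  have ne y : y \notin qW a -> skew_sign K (y :: enum (qW a)) != 0.
    by move=> yW; rewrite /skew_sign /= mem_enum yW enum_uniq signr_eq0.
  by rewrite !mulf_neq0 // ne ?(qiW, qjW, qxW).
by apply: (mulfI s0); rewrite mulr0 -[RHS]E; ring.
Qed.

End Plucker.

(** * Duality, and F as an element of the representation *)

Section Functional.

Variables (K : numFieldType) (N : nat).
Implicit Types (f g : {mpoly K[N]}) (psi : 'X_{1..N} -> K) (x : 'X_{1..N}).

Definition lfun psi f : K := \sum_(x <- msupp f) f@_x * psi x.

Lemma lfunE psi f (s : seq 'X_{1..N}) : uniq s -> {subset msupp f <= s} ->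
  lfun psi f = \sum_(x <- s) f@_x * psi x.
Proof.
move=> us sub; rewrite [RHS](bigID (mem (msupp f))) /= [X in _ + X]big1 ?addr0.
  rewrite -big_filter; apply: perm_big; apply: uniq_perm; rewrite ?filter_uniq //.
  by move=> x; rewrite mem_filter /=; case: (boolP (x \in msupp f)) => // /sub ->.
by move=> x /memN_msupp_eq0 ->; rewrite mul0r.
Qed.

Lemma lfun_is_linear psi : linear_for *%R (lfun psi).
Proof.
move=> c f g; pose s := undup (msupp f ++ msupp g ++ msupp (c *: f + g)).
have us : uniq s by apply: undup_uniq.
rewrite !(@lfunE psi _ s) //.
- rewrite mulr_sumr -big_split; apply: eq_bigr => x _ /=.
  by rewrite mcoeffD mcoeffZ mulrDl mulrA.
- by move=> x xf; rewrite mem_undup !mem_cat xf !orbT.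
- by move=> x xf; rewrite mem_undup !mem_cat xf.
- by move=> x xf; rewrite mem_undup !mem_cat xf !orbT.
Qed.

HB.instance Definition _ psi :=
  GRing.isLinear.Build K {mpoly K[N]} K *%R (lfun psi) (lfun_is_linear psi).

Lemma lfunX psi x : lfun psi 'X_[x] = psi x.
Proof. by rewrite /lfun msuppX big_seq1 mcoeffX eqxx mul1r. Qed.

Lemma eq_lfun psi psi' f : psi =1 psi' -> lfun psi f = lfun psi' f.
Proof. by move=> E; apply: eq_bigr => x _; rewrite E. Qed.

Lemma lfun_mulX psi k f : lfun psi ('X_[k] * f) = lfun (fun x => psi (k + x)%MM) f.
Proof.
rewrite {1}[f]mpolyE mulr_sumr raddf_sum; apply: eq_bigr => x _.
by rewrite /= -scalerAr linearZ /= -mpolyXD lfunX.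
Qed.

End Functional.

Section Pairing.

Variables (K : numFieldType) (n : nat).
Implicit Types (M : 'I_n -> nat -> K) (f g : Cpoly K n) (c : zvec n).

Notation NX := #|{: pset n}|.
Implicit Types (x : 'X_{1..NX}) (k l : 'I_NX).

(** Weighting the coefficients by x! makes multiplication by a variable adjoint
    to differentiation, hence E_{i,j} adjoint to E_{j,i}. *)
Definition dual f x : K := f@_x / vinvfact K (@zm n x).

Definition pair f : Cpoly K n -> K := lfun (dual f).

HB.instance Definition _ f := GRing.Linear.on (pair f).

Lemma pairC f g : pair f g = pair g f.
Proof.
pose s := undup (msupp f ++ msupp g); have us : uniq s by apply: undup_uniq.
rewrite /pair (@lfunE _ _ _ g s) // ?(@lfunE _ _ _ f s) //.
- by apply: eq_bigr => x _; rewrite /dual mulrCA.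
- by move=> x xf; rewrite mem_undup mem_cat xf.
- by move=> x xf; rewrite mem_undup mem_cat xf orbT.
Qed.

Lemma dual_deriv k f x : dual f^`M(k) x = dual f (x + U_(k))%MM.
Proof.
rewrite /dual mcoeff_deriv -[k in zm (x + U_(k))%MM]enum_valK.
have := vinvfactS K x (enum_val k); rewrite enum_valK => <-.
rewrite -[X in X / _]mulr_natr -[in X in _ / X]mulr_natr.
by rewrite -mulf_div divff ?mulr1 // pnatr_eq0.
Qed.

Lemma pair_deriv k f g : pair f^`M(k) g = pair f ('X_k * g).
Proof.
rewrite /pair lfun_mulX; apply: eq_lfun => x.
by rewrite dual_deriv addmC.
Qed.

Lemma pair_Eop i j f g : pair (Eop i j f) g = pair f (Eop j i g).
Proof.
rewrite pairC /Eop !raddf_sum /=; apply: eq_big => X; first exact: andbC.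
move=> _; rewrite /Aseq /dseq !set_cons_enum -!scalerAl -!scalerAr !linearZ /=.
rewrite mulrCA; congr (_ * (_ * _)); rewrite /Aset /dset.
case: insubP => [Xi _ _|_]; last first.
  by rewrite mul0r !raddf0; case: insubP => *; rewrite ?mulr0 ?raddf0.
case: insubP => [Xj _ _|_]; last by rewrite mulr0 mul0r !raddf0.
by rewrite -pair_deriv pairC -pair_deriv.
Qed.

Lemma pair_Ffun c g : pair (Ffun K c) g = lfun (fun x => phi K (@zm n x - c)) g.
Proof.
by apply: eq_lfun => x; rewrite /dual Ffun_coef mulfK // vinvfact_zm_neq0.
Qed.

Lemma pair_Ffun_mulX k c g :
  pair (Ffun K c) ('X_k * g) = pair (Ffun K (c - evec (val (enum_val k)))) g.
Proof.
rewrite -pair_deriv -dset_Ffun; last exact: (valP (enum_val k)).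
by rewrite /dset valK enum_valK.
Qed.

(** * Localization at the cluster variables *)

(** Both conditions define ideals: for the first, multiplication by a variable
    amounts to a shift of gamma.  Both ideals contain the three-term relations. *)
Definition negligible f :=
  (forall c, pair (Ffun K c) f = 0) /\ (forall M, f.@[pt M] = 0).

Lemma negligibleD f g : negligible f -> negligible g -> negligible (f + g).
Proof.
move=> [f1 f2] [g1 g2]; split=> [c|M]; last by rewrite mevalD f2 g2 addr0.
by rewrite raddfD /= f1 g1 addr0.
Qed.

Lemma negligible_mul p f : negligible f -> negligible (p * f).
Proof.
elim/mpoly_ring_ind: p f => [c|k|p q IHp IHq|p q IHp IHq] f.
- move=> [f1 f2]; rewrite mul_mpolyC; split=> [d|M]; last by rewrite mevalZ f2 mulr0.
  by rewrite linearZ /= f1 mulr0.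
- move=> [f1 f2]; split=> [c|M]; last by rewrite mevalM f2 mulr0.
  by rewrite pair_Ffun_mulX f1.
- by move=> cf; rewrite mulrDl; apply: negligibleD; [apply: IHp|apply: IHq].
- by move=> cf; rewrite -mulrA; apply/IHp/IHq.
Qed.

Lemma pair_Aset2 Y Y' c : proper_set Y -> proper_set Y' ->
  pair (Ffun K c) (Aset K Y * Aset K Y') = phi K (- c + (evec Y + evec Y')).
Proof.
move=> pY pY'; rewrite pair_Ffun (Aset_proper _ pY) (Aset_proper _ pY').
by rewrite -mpolyXD lfunX zmD !zmU !SubK addrC.
Qed.

Lemma negligible_quad (a : quad n) :
  negligible (Aset K (qi a |: qW a) * Aset K (qtop a) -
          Aset K (qj a |: qW a) * Aset K (qi a |: (qx a |: qW a)) +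
          Aset K (qx a |: qW a) * Aset K (qi a |: (qj a |: qW a))).
Proof.
split=> [c|M].
  rewrite raddfD raddfB /= !pair_Aset2 ?qproper //.
  by rewrite -vplusE -vminusE -vzeroE phi_plucker.
rewrite mevalD mevalB !mevalM !meval_Aset ?qproper //; exact: minor_plucker.
Qed.

Definition clpoly f := forall x k, f@_x != 0 -> x k != 0%N -> cluster (val (enum_val k)).

Lemma clpolyC (c : K) : clpoly c%:MP.
Proof.
move=> x k; rewrite mcoeffC; case: (eqVneq x 0%MM) => [->|_].
  by rewrite mnm0E.
by rewrite mulr0 eqxx.
Qed.

Lemma clpolyX k : cluster (val (enum_val k)) -> clpoly 'X_k.
Proof.
move=> ck x l; rewrite mcoeffX; case: (eqVneq U_(k)%MM x) => [<-|_]; last by rewrite eqxx.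
by rewrite mnm1E; case: (eqVneq k l) => [<-|].
Qed.

Lemma clpolyD f g : clpoly f -> clpoly g -> clpoly (f + g).
Proof.
move=> cf cg x k; rewrite mcoeffD => ne xk.
have [fx|] := eqVneq f@_x 0; last by move/cf; apply.
by move: ne; rewrite fx add0r => /cg; apply.
Qed.

Lemma clpolyM f g : clpoly f -> clpoly g -> clpoly (f * g).
Proof.
move=> cf cg x k; rewrite -mcoeff_msupp => /msuppM_le/allpairsP[[y z] /= [yf zg ->]].
rewrite mnmDE addn_eq0 negb_and => /orP[yk|zk].
  by apply: cf yk; rewrite -mcoeff_msupp.
by apply: cg zk; rewrite -mcoeff_msupp.
Qed.

(** Up to multiplication by a monomial, f is congruent to a polynomial in the
    cluster variables; the monomial itself has to be so as well, for the property
    to be stable under products and sums. *)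
Definition localizable f := exists u d p,
  [/\ clpoly d, clpoly p, negligible ('X_[u] - d) & negligible ('X_[u] * f - p)].

Lemma negligible0 : negligible 0.
Proof. by split=> [c|M]; rewrite ?raddf0 ?meval0. Qed.

Lemma localizable_clpoly f : clpoly f -> localizable f.
Proof.
move=> cf; exists 0%MM, 1, f; rewrite mpolyX0 mul1r !subrr.
split=> //; try exact: negligible0.
by rewrite -mpolyC1; apply: clpolyC.
Qed.

Lemma localizableM f g : localizable f -> localizable g -> localizable (f * g).
Proof.
move=> [u [d [p [cd cp ud up]]]] [u' [d' [p' [cd' cp' ud' up']]]].
exists (u + u')%MM, (d * d'), (p * p'); rewrite mpolyXD.
split; try exact: clpolyM.
  rewrite (_ : _ - _ = 'X_[u] * ('X_[u'] - d') + d' * ('X_[u] - d)); last by ring.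
  by apply: negligibleD; apply: negligible_mul.
rewrite (_ : _ - _ = ('X_[u] * f) * ('X_[u'] * g - p') + p' * ('X_[u] * f - p)).
  by apply: negligibleD; apply: negligible_mul.
by ring.
Qed.

Lemma localizableD f g : localizable f -> localizable g -> localizable (f + g).
Proof.
move=> [u [d [p [cd cp ud up]]]] [u' [d' [p' [cd' cp' ud' up']]]].
exists (u + u')%MM, (d * d'), (d' * p + d * p'); rewrite mpolyXD.
split; try by [apply: clpolyM|apply: clpolyD; apply: clpolyM].
  rewrite (_ : _ - _ = 'X_[u] * ('X_[u'] - d') + d' * ('X_[u] - d)); last by ring.
  by apply: negligibleD; apply: negligible_mul.
rewrite (_ : _ - _ = ('X_[u'] * ('X_[u] * f - p) + p * ('X_[u'] - d')) +
  ('X_[u] * ('X_[u'] * g - p') + p' * ('X_[u] - d))); last by ring.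
by apply: negligibleD; apply: negligibleD; apply: negligible_mul.
Qed.

(** The three-term relation expresses the product of the variable at qtop a with
    another variable by variables of sets of smaller element sum. *)
Lemma localizable_Aset Y : proper_set Y -> localizable (Aset K Y).
Proof.
have [m] := ubnP (rho Y); elim: m Y => // m IH Y; rewrite ltnS => Ym pY.
have [cY|ncY] := boolP (cluster Y).
  by apply: localizable_clpoly; rewrite (Aset_proper _ pY); apply: clpolyX; rewrite enum_rankK.
have [a Ea] := ncluster_qtop pY ncY.
have [h1 h2 h3 h4 h5] := rho_qtop a; rewrite Ea in h1 h2 h3 h4 h5.
have IHa Z : (rho Z < rho Y)%N -> proper_set Z -> localizable (Aset K Z).
  by move=> lt; apply: IH; apply: leq_trans lt Ym.
have lneg f : localizable f -> localizable (- f).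
  rewrite -mulN1r -[-1]opprK -mpolyC1 -!mpolyCN; apply: localizableM.
  exact/localizable_clpoly/clpolyC.
pose h := Aset K (qj a |: qW a) * Aset K (qi a |: (qx a |: qW a)) -
          Aset K (qx a |: qW a) * Aset K (qi a |: (qj a |: qW a)).
have [u [d [p [cd cp ud up]]]] : localizable h.
  apply: localizableD; first by apply: localizableM; apply: IHa; rewrite ?qproper.
  by apply/lneg/localizableM; apply: IHa; rewrite ?qproper.
have [u' [d' [p' [cd' cp' ud' up']]]] := IHa _ h1 (proper_iW a).
have ch := negligible_quad a; rewrite Ea in ch.
pose b := Aset K (qi a |: qW a).
exists (u + u' + U_(enum_rank (Sub _ (proper_iW a))))%MM, (d * p'), (d' * p).
rewrite !mpolyXD -(Aset_proper K (proper_iW a)) -/b.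
split; try exact: clpolyM.
  rewrite (_ : _ - _ = 'X_[u] * ('X_[u'] * b - p') + p' * ('X_[u] - d)); last by ring.
  by apply: negligibleD; apply: negligible_mul.
rewrite (_ : _ - _ = ('X_[u] * 'X_[u']) * (b * Aset K Y - h) +
  ('X_[u'] * ('X_[u] * h - p) + p * ('X_[u'] - d'))); last by ring.
apply: negligibleD; last by apply: negligibleD; apply: negligible_mul.
by apply: negligible_mul; rewrite /h opprB [_ - Aset K (qj a |: qW a) * _]addrC addrA.
Qed.

Lemma localizable_all f : localizable f.
Proof.
elim/mpoly_ring_ind: f => [c|k|f g|f g].
- exact/localizable_clpoly/clpolyC.
- have := localizable_Aset (valP (enum_val k)); rewrite Aset_val enum_valK; exact.
- exact: localizableD.
- exact: localizableM.
Qed.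

End Pairing.

Section ClusterVanishing.

Variables (K : numFieldType) (n : nat).
Implicit Types (L : 'I_n -> nat -> K) (f g : Cpoly K n).

Lemma digits_inj N B (x y : 'I_N -> nat) :
  (forall k, x k < B)%N -> (forall k, y k < B)%N ->
  (\sum_k x k * B ^ k = \sum_k y k * B ^ k)%N -> x =1 y.
Proof.
elim: N x y => [|N IH] x y xB yB; first by move=> _ [].
have B0 : (0 < B)%N by apply: leq_trans (xB ord0).
rewrite !big_ord_recl expn0 !muln1 => E.
have tailE (z : 'I_N.+1 -> nat) :
    (\sum_(k < N) z (lift ord0 k) * B ^ (lift ord0 k) =
     (\sum_(k < N) z (lift ord0 k) * B ^ k) * B)%N.
  by rewrite big_distrl; apply: eq_bigr => k _; rewrite /= expnSr mulnA.
rewrite !tailE in E.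
have E0 : x ord0 = y ord0.
  have := congr1 (modn^~ B) E.
  by rewrite ![(_ + _ * B)%N]addnC !modnMDl !modn_small.
have /eqP := E; rewrite E0 eqn_add2l eqn_pmul2r // => /eqP E1.
move=> k; case: (unliftP ord0 k) => [l ->|->] //.
exact: (IH (fun k => x (lift ord0 k)) (fun k => y (lift ord0 k))).
Qed.

(** Kronecker substitution: once B exceeds all the exponents in p, distinct
    monomials have distinct exponents of t, which are numbers written in base B. *)
Lemma mpoly_kronecker N (p : {mpoly K[N]}) :
  (forall B (t : K), t != 0 -> p.@[fun k => t ^+ (B ^ k)] = 0) -> p = 0.
Proof.
move=> p0; pose B := msize p.
pose w (x : 'X_{1..N}) := (\sum_k x k * B ^ k)%N.
pose q : {poly K} := \sum_(x <- msupp p) p@_x *: 'X^(w x).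
have qE t : t != 0 -> q.[t] = 0.
  move=> t0; rewrite -[RHS](p0 B t t0) mevalE horner_sum; apply: eq_bigr => x _.
  rewrite hornerZ hornerXn; congr (_ * _); rewrite /w -prodrXr.
  by apply: eq_bigr => k _; rewrite mulnC exprM.
have q0 : q = 0.
  apply: (@mulfI _ 'X); first by rewrite polyX_eq0.
  rewrite mulr0; apply: poly_horner_eq0 => t; rewrite hornerM hornerX.
  by have [->|/qE ->] := eqVneq t 0; rewrite ?mul0r ?mulr0.
apply/mpolyP => x; rewrite mcoeff0; apply/eqP/negPn/negP => px.
have xp : x \in msupp p by rewrite mcoeff_msupp.
have small (y : 'X_{1..N}) k : y \in msupp p -> (y k < B)%N.
  move=> yp; apply: leq_ltn_trans (msize_mdeg_lt yp).
  by rewrite mdegE (bigD1 k) //= leq_addr.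
have := congr1 (fun r : {poly K} => r`_(w x)) q0.
rewrite coef0 coef_sum (bigD1_seq x) ?msupp_uniq //= coefZ coefXn eqxx mulr1.
rewrite big_seq_cond big1 ?addr0 => [E|y /andP[yp yx]]; first by rewrite E eqxx in px.
rewrite coefZ coefXn; case: eqP => [E|_]; last by rewrite mulr0.
case/eqP: yx; apply/mnmP; apply: digits_inj (esym E) => k; exact: small.
Qed.

(** The minor on {1, ..., i} determines the product of the first i diagonal
    entries, after which the one on {1, ..., i, j} determines the entry (j, i + 1). *)
Lemma lower_cluster_values (c : {set 'I_n} -> K) : (forall Y, c Y != 0) ->
  exists L, [/\ forall (y : 'I_n) b, (y < b)%N -> L y b = 0,
    forall y : 'I_n, L y y != 0
    & forall Y, proper_set Y -> cluster Y -> minor L Y = c Y].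
Proof.
move=> c0; pose E k := if k is 0 then 1 else c (initset n k).
have E0 k : E k != 0 by case: k => [|k]; rewrite /E ?oner_eq0.
pose D a := E a.+1 / E a.
pose L (y : 'I_n) b :=
  if (b < y)%N then c (y |: initset n b) / E b else
  if (b == y)%N then D y else 0.
have LD (y : 'I_n) : L y y = D y by rewrite /L ltnn eqxx.
have Llow (y : 'I_n) b : (y < b)%N -> L y b = 0.
  by move=> yb; rewrite /L ltnNge (ltnW yb) /= (gtn_eqF yb).
exists L; split=> // [y|Y pY /clusterP[i [j [ij EY]]]].
  by rewrite LD /D mulf_neq0 ?invr_neq0.
rewrite EY (minor_lower Llow LD ij).
have -> : \prod_(0 <= a < i) D a = E i.
  elim: (val i) => [|k IH]; first by rewrite big_geq.
  by rewrite big_nat_recr //= IH /D mulrC divfK.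
move: ij; rewrite leq_eqVlt => /orP[/eqP/val_inj Eij|ij]; last first.
  by rewrite /L ij mulrC divfK.
rewrite -Eij LD /D mulrC divfK //= ; congr c.
by apply/setP=> y; rewrite in_setU1 !in_initset -val_eqE ltnS leq_eqVlt.
Qed.

Lemma clpoly_eq0 (p : Cpoly K n) : clpoly p ->
  (forall L, (forall (y : 'I_n) b, (y < b)%N -> L y b = 0) ->
     (forall y : 'I_n, L y y != 0) -> p.@[pt L] = 0) -> p = 0.
Proof.
move=> cp p0; apply: mpoly_kronecker => B t t0.
pose c (Y : {set 'I_n}) : K :=
  if (insub Y : option (pset n)) is Some X then t ^+ (B ^ (enum_rank X)) else 1.
have c0 Y : c Y != 0.
  by rewrite /c; case: insub => [X|]; rewrite ?oner_eq0 ?expf_neq0.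
have [L [Llow Ldiag Lc]] := lower_cluster_values c0.
rewrite -[RHS](p0 L Llow Ldiag) !mevalE; apply: eq_big_seq => x xp; congr (_ * _).
apply: eq_bigr => k _; have [->|xk] := eqVneq (x k) 0%N; first by rewrite !expr0.
congr (_ ^+ _); rewrite /pt Lc; first by rewrite /c valK enum_valK.
  exact: (valP (enum_val k)).
by apply: cp xk; rewrite -mcoeff_msupp.
Qed.

(** If g vanishes at the lower triangular matrices then so does its localization,
    which is a polynomial in cluster variables and hence zero; and multiplication
    by a monomial only shifts gamma. *)
Lemma pair_Ffun_eq0 g :
  (forall L, (forall (y : 'I_n) b, (y < b)%N -> L y b = 0) ->
     (forall y : 'I_n, L y y != 0) -> g.@[pt L] = 0) ->
  forall c, pair (Ffun K c) g = 0.
Proof.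
move=> g0 c; have [u [d [p [_ cp _ [up upM]]]]] := localizable_all g.
have p0 : p = 0.
  apply: clpoly_eq0 => // L Llow Ldiag.
  have := upM L; rewrite mevalB mevalM (g0 L) // mulr0 sub0r => /eqP.
  by rewrite oppr_eq0 => /eqP.
have := up (c + zm u); rewrite p0 subr0 !pair_Ffun lfun_mulX => <-.
apply: eq_lfun => x; congr (phi K _); rewrite zmD; move: (zm u) (zm x) => a b.
by rewrite opprD addrA [RHS]addrAC [a + b]addrC addrK.
Qed.

End ClusterVanishing.

Section Representation.

Variables (K : numFieldType) (n : nat) (m : 'I_n -> int).
Implicit Types (f g : Cpoly K n) (c z : zvec n).

Hypothesis hm0 : forall p : 'I_n, p.+1 = n -> m p = 0.

Notation NX := #|{: pset n}|.
Notation zm := (@zm n).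
Implicit Types (x y : 'X_{1..NX}) (X : pset n).

(** The monomials with the given upper row in their array: the highest vector has
    only such monomials, and the E_{i,j} preserve the cardinals of the sets. *)
Definition row_ok x := forall p : 'I_n, gtwt p n.-1 (zm x) = m p.

Definition row_homog f := forall x, f@_x != 0 -> row_ok x.

Lemma gtwt_top p (Y : {set 'I_n}) : proper_set Y ->
  gtwt p n.-1 (evec Y) = (p < #|Y|)%:R.
Proof. by move=> pY; rewrite /gtwt wt_evec // cnt_full // leqSpred. Qed.

Lemma row_homog_lin a f g : row_homog f -> row_homog g -> row_homog (a *: f + g).
Proof.
move=> hf hg x; rewrite mcoeffD mcoeffZ => ne.
have [fx|/hf//] := eqVneq f@_x 0.
by move: ne; rewrite fx mulr0 add0r => /hg.
Qed.

Lemma row_homog0 : row_homog 0.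
Proof. by move=> x; rewrite mcoeff0 eqxx. Qed.

Lemma row_homogZ a f : row_homog f -> row_homog (a *: f).
Proof. by move=> hf; rewrite -[_ *: _]addr0; apply/row_homog_lin/row_homog0. Qed.

Lemma row_homog_sum (I : finType) (P : pred I) (F : I -> Cpoly K n) :
  (forall i, P i -> row_homog (F i)) -> row_homog (\sum_(i | P i) F i).
Proof.
move=> hF; apply: big_ind => [|f g hf hg|//]; first exact: row_homog0.
by rewrite -[f]scale1r; apply: row_homog_lin.
Qed.

Lemma row_homog_Eop i j f : row_homog f -> row_homog (Eop i j f).
Proof.
move=> hf; apply: row_homog_sum => X /andP[iX jX].
rewrite /Aseq /dseq -scalerAl -scalerAr; do 2 apply: row_homogZ.
rewrite !set_cons_enum /Aset /dset.
case: insubP => [Xi _ Ei|_]; last by rewrite mul0r; apply: row_homog0.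
case: insubP => [Xj _ Ej|_]; last by rewrite mulr0; apply: row_homog0.
move=> x; rewrite -mcoeff_msupp mulrC (perm_mem (msuppMX _ _)) => /mapP[y].
rewrite mcoeff_msupp mcoeff_deriv => ne -> p.
have {}ne : f@_(y + U_(enum_rank Xj)) != 0 by apply: contraNneq ne => ->; rewrite mul0rn.
rewrite -[RHS](hf _ ne) !zmD !raddfD /= !zmU addrC; congr (_ + _).
rewrite !gtwt_top ?[proper_set _](valP Xi) ?[proper_set _](valP Xj) //.
by rewrite Ei Ej !cardsU1 iX jX.
Qed.

Definition initial (Y : {set 'I_n}) := [exists i : 'I_n, Y == initset n i.+1].

Lemma initsetS (i : 'I_n) : initset n i.+1 = i |: initset n i.
Proof. by apply/setP=> y; rewrite in_setU1 !in_initset -val_eqE ltnS leq_eqVlt. Qed.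

Lemma initial_row_inj z : (forall X, ~~ initial (val X) -> z X = 0) ->
  (forall p : 'I_n, gtwt p n.-1 z = 0) -> z = 0.
Proof.
move=> zi zrow; apply: cluster_gtwt_inj => [X ncl|p q pq].
  apply: zi; apply: contra ncl => /existsP[i /eqP ->].
  by apply/clusterP; exists i, i; rewrite initsetS.
rewrite -[RHS](zrow p); apply: eq_bigr => X _.
have [/existsP[i /eqP EX]|/zi ->] := boolP (initial (val X)); last by rewrite !mul0r.
rewrite EX !cnt_initset ?leqSpred //; last first.
  by rewrite prednK ?(leq_ltn_trans _ (ltn_ord p)).
congr (_ * (nat_of_bool _)%:R); have := ltn_ord i; have := ltn_ord q; lia.
Qed.

Definition diag_mx_of (d : 'I_n -> K) : 'I_n -> nat -> K :=
  fun u b => (u == b :> nat)%:R * d u.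

Lemma pt_diag0 d k : ~~ initial (val (enum_val k)) -> pt (diag_mx_of d) k = 0.
Proof.
move=> nk; apply: minor_diag0; apply: contra nk => /eqP E.
have := max_card (mem (val (enum_val k))); rewrite card_ord.
case Ec: #|val (enum_val k)| => [|i] lt.
  by have := valP (enum_val k); rewrite -cards_eq0 Ec eqxx.
by apply/existsP; exists (Ordinal lt); rewrite {1}E Ec.
Qed.

Lemma pt_id k : initial (val (enum_val k)) -> pt (diag_mx_of (fun=> 1)) k = 1.
Proof.
case/existsP => i /eqP E; rewrite /pt E initsetS.
rewrite (@minor_lower _ _ _ (fun=> 1)) //; last 2 first.
- by move=> y b yb; rewrite /diag_mx_of ltn_eqF // mul0r.
- by move=> y; rewrite /diag_mx_of eqxx mul1r.
by rewrite big1 // /diag_mx_of eqxx !mul1r.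
Qed.

Definition mnat (k : nat) : int := if (insub k : option 'I_n) is Some i then m i else 0.

Lemma mnatE (i : 'I_n) : mnat i = m i.
Proof. by rewrite /mnat valK. Qed.

Lemma mnat_n : mnat n = 0.
Proof. by rewrite /mnat insubN // ltnn. Qed.

Lemma big_succ (V : nmodType) (F : 'I_n -> V) (p : 'I_n) (lt : (p.+1 < n)%N) :
  \sum_(q < n | q == p.+1 :> nat) F q = F (Ordinal lt).
Proof. by apply: big_pred1 => q; rewrite /= -val_eqE. Qed.

Definition highest_vec : zvec n :=
  \sum_(p < n) \sum_(q < n | q == p.+1 :> nat) evec (initset n p.+1) *~ (m p - m q).

Lemma proper_initset (p q : 'I_n) : q = p.+1 :> nat -> proper_set (initset n p.+1).
Proof.
move=> E; apply: (@proper_setP _ _ p q); first by rewrite in_initset.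
by rewrite in_initset E ltnn.
Qed.

Lemma highest_vec_initial X : ~~ initial (val X) -> highest_vec X = 0.
Proof.
move=> nX; rewrite /highest_vec sum_ffunE big1 // => p _.
rewrite sum_ffunE big1 // => q _; rewrite ffunMzE evecE.
case: eqP => [E|_]; last by rewrite mul0rz.
by case/negP: nX; apply/existsP; exists p; rewrite E.
Qed.

Lemma highest_vec_row p : gtwt (p : 'I_n) n.-1 highest_vec = m p.
Proof.
rewrite /highest_vec raddf_sum /=.
have E (r : 'I_n) : gtwt p n.-1
    (\sum_(q < n | q == r.+1 :> nat) evec (initset n r.+1) *~ (m r - m q)) =
    (mnat r - mnat r.+1) * (p <= r)%:R.
  rewrite raddf_sum /=; have [lt|ge] := ltnP r.+1 n.
    rewrite big_succ raddfMz /= gtwt_top; last exact: (@proper_initset r (Ordinal lt)).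
    by rewrite card_initset // ltnS -[r.+1]/(val (Ordinal lt)) !mnatE -mulrzr intz mulrC.
  have En : r.+1 = n by apply/eqP; rewrite eqn_leq ge ltn_ord.
  rewrite En mnat_n mnatE hm0 // subrr mul0r big_pred0 // => q.
  by rewrite ltn_eqF.
rewrite (eq_bigr _ (fun r _ => E r)).
rewrite -(big_mkord xpredT (fun r => (mnat r - mnat r.+1) * (p <= r)%:R)).
suff H N : (p <= N)%N ->
    \sum_(0 <= r < N) (mnat r - mnat r.+1) * (p <= r)%:R = mnat p - mnat N.
  by rewrite H ?mnat_n ?subr0 ?mnatE // ltnW.
elim: N => [|N IH].
  by rewrite leqn0 => /eqP ->; rewrite big_geq // subrr.
rewrite big_nat_recr //= leq_eqVlt => /orP[/eqP E'|]; last first.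
  by rewrite ltnS => pN; rewrite IH // pN mulr1 addrA subrK.
rewrite -E' subrr big_nat big1 ?add0r => [|r /andP[_ rN]]; last first.
  by rewrite E' leqNgt ltnS (ltnW rN) mulr0.
by rewrite E' leqNgt ltnS leqnn mulr0.
Qed.

End Representation.

Section HighestVector.

Variables (K : numFieldType) (n : nat) (m : 'I_n -> int).
Implicit Types (f g : Cpoly K n) (c z : zvec n).

Hypothesis hm : forall p q : 'I_n, (p <= q)%N -> m q <= m p.
Hypothesis hm0 : forall p : 'I_n, p.+1 = n -> m p = 0.

Notation NX := #|{: pset n}|.
Notation zm := (@zm n).
Implicit Types (x : 'X_{1..NX}) (X : pset n).

Lemma highest_monomial : exists a x,
  [/\ a != 0, highest K m = a *: 'X_[x] & zm x = highest_vec m].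
Proof.
pose Q f z := exists a x, [/\ a != 0, f = a *: 'X_[x] & zm x = z].
have Q1 : Q 1 0.
  exists 1, 0%MM; rewrite oner_eq0 mpolyX0 scale1r; split=> //.
  by apply/ffunP=> X; rewrite !ffunE mnm0E.
have QM f z f' z' : Q f z -> Q f' z' -> Q (f * f') (z + z').
  move=> [a [x [a0 -> <-]]] [a' [x' [a0' -> <-]]].
  exists (a * a'), (x + x')%MM; rewrite mulf_neq0 // zmD mpolyXD.
  by rewrite -scalerAl -scalerAr scalerA.
apply: (big_ind2 Q) => // p _; apply: (big_ind2 Q) => // q /eqP Eq.
have pY := proper_initset Eq.
have : 0 <= m p - m q by rewrite subr_ge0 hm // Eq.
case: (m p - m q) => // e _; exists (invfact K e), (U_(enum_rank (Sub _ pY)) *+ e)%MM.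
split; first by rewrite /= invr_neq0 // pnatr_eq0 -lt0n fact_gt0.
  by rewrite (Aset_proper _ pY) mpolyXn.
rewrite -pmulrn; elim: e => [|e IH]; last by rewrite mulmS zmD zmU IH mulrS SubK.
by apply/ffunP=> X; rewrite !ffunE mnm0E.
Qed.

Lemma pair_scaleX a x g : pair (a *: 'X_[x]) g = a * dual g x.
Proof. by rewrite pairC linearZ /= /pair lfunX. Qed.

Lemma row_homog_highest : row_homog m (highest K m).
Proof.
have [a [x [a0 -> Ex]]] := highest_monomial => y.
rewrite mcoeffZ mcoeffX; case: (eqVneq x y) => [<-|_]; last by rewrite mulr0 eqxx.
by move=> _ p; rewrite Ex highest_vec_row.
Qed.

(** On diagonal matrices only the monomial of the highest vector survives. *)
Lemma meval_diag d g x : row_homog m g -> zm x = highest_vec m ->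
  g.@[pt (diag_mx_of d)] = g@_x * \prod_k pt (diag_mx_of d) k ^+ x k.
Proof.
move=> hg Ex; rewrite mevalE.
have other y : g@_y != 0 -> y != x -> \prod_k pt (diag_mx_of d) k ^+ y k = 0.
  move=> gy yx; have [/existsP[k /andP[yk nk]]|] :=
      boolP [exists k, (y k != 0%N) && ~~ initial (val (enum_val k))].
    by rewrite (bigD1 k) //= pt_diag0 // expr0n (negbTE yk) mul0r.
  rewrite negb_exists => /forallP H; case/eqP: yx; apply: (@zm_inj n).
  apply/eqP; rewrite -subr_eq0; apply/eqP; apply: initial_row_inj => [X nX|p].
    have -> : (zm y - zm x) X = zm y X - zm x X by rewrite !ffunE.
    rewrite Ex highest_vec_initial // subr0 zmE.
    by have := H (enum_rank X); rewrite enum_rankK nX andbT negbK => /eqP ->.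
  by rewrite raddfB /= (hg _ gy) Ex highest_vec_row // subrr.
have [xg|xg] := boolP (x \in msupp g); last first.
  rewrite (memN_msupp_eq0 xg) mul0r big_seq big1 // => y yg.
  rewrite other ?mulr0 -?mcoeff_msupp //.
  by apply: contraNneq xg => <-.
rewrite (bigD1_seq x) ?msupp_uniq //= -[RHS]addr0; congr (_ + _).
rewrite big_seq_cond; apply: big1 => y /andP[yg yx].
by rewrite other ?mulr0 // -mcoeff_msupp.
Qed.

Notation V := (gen_submodule (highest K m)).

Lemma genV_sub : is_submodule V.
Proof.
split=> [W [W0 _ _] _|a f g Vf Vg W Wsub Wh|i j f Vf W Wsub Wh] //.
  by have [_ WD _] := Wsub; apply: WD; [apply: Vf|apply: Vg].
by have [_ _ WE] := Wsub; apply: WE; apply: Vf.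
Qed.

Lemma genV_highest : V (highest K m).
Proof. by move=> W. Qed.

Lemma genV_homog f : V f -> row_homog m f.
Proof.
move=> Vf; apply: (Vf (row_homog m)); last exact: row_homog_highest.
split; [exact: row_homog0|exact: row_homog_lin|].
by move=> i j g; apply: row_homog_Eop.
Qed.

(** The representation is orthogonal to the relations between minors: these form
    a submodule which does not involve the monomial of the highest vector. *)
Lemma genV_orth_ker f g : V f -> row_homog m g -> (forall M, g.@[pt M] = 0) -> pair f g = 0.
Proof.
move=> Vf; move: g.
apply: (Vf (fun f => forall g, row_homog m g -> (forall M, g.@[pt M] = 0) -> pair f g = 0)).
  split=> [g _ _|a f1 f2 H1 H2 g hg g0|i j f1 H1 g hg g0].
  - by rewrite pairC raddf0.
  - by rewrite pairC linearD linearZ /= ![pair g _]pairC H1 // H2 // mulr0 addr0.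
  - by rewrite pair_Eop; apply: H1; [apply: row_homog_Eop|apply: ker_Eop].
move=> g hg g0; have [a [x [a0 -> Ex]]] := highest_monomial.
rewrite pair_scaleX /dual; have := g0 (diag_mx_of (fun=> 1)).
rewrite (meval_diag _ hg Ex) big1 ?mulr1 => [->|k _]; first by rewrite mul0r mulr0.
have [ik|nk] := boolP (initial (val (enum_val k))); first by rewrite pt_id // expr1n.
have := congr1 (fun z : zvec n => z (enum_val k)) Ex.
by rewrite highest_vec_initial // zmE enum_valK => -[->]; rewrite expr0.
Qed.

(** A polynomial orthogonal to the representation vanishes at the diagonal
    matrices, hence at the lower triangular ones, hence is orthogonal to the F. *)
Lemma orth_genV_Ffun g : row_homog m g -> (forall f, V f -> pair f g = 0) ->
  forall c, pair (Ffun K c) g = 0.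
Proof.
move=> hg Vg; apply: pair_Ffun_eq0 => L Llow Ldiag.
pose W g := row_homog m g /\ forall f, V f -> pair f g = 0.
have WE i j f : W f -> W (Eop i j f).
  move=> [hf Vf]; split; first exact: row_homog_Eop.
  have [_ _ VE] := genV_sub; move=> v Vv; rewrite -pair_Eop.
  by apply: Vf; apply: VE.
apply: (vanish_lower WE _ Llow Ldiag); last by split.
move=> d d0 f [hf Vf]; have [a [x [a0 Eh Ex]]] := highest_monomial.
rewrite -/(diag_mx_of d) (meval_diag _ hf Ex).
have /eqP := Vf _ genV_highest; rewrite Eh pair_scaleX mulf_eq0 (negbTE a0) /dual /=.
by rewrite mulf_eq0 invr_eq0 (negbTE (vinvfact_zm_neq0 _ _)) orbF => /eqP ->; rewrite mul0r.
Qed.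

End HighestVector.

Section Biorthogonal.

Variables (K : numFieldType) (n : nat).
Implicit Types (f g : Cpoly K n).

Notation NX := #|{: pset n}|.

Lemma subspace_rows N (U : 'rV[K]_N -> Prop) :
  U 0 -> (forall a u v, U u -> U v -> U (a *: u + v)) ->
  exists B : 'M[K]_N, forall v, U v <-> (v <= B)%MS.
Proof.
move=> U0 UD.
have UB r (B : 'M[K]_(r, N)) : (forall i, U (row i B)) -> forall v, (v <= B)%MS -> U v.
  move=> HB v /submxP[w ->]; rewrite mulmx_sum_row.
  apply: big_ind => [//|u v' Uu Uv|i _]; first by rewrite -[u]scale1r; apply: UD.
  by rewrite -[_ *: _]addr0; apply: UD.
suff H k : forall B : 'M[K]_N, (N - \rank B <= k)%N -> (forall v, (v <= B)%MS -> U v) ->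
    exists B : 'M[K]_N, forall v, U v <-> (v <= B)%MS.
  apply: (H N 0) => [|v]; first by rewrite leq_subr.
  by rewrite submx0 => /eqP ->.
elim: k => [|k IH] B rB BU.
  exists B => v; split=> [_|/BU//].
  by apply: submx_full; rewrite row_full_unit -row_free_unit -row_leq_rank -subn_eq0 -leqn0.
have [all|] := pselect (forall v, U v -> (v <= B)%MS); first by exists B => v; split=> [/all|/BU].
move=> nall; have [v [Uv vB]] : exists v, U v /\ ~~ (v <= B)%MS.
  apply: contrapT => H; apply: nall => v Uv; apply/negPn/negP => vB.
  by apply: H; exists v.
have lt : (B < B + v)%MS by rewrite ltmxE addsmxSl /= addsmx_sub submx_refl.
apply: (IH (B + v)%MS).
  by have := rank_ltmx lt; have := rank_leq_row (B + v)%MS; lia.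
move=> w /sub_addsmxP[[u1 u2] /= ->]; rewrite -[u1 *m B]scale1r; apply: UD.
  by apply: BU; apply: submxMl.
apply: (UB _ v) => [i|]; last exact: submxMl.
by rewrite (_ : row i v = v) //; apply/rowP => j; rewrite mxE ord1.
Qed.

(** The weights x! are invertible, so the pairing is nondegenerate on the span of
    any finite set s of monomials. *)
Lemma biorthogonal (s : seq 'X_{1..NX}) (V : Cpoly K n -> Prop) f :
  uniq s -> V 0 -> (forall a g h, V g -> V h -> V (a *: g + h)) ->
  (forall g, V g -> {subset msupp g <= s}) -> {subset msupp f <= s} ->
  (forall g, {subset msupp g <= s} -> (forall v, V v -> pair v g = 0) -> pair f g = 0) ->
  V f.
Proof.
move=> us V0 VD Vs fs H.
pose N := size s; pose xs (i : 'I_N) := tnth (in_tuple s) i.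
pose vec g : 'rV[K]_N := \row_i g@_(xs i).
pose pol (w : 'rV[K]_N) : Cpoly K n := \sum_i w 0 i *: 'X_[xs i].
have polK g : {subset msupp g <= s} -> pol (vec g) = g.
  move=> gs; rewrite /pol [RHS]mpolyE; under eq_bigr do rewrite mxE.
  rewrite -(big_tnth _ _ s xpredT (fun x => g@_x *: 'X_[x])).
  rewrite (bigID (mem (msupp g))) /= [X in _ + X]big1 ?addr0; last first.
    by move=> x /memN_msupp_eq0 ->; rewrite scale0r.
  rewrite -big_filter; apply: perm_big; apply: uniq_perm; rewrite ?filter_uniq //.
  by move=> x; rewrite mem_filter /=; case: (boolP (x \in msupp g)) => // /gs ->.
have polD a u v : pol (a *: u + v) = a *: pol u + pol v.
  rewrite /pol scaler_sumr -big_split; apply: eq_bigr => i _ /=.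
  by rewrite !mxE scalerDl scalerA.
have [|a u v|B BE] := @subspace_rows N (fun w => V (pol w)).
- by rewrite /pol big1 // => i _; rewrite mxE scale0r.
- by rewrite polD; apply: VD.
rewrite -(polK f fs); apply/BE; rewrite submxE; apply/eqP/rowP => k; rewrite [RHS]mxE.
(* A column of the cokernel of B, rescaled by the weights, is orthogonal to V *)
pose g : Cpoly K n := \sum_i (cokermx B i k * vinvfact K (@zm n (xs i))) *: 'X_[xs i].
have pairg v : pair v g = (vec v *m cokermx B) 0 k.
  rewrite mxE /g raddf_sum; apply: eq_bigr => i _.
  rewrite /= linearZ /= /pair lfunX /dual [vec v 0 i]mxE.
  have := vinvfact_zm_neq0 K (xs i); move: (vinvfact K _) => w w0; by field.
rewrite -pairg; apply: H => [x|v Vv].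
  move/msupp_sum_le; rewrite filter_predT => /flattenP[t /mapP[i _ ->]].
  by move/msuppZ_le; rewrite msuppX inE => /eqP ->; apply: mem_tnth.
have /BE : V (pol (vec v)) by rewrite polK // => x; apply: Vs.
by rewrite pairg submxE => /eqP ->; rewrite mxE.
Qed.

End Biorthogonal.

Section Membership.

Variables (K : numFieldType) (n : nat) (m : 'I_n -> int).

Hypothesis hn : (0 < n)%N.
Hypothesis hm : forall p q : 'I_n, (p <= q)%N -> m q <= m p.
Hypothesis hm0 : forall p : 'I_n, p.+1 = n -> m p = 0.

Notation NX := #|{: pset n}|.
Notation zm := (@zm n).

Lemma zdeg_zm (x : 'X_{1..NX}) : zdeg (zm x) = (mdeg x)%:Z.
Proof.
rewrite mdegE (reindex (@enum_rank (pset n))) /=; last first.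
  by apply: onW_bij; exact: enum_rank_bij.
rewrite /zdeg /wt -natz natr_sum; apply: eq_bigr => X _.
by rewrite mulr1 zmE natz.
Qed.

Lemma gtwt0_zm (x : 'X_{1..NX}) : gtwt 0 n.-1 (zm x) = (mdeg x)%:Z.
Proof.
rewrite -zdeg_zm; apply: eq_bigr => X _; congr (_ * _).
by rewrite cnt_full ?leqSpred // card_gt0; case/andP: (valP X) => ->.
Qed.

Lemma row_ok_seq : exists2 s : seq 'X_{1..NX}, uniq s & forall x, x \in s <-> row_ok m x.
Proof.
pose p0 : 'I_n := Ordinal hn; pose D := `|m p0|%N.
pose ok (x : 'X_{1..NX}) := [forall p : 'I_n, gtwt p n.-1 (zm x) == m p].
exists [seq val x | x <- enum {: 'X_{1..NX < D.+1}} & ok (val x)].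
  rewrite map_inj_uniq; last exact: val_inj.
  by rewrite filter_uniq // enum_uniq.
move=> x; split=> [/mapP[y]|rx].
  by rewrite mem_filter => /andP[/forallP oky _] -> p; apply/eqP.
have lt : (mdeg x < D.+1)%N by rewrite ltnS /D -(rx p0) gtwt0_zm.
apply/mapP; exists (BMultinom lt) => //; rewrite mem_filter mem_enum andbT.
by apply/forallP => p; rewrite rx.
Qed.

Lemma row_homog_Ffun c : (forall p : 'I_n, gtwt p n.-1 c = m p) -> row_homog m (Ffun K c).
Proof.
move=> hc x; rewrite Ffun_coef mulf_eq0 negb_or => /andP[/phi_neq0[s [t E]] _] p.
have := congr1 (@gtwt n p n.-1) E.
rewrite raddfD raddfB /= gtwt_tv gtwt_sr addr0 hc => /eqP.
by rewrite subr_eq0 => /eqP.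
Qed.

Theorem Ffun_genV c : (forall p : 'I_n, gtwt p n.-1 c = m p) ->
  gen_submodule (highest K m) (Ffun K c).
Proof.
move=> hc; have [s us sP] := row_ok_seq.
have homog_sub f : row_homog m f <-> {subset msupp f <= s}.
  split=> hf x; first by rewrite mcoeff_msupp => /hf/sP.
  by rewrite -mcoeff_msupp => /hf/sP.
have [V0 VD _] := genV_sub K m.
apply: (biorthogonal us V0 VD) => [g Vg||g gs Vg].
- exact/homog_sub/(genV_homog hm hm0 Vg).
- exact/homog_sub/row_homog_Ffun.
- by apply: (orth_genV_Ffun hm hm0) => //; apply/homog_sub.
Qed.

End Membership.

(** * Straightening *)

Section Garnir.

Variables (K : numFieldType) (n k l : nat) (v : 'I_k + 'I_l -> 'I_n).
Notation T := ('I_k + 'I_l)%type.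
Implicit Types (M : 'I_n -> nat -> K) (s : {perm T}).

Definition fseq r (u : 'I_r -> 'I_n) : seq 'I_n := [seq u a | a <- enum 'I_r].

Lemma size_fseq r (u : 'I_r -> 'I_n) : size (fseq u) = r.
Proof. by rewrite size_map size_enum_ord. Qed.

Lemma nth_fseq r (u : 'I_r -> 'I_n) x0 (a : 'I_r) : nth x0 (fseq u) a = u a.
Proof. by rewrite (nth_map a) ?size_enum_ord // nth_ord_enum. Qed.

Lemma eq_fseq r (u u' : 'I_r -> 'I_n) : u =1 u' -> fseq u = fseq u'.
Proof. by move=> E; apply: eq_map. Qed.

Lemma sminor_fseq M r (u : 'I_r -> 'I_n) :
  sminor M (fseq u) = \det (\matrix_(a < r, b < r) M (u a) b).
Proof. by apply: sminorE; [exact: size_fseq|exact: nth_fseq]. Qed.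

Lemma alternating_sum0 M (P : {set T}) (col : T -> nat) :
  (forall p, col p < k)%N -> (k < #|P|)%N ->
  \sum_(s | perm_on P s) (-1) ^+ s * \prod_p M (v (s p)) (col p) = 0.
Proof.
move=> colk kP.
have [p [q [pP qP pq Ecol]]] : exists p q, [/\ p \in P, q \in P, p != q & col p = col q].
  apply: contrapT => no.
  have inj : {in P &, injective (fun p => Ordinal (colk p))}.
    move=> p q pP qP /(congr1 val) /= E; apply/eqP/negPn/negP => pq.
    by apply: no; exists p, q.
  have := card_in_imset inj; move/eqP; rewrite eqn_leq => /andP[_].
  by rewrite leqNgt (leq_ltn_trans (max_card _)) ?card_ord.
set S := (X in X = 0).
have E : S = - S.
  rewrite {1}/S (reindex_inj (mulgI (tperm p q))) -sumrN; apply: eq_big => s.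
    have tP : perm_on P (tperm p q) 
      by apply/subsetP => y; rewrite inE; case: tpermP => [->|->|_ _] //; rewrite eqxx.
    apply/idP/idP => sP; last exact: perm_onM.
    by rewrite -[s](mulKg (tperm p q)) perm_onM // perm_onV.
  move=> _; rewrite odd_permM odd_tperm pq -mulNr signr_addb mulN1r.
  congr (_ * _); rewrite (reindex_inj (@perm_inj _ (tperm p q))).
  by apply: eq_bigr => y _; rewrite permM tpermK; case: tpermP => [->|->|] //; rewrite Ecol.
apply/eqP; move/eqP: E; rewrite -subr_eq0 opprK -mulr2n mulrn_eq0 /=.
by [].
Qed.

(** Garnir relations between minors: after expansion, each term antisymmetrizes
    over the positions in P, two of which carry the same column as P is larger
    than the number of columns. *)
Lemma garnir_minors M (P : {set T}) : (l <= k)%N -> (k < #|P|)%N ->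
  \sum_(s | perm_on P s) (-1) ^+ s *
    (sminor M (fseq (fun a => v (s (inl a)))) * sminor M (fseq (fun b => v (s (inr b))))) = 0.
Proof.
move=> lk kP.
pose col (t1 : 'S_k) (t2 : 'S_l) (p : T) : nat :=
  match p with inl a => t1 a | inr b => t2 b end.
have colk t1 t2 p : (col t1 t2 p < k)%N.
  by case: p => [a|b]; rewrite /col ?ltn_ord // (leq_trans (ltn_ord _)).
rewrite (eq_bigr (fun s : {perm T} => \sum_(t1 : 'S_k) \sum_(t2 : 'S_l)
    (-1) ^+ t1 * (-1) ^+ t2 *
    ((-1) ^+ s * \prod_p M (v (s p)) (col t1 t2 p)))) => [|s _].
  rewrite exchange_big big1 // => t1 _; rewrite exchange_big big1 // => t2 _.
  by rewrite -mulr_sumr alternating_sum0 ?mulr0.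
rewrite !sminor_fseq /determinant big_distrlr mulr_sumr; apply: eq_bigr => t1 _.
rewrite mulr_sumr; apply: eq_bigr => t2 _; rewrite big_sumType /=.
under eq_bigr do rewrite mxE.
under [X in _ * (_ * (_ * X))]eq_bigr do rewrite mxE.
have AC (a b c d e : K) : a * ((b * c) * (d * e)) = b * d * (a * (c * e)) by ring.
exact: AC.
Qed.

Lemma skew_fseq_tperm r (u : 'I_r -> 'I_n) a b : a != b ->
  skew_sign K (fseq (fun c => u (tperm a b c))) = - skew_sign K (fseq u).
Proof.
move=> ab; set u' := fun c => _.
have perm_u : perm_eq (fseq u') (fseq u).
  rewrite /fseq /u' (map_comp u (tperm a b)); apply/perm_map/uniq_perm.
  - by rewrite map_inj_uniq ?enum_uniq //; exact: perm_inj.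
  - exact: enum_uniq.
  move=> c; rewrite mem_enum; apply/mapP; exists (tperm a b c); last by rewrite tpermK.
  by rewrite mem_enum.
have [uu|nu] := boolP (uniq (fseq u)); last first.
  by rewrite /skew_sign (perm_uniq perm_u) (negbTE nu) oppr0.
have Eset : [set y in fseq u'] = [set y in fseq u].
  by apply/setP=> y; rewrite !inE (perm_mem perm_u).
(* The rows of M listed in u form the identity matrix, so that the sign can be
   compared on a nonzero minor. *)
pose M (y : 'I_n) (c : nat) : K := (index y (fseq u) == c)%:R.
have det1u : sminor M (fseq u) = 1.
  rewrite sminor_fseq -[RHS](det1 K r); congr (\det _); apply/matrixP => c d.
  rewrite !mxE /M -(nth_fseq u (u c) c) index_uniq ?size_fseq //.
have swap : sminor M (fseq u') = - sminor M (fseq u).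
  rewrite !sminor_fseq; set A := (X in _ = - \det X).
  have -> : (\matrix_(c, d) M (u' c) d) = tperm_mx a b *m A.
    by rewrite -row_permE; apply/matrixP => c d; rewrite !mxE.
  by rewrite det_mulmx det_perm odd_tperm ab expr1 mulN1r.
move: det1u swap; rewrite !sminor_skew Eset => E1 E2.
have ne0 : minor M [set y in fseq u] != 0.
  by apply: contraTneq (oner_neq0 K) => E0; rewrite -E1 E0 mulr0 eqxx.
by apply: (mulIf ne0); rewrite E2 mulNr.
Qed.

Definition is_left (p : T) := if p is inl _ then true else false.

(** The coefficient, in the Garnir relation, of the product of the two variables
    reached by s, including the signs from sorting their indices. *)
Definition gsign s : K :=
  (-1) ^+ s * (skew_sign K (fseq (fun a => v (s (inl a)))) *
               skew_sign K (fseq (fun b => v (s (inr b))))).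

Lemma gsign_tperm s p q : p != q -> is_left p = is_left q ->
  gsign (tperm p q * s) = gsign s.
Proof.
move=> pq lpq; rewrite /gsign odd_permM odd_tperm pq signr_addb expr1 mulN1r.
case: p q pq lpq => [a|b] [a'|b'] // ne _.
  have ab : a != a' by apply: contraNneq ne => ->.
  have E1 c : (tperm (inl a) (inl a') * s)%g (inl c) = s (inl (tperm a a' c)).
    rewrite permM; congr (s _); case: (tpermP a a' c) => [->|->|/eqP h1 /eqP h2].
    - exact: tpermL.
    - exact: tpermR.
    - by apply: tpermD; rewrite (inj_eq (@inl_inj _ _)) eq_sym.
  have E2 c : (tperm (inl a) (inl a') * s)%g (inr c) = s (inr c).
    by rewrite permM tpermD.
  rewrite (eq_fseq (fun c => congr1 v (E1 c))) (eq_fseq (fun c => congr1 v (E2 c))).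
  by rewrite (skew_fseq_tperm (fun c => v (s (inl c))) ab) [X in _ * X]mulNr mulrNN.
have ab : b != b' by apply: contraNneq ne => ->.
have E1 c : (tperm (inr b) (inr b') * s)%g (inr c) = s (inr (tperm b b' c)).
  rewrite permM; congr (s _); case: (tpermP b b' c) => [->|->|/eqP h1 /eqP h2].
  - exact: tpermL.
  - exact: tpermR.
  - by apply: tpermD; rewrite (inj_eq (@inr_inj _ _)) eq_sym.
have E2 c : (tperm (inr b) (inr b') * s)%g (inl c) = s (inl c).
  by rewrite permM tpermD.
rewrite (eq_fseq (fun c => congr1 v (E1 c))) (eq_fseq (fun c => congr1 v (E2 c))).
by rewrite (skew_fseq_tperm (fun c => v (s (inr c))) ab) [X in _ * X]mulrN mulrNN.
Qed.

(** A permutation which respects the two blocks of positions contributes the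
    sign of the identity, as it is undone by transpositions inside the blocks. *)
Lemma gsign_blocks s : (forall p, is_left (s p) = is_left p) -> gsign s = gsign 1%g.
Proof.
have [N] := ubnP #|[set p | s p != p]|; elim: N s => // N IH s.
rewrite ltnS => sN ls.
have [all|] := boolP [forall p, s p == p].
  by congr gsign; apply/permP => p; rewrite perm1; apply/eqP/(forallP all).
rewrite negb_forall => /existsP[p sp].
pose q := (s^-1)%g p.
have sq : s q = p by rewrite /q permKV.
have pq : p != q by apply: contra sp => /eqP E; rewrite {1}E sq.
have lpq : is_left p = is_left q by rewrite -(ls q) sq.
rewrite -(gsign_tperm s pq lpq); apply: IH => [|r].
  apply: leq_trans sN; apply: proper_card; apply/properP; split.
    apply/subsetP => r; rewrite !inE permM; case: tpermP => [-> _|->|//].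
      exact: sp.
    by move=> _; rewrite sq.
  by exists p; rewrite !inE ?permM ?tpermL ?sq ?eqxx.
by rewrite permM ls; case: tpermP => [->|->|].
Qed.

End Garnir.

Section Straightening.

Variables (K : numFieldType) (n : nat) (m : 'I_n -> int).
Implicit Types (f g : Cpoly K n) (X Y : pset n).

Notation NX := #|{: pset n}|.
Notation zm := (@zm n).
Implicit Types (x y : 'X_{1..NX}).

Lemma meval_Aseq (M : 'I_n -> nat -> K) (l : seq 'I_n) :
  (0 < size l < n)%N -> (Aseq K l).@[pt M] = sminor M l.
Proof.
move=> /andP[l0 ln]; rewrite sminor_skew /Aseq mevalZ /skew_sign.
case: ifPn => [ul|_]; last by rewrite !mul0r.
rewrite meval_Aset //; have El : #|[set y in l]| = size l by rewrite cardsE (card_uniqP ul).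
apply/andP; split; first by rewrite -cards_eq0 El -lt0n.
by apply: contraTneq ln => E; rewrite -El E cardsT card_ord ltnn.
Qed.

Lemma card_fseq r (u : 'I_r -> 'I_n) : uniq (fseq u) -> #|[set y in fseq u]| = r.
Proof. by move=> uu; rewrite cardsE (card_uniqP uu) size_fseq. Qed.

Lemma rho_fseq r (u : 'I_r -> 'I_n) : uniq (fseq u) ->
  rho [set y in fseq u] = (\sum_(a < r) u a)%N.
Proof.
move=> uu; rewrite /rho (eq_bigl (mem (fseq u))) => [|y]; last by rewrite inE.
by rewrite -big_uniq // /fseq big_map big_enum.
Qed.

(** A permutation of P which does not respect the blocks moves small elements
    to the left block and large ones out of it. *)
Lemma left_sum_lt k l (v : 'I_k + 'I_l -> 'I_n) (q : nat)
    (P : {set 'I_k + 'I_l}) (s : {perm 'I_k + 'I_l}) :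
  perm_on P s ->
  (forall p, p \in P -> if is_left p then (q <= v p)%N else (v p < q)%N) ->
  ~ (forall p, is_left (s p) = is_left p) ->
  (\sum_(a < k) v (s (inl a)) < \sum_(a < k) v (inl a))%N.
Proof.
move=> sP vP nblock.
pose A0 := [set p : 'I_k + 'I_l | is_left p]; pose A := s @: A0.
have sum_left (F : 'I_k + 'I_l -> nat) :
    (\sum_(a < k) F (inl a) = \sum_(p in A0) F p)%N.
  rewrite [RHS]big_mkcond [RHS]big_sumType /= [X in _ = (_ + X)%N]big1 ?addn0 => [|b _].
    by apply: eq_bigr => a _; rewrite inE.
  by rewrite inE.
rewrite (sum_left (fun p => v (s p))) (sum_left (fun p => v p)).
rewrite (_ : (\sum_(p in A0) v (s p) = \sum_(p in A) v p)%N); last first.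
  by rewrite big_imset //= => p p' _ _; apply: perm_inj.
have cA : #|A| = #|A0| by rewrite card_imset //; apply: perm_inj.
rewrite (big_setID A0) /= [ltnRHS](big_setID A) /= setIC ltn_add2l.
have cD : #|A :\: A0| = #|A0 :\: A| by rewrite !cardsD setIC cA.
have moved (p : 'I_k + 'I_l) : s p != p -> s p \in P.
  by move=> sp; rewrite (perm_closed _ sP); apply: (subsetP sP); rewrite inE.
have inA0 p : (p \in A0) = is_left p by rewrite inE.
have small p : p \in A :\: A0 -> (v p < q)%N.
  rewrite in_setD => /andP[pA0 /imsetP[p' p'A0 Ep]].
  have : p \in P by rewrite Ep moved // -Ep; apply: contraNneq pA0 => ->.
  by move=> pP; have := vP p pP; rewrite -inA0 (negbTE pA0).
have large p : p \in A0 :\: A -> (q <= v p)%N.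
  rewrite in_setD => /andP[pA pA0].
  have pP : p \in P.
    apply: (subsetP sP); rewrite inE; apply: contraNneq pA => Ep.
    by apply/imsetP; exists p.
  by have := vP p pP; rewrite -inA0 pA0.
have D0 : (0 < #|A :\: A0|)%N.
  rewrite card_gt0 setD_eq0; apply/negP => sub; apply: nblock => p.
  have EA : A = A0 by apply/eqP; rewrite eqEcard sub cA leqnn.
  have [pl|pr] := boolP (is_left p).
    by rewrite -inA0 -EA imset_f // inA0.
  apply: contraNF pr => spl; move: spl; rewrite -inA0 -EA => /imsetP[p' p'A0].
  by move/perm_inj ->; rewrite -inA0.
apply: (@leq_trans (\sum_(p in A :\: A0) (v p).+1)).
  under [X in (_ < X)%N]eq_bigr do rewrite -addn1.
  by rewrite big_split /= sum1_card -addn1 leq_add2l.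
apply: (@leq_trans (#|A :\: A0| * q)).
  by rewrite -sum_nat_const; apply: leq_sum => p /small.
by rewrite cD -sum_nat_const; apply: leq_sum => p /large.
Qed.

(** The factor 2 n^2 is at least twice any element sum.  Hence it is profitable to
    transfer some element sum from a larger set to a smaller one, and, the square
    being convex, between sets of equal size to the one of larger sum. *)
Definition pot (Y : {set 'I_n}) : int :=
  (rho Y)%:Z ^+ 2 + 2 * n%:Z ^+ 2 * ((n%:Z - #|Y|%:Z) * (rho Y)%:Z).

Lemma rho_bound (Y : {set 'I_n}) : (rho Y <= n * n)%N.
Proof.
rewrite /rho big_mkcond; apply: (@leq_trans (\sum_(y < n) n)).
  by apply: leq_sum => y _; case: ifP => // _; apply: ltnW.
by rewrite sum_nat_const card_ord.
Qed.

Lemma pot_exchange (X Y X' Y' : {set 'I_n}) :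
  #|X'| = #|X| -> #|Y'| = #|Y| -> (rho X' + rho Y' = rho X + rho Y)%N ->
  (rho X' < rho X)%N -> (#|Y| <= #|X|)%N -> (#|X| = #|Y| -> (rho X <= rho Y)%N) ->
  pot X + pot Y < pot X' + pot Y'.
Proof.
rewrite /pot => -> -> Es lt cXY tie; have bX := rho_bound X.
have [d [d0 EX EY]] : exists d : int,
    [/\ 0 < d, (rho X')%:Z = (rho X)%:Z - d & (rho Y')%:Z = (rho Y)%:Z + d].
  by exists ((rho X)%:Z - (rho X')%:Z); split; lia.
rewrite EX EY -subr_gt0.
move: (rho X) (rho Y) (#|X|) (#|Y|) bX tie cXY => a b k l ba tie kl.
rewrite (_ : _ - _ = d * (2 * (b%:Z - a%:Z + d) + 2 * n%:Z ^+ 2 * (k%:Z - l%:Z)));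
  last by ring.
apply: mulr_gt0 => //; move: kl; rewrite leq_eqVlt => /orP[/eqP E|lk].
  by rewrite E subrr mulr0 addr0; have := tie (esym E); lia.
have : 2 * n%:Z ^+ 2 * 1 <= 2 * n%:Z ^+ 2 * (k%:Z - l%:Z).
  by apply: ler_wpM2l; [rewrite mulr_ge0 ?sqr_ge0|lia].
have : a%:Z <= n%:Z ^+ 2 by rewrite expr2 -PoszM lez_nat.
by move: (n%:Z ^+ 2) => N2 h1 h2; lia.
Qed.

End Straightening.

Section StraighteningStep.

Variables (K : numFieldType) (n : nat) (m : 'I_n -> int).
Implicit Types (f g : Cpoly K n) (X Y : pset n).

Notation NX := #|{: pset n}|.
Notation zm := (@zm n).
Notation e X := (U_(enum_rank X))%MM.
Implicit Types (x y : 'X_{1..NX}).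

Variable f : Cpoly K n.
Hypothesis orth : forall g, row_homog m g -> (forall M, g.@[pt M] = 0) -> pair f g = 0.

Lemma row_ok_exchange y X Y X' Y' :
  #|val X'| = #|val X| -> #|val Y'| = #|val Y| ->
  row_ok m (y + (e X + e Y)) -> row_ok m (y + (e X' + e Y')).
Proof.
move=> EX EY H p; rewrite -(H p) !zmD !zmU !raddfD /=.
by rewrite !gtwt_top ?EX ?EY //; exact: valP.
Qed.

(** The Garnir relation for incomparable X and Y: the terms other than A_X A_Y
    have larger potential, and A_X A_Y itself occurs with a nonzero coefficient,
    all the block permutations contributing with the same sign. *)
Lemma garnir_step y X Y q :
  (#|val Y| <= #|val X|)%N ->
  (#|val X| = #|val Y| -> (rho (val X) <= rho (val Y))%N) ->
  (cnt (val X) q < cnt (val Y) q)%N ->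
  row_ok m (y + (e X + e Y)) ->
  (forall x, row_ok m x ->
     wt (@pot n) (zm (y + (e X + e Y))) < wt (@pot n) (zm x) -> dual f x = 0) ->
  dual f (y + (e X + e Y)) = 0.
Proof.
move=> cYX tie lt_cnt rx larger.
pose k := #|val X|; pose l := #|val Y|.
pose v (p : 'I_k + 'I_l) : 'I_n :=
  match p with inl a => enum_val a | inr b => enum_val b end.
(* The positions of the large elements of X and of the small elements of Y; as X
   has fewer small elements than Y, there are more than k of them *)
pose P : {set 'I_k + 'I_l} :=
  [set p | if is_left p then (q <= v p)%N else (v p < q)%N].
have vP p : p \in P -> if is_left p then (q <= v p)%N else (v p < q)%N by rewrite inE.
have count_lt (Z : {set 'I_n}) : (\sum_(z in Z) (z < q)%N = cnt Z q)%N.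
  rewrite /cnt -sum1_card [RHS](eq_bigl (fun z => (z \in Z) && (z < q)%N)); last first.
    by move=> z; rewrite !inE.
  by rewrite [RHS]big_mkcondr; apply: eq_bigr => z _; case: (z < q)%N.
have kP : (k < #|P|)%N.
  rewrite -sum1_card big_mkcond big_sumType /=.
  have -> : (\sum_(b < l) (if inr b \in P then 1 else 0) = cnt (val Y) q)%N.
    rewrite -count_lt [RHS]big_enum_val /=; apply: eq_bigr => b _.
    by rewrite inE /=; case: ltnP.
  have EX : (cnt (val X) q + \sum_(a < k) (if inl a \in P then 1 else 0) = k)%N.
    rewrite -count_lt [X in (X + _)%N]big_enum_val /= -big_split /=.
    rewrite -[RHS]card_ord -[RHS]sum1_card; apply: eq_bigr => a _.
    by rewrite inE /=; case: ltnP.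
  by rewrite -[ltnLHS]EX addnC ltn_add2l.
have kn : (0 < k < n)%N.
  rewrite card_gt0 -[X in (_ < X)%N]card_ord -cardsT.
  case/andP: (valP X) => -> /= XT; apply: proper_card.
  by rewrite properEneq XT subsetT.
have ln : (0 < l < n)%N.
  rewrite card_gt0 (leq_ltn_trans cYX) ?andbT; first by case/andP: (valP Y).
  by case/andP: kn.
pose lX (s : {perm 'I_k + 'I_l}) := fseq (fun a => v (s (inl a))).
pose lY (s : {perm 'I_k + 'I_l}) := fseq (fun b => v (s (inr b))).
pose g : Cpoly K n := \sum_(s | perm_on P s)
  (-1) ^+ s *: ('X_[y] * (Aseq K (lX s) * Aseq K (lY s))).
have g0 M : g.@[pt M] = 0.
  rewrite /g raddf_sum /= (eq_bigr (fun s : {perm 'I_k + 'I_l} =>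
      ('X_[y]).@[pt M] * ((-1) ^+ s * (sminor M (lX s) * sminor M (lY s))))).
    by rewrite -mulr_sumr garnir_minors ?mulr0.
  move=> s _; rewrite mevalZ !mevalM !meval_Aseq ?size_fseq //.
  by rewrite mulrCA.
have termE (s : {perm 'I_k + 'I_l}) : (-1) ^+ s *: ('X_[y] * (Aseq K (lX s) * Aseq K (lY s))) =
    gsign K v s *: ('X_[y] * (Aset K [set z in lX s] * Aset K [set z in lY s])).
  by rewrite /Aseq -!scalerAl -!scalerAr !scalerA /gsign.
have uniq_lX s : gsign K v s != 0 -> uniq (lX s).
  by apply: contraNT => nu; rewrite /gsign /skew_sign (negbTE nu) mul0r mulr0.
have uniq_lY s : gsign K v s != 0 -> uniq (lY s).
  by apply: contraNT => nu; rewrite /gsign /skew_sign (negbTE nu) !mulr0.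
have sets s : gsign K v s != 0 -> exists X' Y',
    [/\ val X' = [set z in lX s], val Y' = [set z in lY s],
        #|val X'| = k & #|val Y'| = l].
  move=> gs; have cX := card_fseq (uniq_lX s gs); have cY := card_fseq (uniq_lY s gs).
  have pcard (Z : {set 'I_n}) : (0 < #|Z| < n)%N -> proper_set Z.
    case/andP => Z0 Zn; rewrite /proper_set -card_gt0 Z0 /=.
    by apply: contraTneq Zn => ->; rewrite cardsT card_ord ltnn.
  have pX : proper_set [set z in lX s] by apply: pcard; rewrite cX.
  have pY : proper_set [set z in lY s] by apply: pcard; rewrite cY.
  by exists (Sub _ pX), (Sub _ pY); rewrite !SubK.
have hg : row_homog m g.
  apply: row_homog_sum => s _; rewrite termE.
  have [->|gs] := eqVneq (gsign K v s) 0; first by rewrite scale0r; apply: row_homog0.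
  have [X' [Y' [EX EY cX cY]]] := sets s gs.
  apply: row_homogZ; rewrite -EX -EY !Aset_val -!mpolyXD => x.
  rewrite mcoeffX; case: (eqVneq _ x) => [<- _|_]; last by rewrite eqxx.
  exact: row_ok_exchange cX cY rx.
have gs1 : gsign K v 1%g != 0.
  have inj r (u : 'I_r -> 'I_n) : injective u -> skew_sign K (fseq u) != 0.
    by move=> iu; rewrite /skew_sign map_inj_uniq // enum_uniq signr_eq0.
  rewrite /gsign !mulf_neq0 ?signr_eq0 // inj // => a b; rewrite !perm1;
    exact: enum_val_inj.
(* Block permutations reproduce A_X A_Y; any other one gives zero, a repeated
   index, or a monomial of larger potential *)
have pair_term (s : {perm 'I_k + 'I_l}) : perm_on P s ->
    pair f ((-1) ^+ s *: ('X_[y] * (Aseq K (lX s) * Aseq K (lY s)))) =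
    if [forall p, is_left (s p) == is_left p] then
      gsign K v 1%g * dual f (y + (e X + e Y)) else 0.
  move=> sP; rewrite termE linearZ /=.
  case: ifPn => [/forallP bl|nbl].
    have bls p : is_left (s p) = is_left p by apply/eqP.
    have gs : gsign K v s = gsign K v 1%g by apply: gsign_blocks.
    rewrite gs; congr (_ * _); rewrite -gs in gs1.
    have -> : [set z in lX s] = val X.
      apply/eqP; rewrite eqEcard (card_fseq (uniq_lX s gs1)) leqnn andbT.
      apply/subsetP => z; rewrite inE => /mapP[a _ ->].
      by case: (s (inl a)) (bls (inl a)) => // a' _; apply: enum_valP.
    have -> : [set z in lY s] = val Y.
      apply/eqP; rewrite eqEcard (card_fseq (uniq_lY s gs1)) leqnn andbT.
      apply/subsetP => z; rewrite inE => /mapP[b _ ->].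
      by case: (s (inr b)) (bls (inr b)) => // b' _; apply: enum_valP.
    by rewrite !Aset_val -!mpolyXD /pair lfunX.
  have [->|gs] := eqVneq (gsign K v s) 0; first by rewrite mul0r.
  have [X' [Y' [EX EY cX cY]]] := sets s gs.
  rewrite -EX -EY !Aset_val -!mpolyXD /pair lfunX larger ?mulr0 //.
    exact: row_ok_exchange cX cY rx.
  rewrite !zmD !zmU !raddfD /= ltrD2l !wt_evec ?[proper_set _](valP _) //.
  have sum_fseq r (u : 'I_r -> 'I_n) Z : Z = [set z in fseq u] -> uniq (fseq u) ->
      rho Z = (\sum_(a < r) u a)%N by move=> -> /rho_fseq.
  have rX' := sum_fseq _ _ _ EX (uniq_lX s gs).
  have rY' := sum_fseq _ _ _ EY (uniq_lY s gs).
  have rX : rho (val X) = (\sum_(a < k) v (inl a))%N.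
    by rewrite /rho [LHS]big_enum_val.
  have rY : rho (val Y) = (\sum_(b < l) v (inr b))%N.
    by rewrite /rho [LHS]big_enum_val.
  apply: pot_exchange => //.
    have split_sum (w : 'I_k + 'I_l -> nat) :
        (\sum_(a < k) w (inl a) + \sum_(b < l) w (inr b) = \sum_p w p)%N.
      by rewrite [RHS]big_sumType.
    rewrite rX' rY' rX rY (split_sum (fun p => v (s p))) (split_sum (fun p => v p)).
    by rewrite [RHS](reindex_inj (@perm_inj _ s)).
  rewrite rX' rX; apply: left_sum_lt sP vP _ => bl; move/negP: nbl; apply.
  by apply/forallP => p; rewrite bl.
have := orth hg g0; rewrite /g raddf_sum /= (eq_bigr _ pair_term).
rewrite -big_mkcondr sumr_const -mulr_natr => /eqP.
rewrite mulf_eq0 mulf_eq0 (negbTE gs1) /= pnatr_eq0 => /orP[/eqP //|].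
move/eqP/card0_eq/(_ 1%g); rewrite -topredE /= perm_on1 /= => /negP[].
by apply/forallP => p; rewrite perm1.
Qed.

End StraighteningStep.

Section Chains.

Variable n : nat.
Hypothesis hn : (0 < n)%N.
Implicit Types (X Y : pset n) (A B : {set 'I_n}).

Notation NX := #|{: pset n}|.
Notation zm := (@zm n).
Notation e X := (U_(enum_rank X))%MM.
Implicit Types (x y : 'X_{1..NX}).

(** The columns A, B of a tableau, in this order, form a semistandard tableau
    when A dominates B. *)
Definition dominates A B := [forall q : 'I_n.+1, (cnt B q <= cnt A q)%N].

Definition chain (z : zvec n) : Prop :=
  forall X Y, z X != 0 -> z Y != 0 ->
    dominates (val X) (val Y) || dominates (val Y) (val X).

Lemma dominatesP A B : reflect (forall q, (cnt B q <= cnt A q)%N) (dominates A B).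
Proof.
apply: (iffP forallP) => [H q|H q]; last exact: H.
have [qn|nq] := ltnP q n.+1; first exact: (H (Ordinal qn)).
rewrite !cnt_full ?(ltnW nq) //; have := H ord_max.
by rewrite !cnt_full.
Qed.

Lemma cnt_inj A B : (forall q : 'I_n, cnt A q.+1 = cnt B q.+1) -> A = B.
Proof.
move=> H; apply/setP => y.
have H0 : cnt A y = cnt B y.
  case: (val y) (ltn_ord y) => [_|q qn]; last exact: (H (Ordinal (ltnW qn))).
  by have := cnt_le A 0; have := cnt_le B 0; rewrite !leqn0 => /eqP -> /eqP ->.
by have := H y; rewrite !cntS H0 => /addIn; case: (y \in A); case: (y \in B).
Qed.

Section Straighten.

Variables (K : numFieldType) (m : 'I_n -> int).
Variable f : Cpoly K n.
Hypothesis orth : forall g, row_homog m g -> (forall M, g.@[pt M] = 0) -> pair f g = 0.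

(** By downward induction on the potential, which is bounded on the monomials of
    the given weight, garnir_step applies as long as two sets are incomparable. *)
Lemma straighten :
  (forall x, row_ok m x -> chain (zm x) -> dual f x = 0) ->
  forall x, row_ok m x -> dual f x = 0.
Proof.
move=> fchain; have [s us sP] := row_ok_seq m hn.
pose bound := \sum_(x <- s) `|wt (@pot n) (zm x)|.
have le_bound x : row_ok m x -> wt (@pot n) (zm x) <= bound.
  move=> /sP xs; apply: le_trans (ler_norm _) _.
  by rewrite /bound (bigD1_seq x) //= lerDl sumr_ge0.
suff H N x : row_ok m x -> bound - wt (@pot n) (zm x) < N%:Z -> dual f x = 0.
  move=> x rx; apply: (H `|bound - wt (@pot n) (zm x)|.+1 x rx).
  by move: (_ - _) => u; lia.
elim: N x => [|N IH] x rx lt.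
  by have := le_bound x rx; rewrite -subr_ge0 leNgt lt.
have larger x' : row_ok m x' -> wt (@pot n) (zm x) < wt (@pot n) (zm x') -> dual f x' = 0.
  move=> rx' gt; apply: IH => //; move: lt gt.
  by move: (wt _ _) (wt _ _) => u w; lia.
have [ch|nch] := pselect (chain (zm x)); first exact: fchain.
have step X Y : X != Y -> zm x X != 0 -> zm x Y != 0 ->
    (#|val Y| <= #|val X|)%N ->
    (#|val X| = #|val Y| -> (rho (val X) <= rho (val Y))%N) ->
    ~~ dominates (val X) (val Y) -> dual f x = 0.
  move=> XY xX xY cXY tie; rewrite negb_forall => /existsP[q]; rewrite -ltnNge => ltq.
  have lexy : (e X + e Y <= x)%MM.
    apply/mnm_lepP => k; rewrite mnmDE !mnm1E -[k]enum_valK !(inj_eq enum_rank_inj).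
    rewrite [x _]lock; have [EX|nX] := eqVneq X (enum_val k);
      have [EY|nY] := eqVneq Y (enum_val k); rewrite -?lock //=.
    - by rewrite EX EY eqxx in XY.
    - by rewrite addn0 -EX lt0n; move: xX; rewrite zmE; case: (x _).
    - by rewrite add0n -EY lt0n; move: xY; rewrite zmE; case: (x _).
  have Ex : x = ((x - (e X + e Y)) + (e X + e Y))%MM by rewrite submK.
  rewrite Ex; apply: (garnir_step orth cXY tie ltq); rewrite -Ex //.
apply: contrapT => nz; apply: nch => X Y xX xY; apply/negPn/negP.
rewrite negb_or => /andP[nXY nYX].
have XY : X != Y.
  by apply: contraNneq nXY => ->; apply/dominatesP.
have YX : Y != X by rewrite eq_sym.
apply: nz; case: (ltngtP #|val X| #|val Y|) => [lt'|gt|E].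
- by apply: (step Y X) => //; [exact: ltnW|move=> E; rewrite E ltnn in lt'].
- by apply: (step X Y) => //; [exact: ltnW|move=> E; rewrite E ltnn in gt].
case: (leqP (rho (val X)) (rho (val Y))) => [le|/ltnW le].
- by apply: (step X Y) => //; rewrite E.
- by apply: (step Y X) => //; rewrite E.
Qed.

End Straighten.

Lemma chain_sub x y : chain (zm (x + y)) -> chain (zm x).
Proof.
move=> ch X Y xX xY; apply: ch; rewrite zmE mnmDE.
  by move: xX; rewrite zmE; case: (x _).
by move: xY; rewrite zmE; case: (x _).
Qed.

(** The entry (p, q) is nonzero when some set of the chain has enough elements up
    to q, and then the largest set has. *)
Lemma chain_top x : chain (zm x) -> x != 0%MM ->
  exists X, x (enum_rank X) != 0%N /\
    forall p q : 'I_n, (p < cnt (val X) q.+1)%N = (gtwt p q (zm x) != 0).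
Proof.
move=> ch x0.
have [X0 xX0] : exists X, x (enum_rank X) != 0%N.
  apply: contrapT => no; case/eqP: x0; apply/mnmP => k; rewrite mnm0E.
  by apply/eqP/negPn/negP => xk; apply: no; exists (enum_val k); rewrite enum_valK.
pose h X := (\sum_(q < n.+1) cnt (val X) q)%N.
case: (@arg_maxnP _ X0 [pred X | x (enum_rank X) != 0%N] h xX0) => X /= xX maxX.
have top Y : x (enum_rank Y) != 0%N -> dominates (val X) (val Y).
  move=> xY; have : dominates (val X) (val Y) || dominates (val Y) (val X).
    by apply: ch; rewrite zmE; [move: xX|move: xY]; case: (x _).
  case/orP => // /dominatesP dYX; apply/forallP => q; rewrite leqNgt; apply/negP => ltq.
  have := maxX Y xY; apply/negP; rewrite -ltnNge /h (bigD1 q) //= [ltnRHS](bigD1 q) //=.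
  by rewrite -addSn leq_add //; apply: leq_sum => r _; apply: dYX.
exists X; split=> // p q; have [pX|Xp] := ltnP p (cnt (val X) q.+1); symmetry.
  rewrite gt_eqF // /gtwt /wt (bigD1 X) //= pX mulr1 ltr_wpDr //.
    by apply: sumr_ge0 => Y _; rewrite mulr_ge0 ?zm_ge0.
  by rewrite zmE ltz_nat lt0n.
apply/negbTE; rewrite negbK; apply/eqP; apply: big1 => Y _.
have [xY|xY] := eqVneq (x (enum_rank Y)) 0%N; first by rewrite zmE xY mul0r.
rewrite [(p < _)%N]leqNgt ltnS (leq_trans _ Xp) ?mulr0 //.
exact/dominatesP/top.
Qed.

(** The largest set of a chain is read off from its array; remove it and proceed by
    induction on the number of sets. *)
Lemma chain_inj x y : chain (zm x) -> chain (zm y) ->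
  (forall p q : 'I_n, (p <= q)%N -> gtwt p q (zm x) = gtwt p q (zm y)) -> x = y.
Proof.
have [N] := ubnP (mdeg x); elim: N x y => // N IH x y; rewrite ltnS => xN chx chy E.
have deg_eq : mdeg x = mdeg y.
  have lt : (n.-1 < n)%N by rewrite prednK.
  by apply/eqP; rewrite -eqz_nat -!gtwt0_zm (E (Ordinal hn) (Ordinal lt)).
have [x0|x0] := eqVneq x 0%MM.
  by apply/eqP; rewrite x0 eq_sym -mdeg_eq0 -deg_eq x0 mdeg0.
have y0 : y != 0%MM by rewrite -mdeg_eq0 -deg_eq mdeg_eq0.
have [X [xX HX]] := chain_top chx x0; have [Y [yY HY]] := chain_top chy y0.
have EXY : X = Y.
  apply/val_inj/cnt_inj => q.
  have Hp (p : 'I_n) : (p < cnt (val X) q.+1)%N = (p < cnt (val Y) q.+1)%N.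
    have [pq|qp] := leqP p q; first by rewrite HX HY E.
    by rewrite ![(p < _)%N]ltnNge !(leq_trans (cnt_le _ _) qp).
  have cn (Z : {set 'I_n}) : (cnt Z q.+1 <= n)%N := leq_trans (cnt_le Z q.+1) (ltn_ord q).
  apply/eqP; case: ltngtP => // lt.
    by have := Hp (Ordinal (leq_trans lt (cn _))); rewrite /= lt ltnn.
  by have := Hp (Ordinal (leq_trans lt (cn _))); rewrite /= lt ltnn.
have le_e (w : 'X_{1..NX}) : w (enum_rank X) != 0%N -> w = ((w - e X) + e X)%MM.
  by move=> wX; rewrite submK // lep1mP.
have Ex := le_e x xX; have Ey : y = ((y - e X) + e X)%MM by apply: le_e; rewrite EXY.
rewrite Ex Ey; congr (_ + _)%MM; apply: IH.
- apply: leq_trans xN; rewrite [in ltnRHS]Ex mdegD mdeg1 addn1; exact: leqnn.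
- by apply: (@chain_sub _ (e X)); rewrite -Ex.
- by apply: (@chain_sub _ (e X)); rewrite -Ey.
move=> p q pq; have := E p q pq; rewrite {1}Ex {1}Ey !zmD !raddfD /=.
exact: addIr.
Qed.

End Chains.

(** * Gelfand-Tsetlin diagrams and chains *)

Section Diagrams.

Variables (n : nat) (m : 'I_n -> int).
Hypothesis hn : (0 < n)%N.
Hypothesis hm : forall p q : 'I_n, (p <= q)%N -> m q <= m p.
Hypothesis hm0 : forall p : 'I_n, p.+1 = n -> m p = 0.

Notation NX := #|{: pset n}|.
Notation zm := (@zm n).
Notation e X := (U_(enum_rank X))%MM.
Implicit Types (x y : 'X_{1..NX}) (X Y : pset n).

Lemma gtwt_mono p q p' q' x :
  (forall Y : {set 'I_n}, (p < cnt Y q.+1)%N -> (p' < cnt Y q'.+1)%N) ->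
  gtwt p q (zm x) <= gtwt p' q' (zm x).
Proof.
move=> H; apply: ler_sum => X _; apply: ler_wpM2l; first exact: zm_ge0.
by have := H (val X); case: (p < _)%N => [->|_]; case: (p' < _)%N.
Qed.

Definition array x : 'M[int]_n :=
  \matrix_(p, q) if (p <= q)%N then gtwt p q (zm x) else 0.

Lemma array_GT x : row_ok m x -> is_GT m (array x).
Proof.
move=> rx; apply/and3P; split.
- apply/forallP => p; apply/forallP => q; apply/implyP => /eqP qn.
  have Eq : n.-1 = q by lia.
  have pq : (p <= q)%N by have := ltn_ord p; lia.
  by rewrite mxE pq -(rx p) Eq.
- apply/forallP => p; apply/forallP => q; apply/forallP => p'; apply/forallP => q'.
  apply/implyP => /and3P[pq /eqP Ep /eqP Eq].
  rewrite !mxE Ep Eq ltnS pq (leqW pq); apply/andP; split.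
    apply: gtwt_mono => Y; rewrite -Eq => lt.
    by rewrite -ltnS (leq_trans lt) // cnt_leS // -Eq.
  by apply: gtwt_mono => Y /leq_trans; apply; apply: cnt_mono; rewrite ltnW.
apply/forallP => p; apply/forallP => q; apply/implyP => qp.
by rewrite mxE leqNgt qp.
Qed.

Section OfDiagram.

Variable d : 'M[int]_n.
Hypothesis dGT : is_GT m d.

Lemma GT_top (p q : 'I_n) : q.+1 = n -> d p q = m p.
Proof.
move=> /eqP qn; case/and3P: dGT => /forallP/(_ p)/forallP/(_ q).
by rewrite qn => /eqP.
Qed.

Lemma GT_interlace (p q p' q' : 'I_n) :
  (p <= q)%N -> p' = p.+1 :> nat -> q' = q.+1 :> nat -> d p' q' <= d p q <= d p q'.
Proof.
move=> pq /eqP Ep /eqP Eq; case/and3P: dGT => _ + _.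
move=> /forallP/(_ p)/forallP/(_ q)/forallP/(_ p')/forallP/(_ q').
by rewrite pq Ep Eq.
Qed.

Lemma GT_low (p q : 'I_n) : (q < p)%N -> d p q = 0.
Proof.
move=> qp; case/and3P: dGT => _ _ /forallP/(_ p)/forallP/(_ q).
by rewrite qp => /eqP.
Qed.

Lemma GT_row_le (p q q' : 'I_n) : (p <= q)%N -> q' = q.+1 :> nat -> d p q <= d p q'.
Proof.
move=> pq Eq; have lt : (p.+1 < n)%N by have := ltn_ord q'; lia.
by case/andP: (@GT_interlace p q (Ordinal lt) q' pq erefl Eq).
Qed.

Lemma GT_diag_le (p q p' q' : 'I_n) :
  (p <= q)%N -> p' = p.+1 :> nat -> q' = q.+1 :> nat -> d p' q' <= d p q.
Proof. by move=> pq Ep Eq; case/andP: (GT_interlace pq Ep Eq). Qed.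

Lemma GT_bound (p q : 'I_n) : (p <= q)%N -> 0 <= d p q <= m (Ordinal hn).
Proof.
move Ek : (n.-1 - q)%N => k; elim: k p q Ek => [|k IH] p q Ek pq.
  have qn : q.+1 = n by have := ltn_ord q; lia.
  rewrite GT_top // hm // andbT.
  by rewrite -(hm0 qn) hm.
have qn : (q.+1 < n)%N by lia.
have pn : (p.+1 < n)%N by lia.
have /andP[_ h1] := IH p (Ordinal qn) ltac:(rewrite /=; lia) (leqW pq).
have /andP[h2 _] := IH (Ordinal pn) (Ordinal qn) ltac:(rewrite /=; lia) pq.
have /andP[h3 h4] := @GT_interlace p q (Ordinal pn) (Ordinal qn) pq erefl erefl.
by rewrite (le_trans h2 h3) (le_trans h4 h1).
Qed.

(** Column u of the partition formed by the entries of d of second index q - 1,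
    which is empty for q = 0. *)
Definition gtcol (u q : nat) : {set 'I_n} :=
  [set p : 'I_n | [exists r : 'I_n, [&& r.+1 == q, (p <= r)%N & u%:Z < d p r]]].

Lemma in_gtcolS u (r p : 'I_n) : (p \in gtcol u r.+1) = (p <= r)%N && (u%:Z < d p r).
Proof.
rewrite inE; apply/existsP/idP => [[r' /and3P[/eqP[/val_inj ->] -> ->]] //|H].
by exists r; rewrite eqxx.
Qed.

Lemma gtcol0 u : gtcol u 0 = set0.
Proof. by apply/setP => p; rewrite !inE; apply/existsP => -[r /andP[]]. Qed.

Lemma gtcol_pred u r (p p' : 'I_n) : (r <= n)%N ->
  p' = p.+1 :> nat -> p' \in gtcol u r -> p \in gtcol u r.-1.
Proof.
case: r => [|r] rn Ep; first by rewrite gtcol0 inE.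
rewrite -[r]/(val (Ordinal rn)) in_gtcolS /= Ep => /andP[pr ud].
case: r rn pr ud => // r rn pr ud; have rn' := ltnW rn.
rewrite -[r.+1]/((Ordinal rn').+1) in_gtcolS /= -ltnS pr /=.
by apply: lt_le_trans ud _; apply: GT_diag_le.
Qed.

Lemma gtcol_sub u r : (r < n)%N -> gtcol u r \subset gtcol u r.+1.
Proof.
case: r => [|r] rn; first by rewrite gtcol0 sub0set.
apply/subsetP => p; have rn' := ltnW rn.
have E1 := in_gtcolS u (Ordinal rn') p; have E2 := in_gtcolS u (Ordinal rn) p.
rewrite /= in E1 E2; rewrite E1 E2 => /andP[pr ud]; rewrite (leqW pr) /=.
by apply: lt_le_trans ud _; apply: GT_row_le.
Qed.

Lemma gtcol_down u r (p p' : 'I_n) : (r <= n)%N ->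
  (p <= p')%N -> p' \in gtcol u r -> p \in gtcol u r.
Proof.
move=> rn; move Ek : (p' - p)%N => k; elim: k p' Ek => [|k IH] p' Ek pp' H.
  by rewrite (_ : p = p') //; apply/val_inj/eqP; rewrite eqn_leq pp' -subn_eq0 Ek.
have lt : (p'.-1 < n)%N by have := ltn_ord p'; lia.
apply: (IH (Ordinal lt)); rewrite /=; [lia|lia|].
have := @gtcol_pred u r (Ordinal lt) p' rn; rewrite /= => /(_ ltac:(lia) H).
case: r rn {IH H} => [|r] rn; first by [].
exact/subsetP/gtcol_sub.
Qed.

Lemma gtcolE u r : (r <= n)%N -> gtcol u r = initset n #|gtcol u r|.
Proof.
move=> rn; set S := gtcol u r.
have cS : (#|S| <= n)%N by rewrite -[X in (_ <= X)%N]card_ord max_card.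
apply/eqP; rewrite eqEcard card_initset // leqnn andbT; apply/subsetP => p pS.
rewrite in_initset -[ltnLHS]/(val p) -ltnS -(card_initset (ltn_ord p)) ltnS.
apply: subset_leq_card; apply/subsetP => y; rewrite in_initset ltnS => yp.
exact: gtcol_down pS.
Qed.

Lemma in_gtcol u r (y : 'I_n) : (r <= n)%N -> (y \in gtcol u r) = (y < #|gtcol u r|)%N.
Proof. by move=> rn; rewrite {1}gtcolE // in_initset. Qed.

Lemma card_gtcolS u r : (r < n)%N ->
  (#|gtcol u r| <= #|gtcol u r.+1| <= #|gtcol u r|.+1)%N.
Proof.
move=> rn; rewrite subset_leq_card ?gtcol_sub //= leqNgt; apply/negP => lt.
have c1 : (#|gtcol u r.+1| <= n)%N by rewrite -[X in (_ <= X)%N]card_ord max_card.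
have p'n : (#|gtcol u r|.+1 < n)%N := leq_trans lt c1.
have pn := ltnW p'n.
have H : Ordinal p'n \in gtcol u r.+1 by rewrite in_gtcol.
have := @gtcol_pred u r.+1 (Ordinal pn) (Ordinal p'n) rn erefl H.
by rewrite /= in_gtcol ?(ltnW rn) //= ltnn.
Qed.

(** Column u of the semistandard tableau of d, which is filled in the order in which
    the successive partitions grow. *)
Definition tabcol u : {set 'I_n} := [set y : 'I_n | #|gtcol u y| < #|gtcol u y.+1|]%N.

Lemma cnt_tabcol u q : (q <= n)%N -> cnt (tabcol u) q = #|gtcol u q|.
Proof.
elim: q => [_|q IH qn].
  by apply/eqP; rewrite gtcol0 cards0 -leqn0 cnt_le.
rewrite -[q.+1 in LHS]/((Ordinal qn).+1) cntS /= IH ?(ltnW qn) // inE /=.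
have := card_gtcolS u qn; move: #|gtcol u q| #|gtcol u q.+1| => a b.
by case: (ltnP a b) => /=; lia.
Qed.

Lemma tabcol_lt u (p q : 'I_n) : (p <= q)%N ->
  (p < cnt (tabcol u) q.+1)%N = (u%:Z < d p q).
Proof.
move=> pq; rewrite cnt_tabcol // -in_gtcol //.
by rewrite in_gtcolS pq.
Qed.

Lemma proper_tabcol u : u%:Z < m (Ordinal hn) -> proper_set (tabcol u).
Proof.
move=> um; have lt : (n.-1 < n)%N by rewrite prednK.
have En : n.-1.+1 = n by rewrite prednK.
have c1 : (0 < cnt (tabcol u) n)%N.
  have := @tabcol_lt u (Ordinal hn) (Ordinal lt) isT.
  by rewrite GT_top /= ?En // um.
have c2 : (cnt (tabcol u) n < n)%N.
  have := @tabcol_lt u (Ordinal lt) (Ordinal lt) (leqnn _).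
  rewrite GT_top /= ?En // hm0 /= ?En //; have := cnt_le (tabcol u) n.
  by move: (cnt _ _) => c; lia.
rewrite cnt_full // in c1 c2; apply/andP; split; first by rewrite -card_gt0.
by apply: contraTneq c2 => ->; rewrite cardsT card_ord ltnn.
Qed.

Definition colmon (Y : {set 'I_n}) : 'X_{1..NX} :=
  if (insub Y : option (pset n)) is Some X then e X else 0%MM.

Lemma zm_colmon (Y : {set 'I_n}) : proper_set Y -> zm (colmon Y) = evec Y.
Proof. by move=> pY; rewrite /colmon insubT zmU SubK. Qed.

(** The semistandard monomial of d. *)
Definition gtmon : 'X_{1..NX} := (\sum_(u < `|m (Ordinal hn)|) colmon (tabcol u))%MM.

Lemma zm_gtmon : zm gtmon = \sum_(u < `|m (Ordinal hn)|) evec (tabcol u).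
Proof.
have m0 : 0 <= m (Ordinal hn).
  have lt : (n.-1 < n)%N by rewrite prednK.
  by rewrite -(hm0 (p := Ordinal lt)) ?hm //= prednK.
rewrite /gtmon; apply: (big_ind2 (fun x z => zm x = z)) => [|x z x' z' <- <-|u _].
- by apply/ffunP => X; rewrite !ffunE mnm0E.
- exact: zmD.
apply/zm_colmon/proper_tabcol; have := ltn_ord u; lia.
Qed.

Lemma sum_lt (N : nat) (D : int) : 0 <= D <= N%:Z ->
  \sum_(u < N) (u%:Z < D)%R%:R = D.
Proof.
case: D => // D /andP[_]; rewrite lez_nat => DN.
have H k : \sum_(u < k) (u%:Z < D%:Z)%R%:R = (minn k D)%:Z :> int.
  elim: k => [|k IH]; first by rewrite big_ord0 min0n.
  rewrite big_ord_recr /= IH ltz_nat; case: ltnP => h /=; lia.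
by rewrite H (minn_idPr DN).
Qed.

Lemma gtwt_gtmon (p q : 'I_n) : (p <= q)%N -> gtwt p q (zm gtmon) = d p q.
Proof.
move=> pq; have /andP[d0 dm] := GT_bound pq.
rewrite zm_gtmon raddf_sum /= (eq_bigr (fun u : 'I__ => (u%:Z < d p q)%R%:R)) => [|u _].
  by rewrite sum_lt // d0 gez0_abs // (le_trans d0).
rewrite /gtwt wt_evec ?tabcol_lt //; apply: proper_tabcol; have := ltn_ord u; lia.
Qed.

Lemma chain_gtmon : chain (zm gtmon).
Proof.
have col X : zm gtmon X != 0 -> exists u, val X = tabcol u.
  rewrite zm_gtmon sum_ffunE => H; apply: contrapT => no; case/eqP: H.
  by apply: big1 => u _; rewrite evecE; case: eqP => // E; case: no; exists u.
have dom u u' : (u <= u')%N -> dominates (tabcol u) (tabcol u').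
  move=> uu'; apply/forallP => q.
  have qn : (q <= n)%N by rewrite -ltnS ltn_ord.
  rewrite !cnt_tabcol //.
  apply: subset_leq_card; apply/subsetP => p; rewrite !inE.
  case/existsP => r /and3P[rq pr ud]; apply/existsP; exists r; rewrite rq pr /=.
  by apply: le_lt_trans ud; rewrite lez_nat.
move=> X Y /col[u ->] /col[u' ->]; case/orP: (leq_total u u') => /dom -> //.
by rewrite orbT.
Qed.

End OfDiagram.

End Diagrams.

(** * The basis *)

Section Basis.

Variables (K : numFieldType) (n : nat) (m : 'I_n -> int) (gamma : GTdiag m -> zvec n).
Hypothesis hn : (0 < n)%N.
Hypothesis hm : forall p q : 'I_n, (p <= q)%N -> m q <= m p.
Hypothesis hm0 : forall p : 'I_n, p.+1 = n -> m p = 0.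
Hypothesis hgamma : forall d : GTdiag m, is_shift (val d) (gamma d).

Notation NX := #|{: pset n}|.
Notation zm := (@zm n).
Implicit Types (d : GTdiag m) (l : seq (GTdiag m)).

Lemma gtwt_shift D g (p q : 'I_n) : is_shift D g -> (p <= q)%N -> gtwt p q g = D p q.
Proof.
move=> gD pq; rewrite -(gD p q pq) big_mkcond; apply: eq_bigr => X _.
by rewrite /cnt; case: (p < _)%N; rewrite ?mulr1 ?mulr0.
Qed.

Definition gtx d : 'X_{1..NX} := gtmon m hn (val d).

Lemma gtwt_gtx d (p q : 'I_n) : (p <= q)%N -> gtwt p q (zm (gtx d)) = val d p q.
Proof. exact: (gtwt_gtmon hn hm hm0 (valP d)). Qed.

Lemma diag_eq d d' : (forall p q : 'I_n, (p <= q)%N -> val d p q = val d' p q) -> d = d'.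
Proof.
move=> E; apply/val_inj/matrixP => p q; have [/E //|qp] := leqP p q.
by rewrite (GT_low (valP d) qp) (GT_low (valP d') qp).
Qed.

Lemma gtx_inj : injective gtx.
Proof. by move=> d d' E; apply: diag_eq => p q pq; rewrite -!gtwt_gtx // E. Qed.

Lemma gtx_row_ok d : row_ok m (gtx d).
Proof.
move=> p; have lt : (n.-1 < n)%N by rewrite prednK.
rewrite (@gtwt_gtx d p (Ordinal lt)); last by have := ltn_ord p; rewrite /=; lia.
by apply: (GT_top (valP d)); rewrite /= prednK.
Qed.

Lemma row_ok_gtx x : row_ok m x -> chain (zm x) -> exists d, gtx d = x.
Proof.
move=> rx chx; exists (Sub (array x) (array_GT hn rx)); apply: (chain_inj hn).
- exact: (chain_gtmon hm hm0 (array_GT hn rx)).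
- exact: chx.
by move=> p q pq; rewrite gtwt_gtx // mxE pq.
Qed.

Lemma diag_seq : exists2 l : seq (GTdiag m), uniq l & forall d, d \in l.
Proof.
have [s us sP] := row_ok_seq m hn; have [l ul lP] := preimage_seq s gtx_inj.
by exists l => // d; apply: lP; apply/sP/gtx_row_ok.
Qed.

Lemma gtx_gamma d : exists t, zm (gtx d) - gamma d = tv t.
Proof.
apply: gtwt_eq0_tv => p q pq; rewrite raddfB /= gtwt_gtx //.
by rewrite (gtwt_shift (hgamma d) pq) subrr.
Qed.

Lemma sqwt_gamma d : sqwt (gamma d) = sqwt (zm (gtx d)).
Proof.
have [t E] := gtx_gamma d; apply/eqP; rewrite eq_sym -subr_eq0 -raddfB /= E.
by rewrite sqwt_tv.
Qed.

Definition Fco d' d : K := phi K (zm (gtx d) - gamma d').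

Lemma Fco_diag d : Fco d d = 1.
Proof. by have [t E] := gtx_gamma d; rewrite /Fco E phi_tv. Qed.

(** The terms of F with s nonzero lie lower for sqwt, and those with s = 0 keep
    the array. *)
Lemma Fco_tri d' d : Fco d' d != 0 ->
  d' = d \/ sqwt (zm (gtx d)) < sqwt (zm (gtx d')).
Proof.
move=> /phi_neq0[s [t E]].
have [s0|s0] := lerP (sqwt (sr s)) 0; [left|right].
  have Et : zm (gtx d) - gamma d' = tv t by rewrite -E (sqwt_sr_eq0 s0) sr0 addr0.
  apply: diag_eq => p q pq; rewrite -(gtwt_gtx d pq) -(gtwt_shift (hgamma d') pq).
  by apply/eqP; rewrite eq_sym -subr_eq0 -raddfB /= Et gtwt_tv.
have := congr1 (@sqwt n) E; rewrite raddfD raddfB /= sqwt_tv sqwt_gamma.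
by move: s0; move: (sqwt _) (sqwt _) (sqwt _) => a b c; lia.
Qed.

(** Unitriangularity: at a diagram of largest sqwt among those with nonzero
    coefficient, a single term survives. *)
Lemma Fco_inj l (c : GTdiag m -> K) : uniq l ->
  (forall d, d \in l -> \sum_(d' <- l) c d' * Fco d' d = 0) ->
  forall d, d \in l -> c d = 0.
Proof.
move=> ul H.
pose bound := \sum_(d <- l) `|sqwt (zm (gtx d))|.
suff ind N d : d \in l -> bound - sqwt (zm (gtx d)) < N%:Z -> c d = 0.
  move=> d dl; apply: (ind `|bound - sqwt (zm (gtx d))|.+1 d dl).
  by move: (_ - _) => u; lia.
elim: N d => [|N IH] d dl lt.
  have : sqwt (zm (gtx d)) <= bound.
    by apply: le_trans (ler_norm _) _; rewrite /bound (bigD1_seq d) //= lerDl sumr_ge0.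
  by rewrite -subr_ge0 leNgt lt.
have := H d dl; rewrite (bigD1_seq d) //= Fco_diag mulr1 big_seq_cond big1 ?addr0 //.
move=> d' /andP[d'l dd']; have [->|F0] := eqVneq (Fco d' d) 0; first by rewrite mulr0.
case: (Fco_tri F0) => [E|gt]; first by rewrite E eqxx in dd'.
rewrite IH ?mul0r //; move: lt gt; move: (sqwt _) (sqwt _) => u w; lia.
Qed.

Notation V := (gen_submodule (highest K m)).
Notation F d := (Ffun K (gamma d)).

Lemma dual_lin (f g : Cpoly K n) a x : dual (a *: f + g) x = a * dual f x + dual g x.
Proof. by rewrite /dual mcoeffD mcoeffZ mulrDl mulrA. Qed.

Lemma dual_sum l (c : GTdiag m -> K) d :
  dual (\sum_(d' <- l) c d' *: F d') (gtx d) = \sum_(d' <- l) c d' * Fco d' d.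
Proof.
elim: l => [|d' l IH]; first by rewrite !big_nil /dual mcoeff0 mul0r.
rewrite !big_cons dual_lin IH /dual Ffun_coef mulfK //.
exact: vinvfact_zm_neq0.
Qed.

Lemma F_in_V d : V (F d).
Proof.
apply: (Ffun_genV hn hm hm0) => p; have lt : (n.-1 < n)%N by rewrite prednK.
rewrite (@gtwt_shift (val d) _ p (Ordinal lt) (hgamma d)); last first.
  by have := ltn_ord p; rewrite /=; lia.
by apply: (GT_top (valP d)); rewrite /= prednK.
Qed.

(** Elements of the representation are determined by the coefficients at the
    monomials of the diagrams, as there are no other chains. *)
Lemma V_eq0 f : V f -> (forall d, dual f (gtx d) = 0) -> f = 0.
Proof.
move=> Vf fd.
have f0 x : row_ok m x -> dual f x = 0.
  apply: (straighten hn) => [g|y ry /(row_ok_gtx ry)[d <-] //].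
  exact: (genV_orth_ker hm hm0).
apply/mpolyP => x; rewrite mcoeff0; apply/eqP/negPn/negP => fx.
have /eqP := f0 x (genV_homog hm hm0 Vf fx).
by rewrite /dual mulf_eq0 invr_eq0 (negbTE fx) (negbTE (vinvfact_zm_neq0 _ _)).
Qed.

Theorem Ffun_basis : is_basis V (fun d => F d).
Proof.
split; first exact: F_in_V.
  move=> l c ul sum0; apply: Fco_inj ul _ => d dl.
  by rewrite -dual_sum sum0 /dual mcoeff0 mul0r.
move=> f Vf; have [l ul lP] := diag_seq.
pose dd (i : 'I_(size l)) := tnth (in_tuple l) i.
have dd_inj i j : (dd i == dd j) = (i == j).
  by apply: inj_eq; apply/tuple_uniqP.
have extend (v : 'rV[K]_(size l)) : exists c, forall i, c (dd i) = v 0 i.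
  exists (fun d => \sum_i (dd i == d)%:R * v 0 i) => i.
  rewrite (bigD1 i) //= eqxx mul1r big1 ?addr0 // => j ji.
  by rewrite dd_inj (negbTE ji) mul0r.
pose A : 'M[K]_(size l) := \matrix_(i, j) Fco (dd i) (dd j).
have mulA (v : 'rV[K]_(size l)) c : (forall i, c (dd i) = v 0 i) ->
    forall j, (v *m A) 0 j = \sum_(d <- l) c d * Fco d (dd j).
  move=> cv j; rewrite mxE (big_tnth _ _ l); apply: eq_bigr => i _.
  by rewrite mxE -cv.
have unitA : A \in unitmx.
  rewrite -row_free_unit; apply: inj_row_free => v vA; have [c cv] := extend v.
  apply/rowP => i; rewrite mxE -cv; apply: (Fco_inj ul) => [d dl|]; last exact: mem_tnth.
  have [j Ej] : exists j, d = dd j.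
    by case/(tnthP (in_tuple l)): dl => j Ej; exists j.
  by rewrite Ej -(mulA v c cv) vA mxE.
(* As A is invertible, a combination of the F matches the coefficients of f at the
   monomials of the diagrams *)
have [c cE] := extend ((\row_j dual f (gtx (dd j))) *m invmx A).
exists l, c; apply/eqP; rewrite -subr_eq0; apply/eqP.
have [_ VD _] := genV_sub K m.
have Vsum : V (\sum_(d <- l) c d *: F d).
  elim: (l) => [|d l' IH]; first by rewrite big_nil; have [] := genV_sub K m.
  by rewrite big_cons; apply: VD IH; apply: F_in_V.
apply: V_eq0 => [|d]; first by rewrite addrC -scaleN1r; apply: VD.
have [j ->] : exists j, d = dd j.
  by case/(tnthP (in_tuple l)): (lP d) => j Ej; exists j.
rewrite addrC -scaleN1r dual_lin dual_sum -(mulA _ c cE) mulmxKV // mxE.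
by rewrite mulN1r addNr.
Qed.

End Basis.

Unset Implicit Arguments.

Theorem lemma7p1 (R : realType) (n : nat) (m : 'I_n -> int)
    (gamma : GTdiag m -> zvec n)
    (hn : (2 <= n)%N)
    (hm : forall p q : 'I_n, (p <= q)%N -> m q <= m p)
    (hm0 : forall p : 'I_n, p.+1 = n -> m p = 0)
    (hgamma : forall d : GTdiag m, is_shift (val d) (gamma d)) :
  is_basis (gen_submodule (highest R[i] m))
    (fun d : GTdiag m => Ffun R[i] (gamma d)) /\
  (forall (i j : 'I_n) (d : GTdiag m),
     Eop i j (Ffun R[i] (gamma d)) =
     \sum_(X : {set 'I_n} | (i \notin X) && (j \notin X))
       Aseq R[i] (i :: enum X) *
       (skew_sign R[i] (j :: enum X) *: Ffun R[i] (gamma d - evec (j |: X)))).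
Proof.
have n0 : (0 < n)%N by apply: leq_trans hn.
split; first exact: (Ffun_basis R[i] n0 hm hm0 hgamma).
by move=> i j d; apply: Eop_Ffun.
Qed.
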